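(* Fix $r\in\mathbb{N}$, $d>0$ and a spin structure on $\Gamma_r\backslash G$ given by $\delta=(\delta_1,\delta_2,\delta_3)\in\{-1,1\}^3$ (with $\delta_3=1$ if $r$ is odd). If the Heisenberg manifold $M(r,d,T)$ collapses to the 2-torus, i.e. if $T\to0$, then the Dirac eigenvalues of $M(r,d,T)$ (numbered, with multiplicities, as continuous functions of $T\in(0,\infty)$) behave as follows. **A.** If $\delta_3=+1$: there are eigenvalues converging to those of the Dirac operator of the 2-torus (with limits being precisely the Dirac eigenvalues of the torus), and all other eigenvalues tend to $\pm\infty$. **B.** If $\delta_3=-1$: all eigenvalues tend to $\pm\infty$.
   Context: $G$ is the 3-dimensional Heisenberg group of matrices $g(x,y,z)=\begin{pmatrix}1&x&z\\0&1&y\\0&0&1\end{pmatrix}$, with Lie algebra spanned by the left invariant fields $X,Y,Z$ (elementary matrices with a single entry $1$ in position $(1,2)$, $(2,3)$, $(1,3)$). $\Gamma_r=\{g(rx,y,z)\mid x,y,z\in\mathbb{Z}\}$. $M(r,d,T)$ is $\Gamma_r\backslash G$ with the metric induced by the left invariant metric on $G$ for which $e_1=-dX$, $e_2=-dY$, $e_3=T^{-1}Z$ is an orthonormal (positively oriented) frame. It is a circle bundle, via $g(x,y,z)\mapsto(x,y)$, over the flat torus $T^2=\mathbb{R}^2/(r\mathbb{Z}\oplus\mathbb{Z})$ with metric $d^{-2}(dx^2+dy^2)$, and its fiber length is proportional to $T$. Spin structures on $\Gamma_r\backslash G$ correspond to homomorphisms $\epsilon:\Gamma_r\to\{-1,1\}$,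 $\epsilon(g(rx,y,z))=\delta_1^x\delta_2^y\delta_3^z$ ($x,y,z\in\mathbb{Z}$); spinor fields are maps $\sigma:G\to\Sigma_3$ with $\sigma(g_0g)=\epsilon(g_0)\sigma(g)$ for $g_0\in\Gamma_r$. In case A the torus carries the spin structure given by the homomorphism $r\mathbb{Z}\oplus\mathbb{Z}\to\{-1,1\}$ with $(r,0)\mapsto\delta_1$, $(0,1)\mapsto\delta_2$; its Dirac eigenvalues are $\pm2\pi d\sqrt{\alpha^2+\beta^2}$ with $\alpha\in\frac1{2r}\mathbb{Z}$, $e^{2\pi ir\alpha}=\delta_1$, $\beta\in\frac12\mathbb{Z}$, $e^{2\pi i\beta}=\delta_2$. *)

(* Defs.v *)
From Stdlib Require Import Reals ZArith List Arith Lra Lia.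
From Coquelicot Require Import Coquelicot.
Open Scope R_scope.

Ltac entrywise :=
  cbv -[Rplus Rmult Ropp Rinv IZR];
  repeat match goal with |- (_, _) = _ => apply f_equal2 end.

(** * The Heisenberg group and its Lie algebra *)

(** The triple [(x, y, z)] stands for the matrix [g(x,y,z)]; using triples makes
    the group a normed module, so that smoothness is smoothness on R^3. *)
Definition heis : Type := (R * R * R)%type.

Definition heis_matrix (p : heis) : matrix 3 3 :=
  let '(x, y, z) := p in
  mk_matrix 3 3 (fun i j =>
    match i, j with
    | 0, 1 => x
    | 1, 2 => y
    | 0, 2 => z
    | _, _ => if Nat.eqb i j then 1%R else 0%R
    end)%nat.

Definition heis_mul (p q : heis) : heis :=
  let '(x, y, z) := p in
  let '(x', y', z') := q in (x + x', y + y', z + z' + x * y').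

Lemma heis_matrix_mul (p q : heis) :
  heis_matrix (heis_mul p q) = Mmult (heis_matrix p) (heis_matrix q).
Proof.
  destruct p as [[x y] z], q as [[x' y'] z'].
  entrywise; try reflexivity; field.
Qed.

(** The triple [(a, b, c)] stands for [a X + b Y + c Z]. *)
Definition heis_lie : Type := (R * R * R)%type.

Definition lieX : heis_lie := (1, 0, 0).
Definition lieY : heis_lie := (0, 1, 0).
Definition lieZ : heis_lie := (0, 0, 1).

Definition lie_matrix (A : heis_lie) : matrix 3 3 :=
  let '(a, b, c) := A in
  mk_matrix 3 3 (fun i j =>
    match i, j with
    | 0, 1 => a
    | 1, 2 => b
    | 0, 2 => c
    | _, _ => 0%R
    end)%nat.

Definition lie_bracket (A B : heis_lie) : heis_lie :=
  let '(a, b, c) := A in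
  let '(a', b', c') := B in (0, 0, a * b' - a' * b).

Lemma lie_matrix_bracket (A B : heis_lie) :
  lie_matrix (lie_bracket A B) =
  minus (Mmult (lie_matrix A) (lie_matrix B)) (Mmult (lie_matrix B) (lie_matrix A)).
Proof.
  destruct A as [[a b] c], B as [[a' b'] c'].
  entrywise; try reflexivity; field.
Qed.

Definition lie_exp (A : heis_lie) : heis :=
  let '(a, b, c) := A in (a, b, c + a * b / 2).

(** The exponential series stops after the quadratic term. *)
Lemma heis_matrix_exp (A : heis_lie) :
  heis_matrix (lie_exp A) =
  plus (plus Mone (lie_matrix A))
       (Mmult (lie_matrix (scal (/ 2) A)) (lie_matrix A)).
Proof.
  destruct A as [[a b] c].
  entrywise; try reflexivity; field.
Qed.

(** * Spinors *)

Definition spinor : Type := (C * C)%type.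

(** Clifford multiplication by the [i]-th vector ([i = 0, 1, 2]) of a positively
    oriented orthonormal frame, with [e_i e_j + e_j e_i = - 2 delta_ij] and
    [e_1 e_2 e_3 = 1].  The other irreducible module, with [e_1 e_2 e_3 = -1], is
    obtained by changing the sign of every [clifford i], which replaces the Dirac
    operator by its negative. *)
Definition clifford (i : nat) (s : spinor) : spinor :=
  let '(u, v) := s in
  match i with
  | 0%nat => ((Ci * v)%C, (Ci * u)%C)
  | 1%nat => (v, (- u)%C)
  | _ => ((Ci * u)%C, (- (Ci * v))%C)
  end.

Lemma clifford_relation (i j : nat) (s : spinor) : (i < 3)%nat -> (j < 3)%nat ->
  plus (clifford i (clifford j s)) (clifford j (clifford i s)) =
  scal (if Nat.eqb i j then RtoC (-2) else RtoC 0) s.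
Proof.
  intros Hi Hj; destruct s as [[u1 u2] [v1 v2]].
  destruct i as [|[|[|i]]]; [| | |lia];
  (destruct j as [|[|[|j]]]; [| | |lia]);
  entrywise; ring.
Qed.

Lemma clifford_volume (s : spinor) :
  clifford 0 (clifford 1 (clifford 2 s)) = s.
Proof.
  destruct s as [[u1 u2] [v1 v2]].
  entrywise; ring.
Qed.

Definition derive_C (f : R -> C) (t : R) : C :=
  (Derive (fun s => Re (f s)) t, Derive (fun s => Im (f s)) t).

Definition derive_spinor (f : R -> spinor) (t : R) : spinor :=
  (derive_C (fun s => fst (f s)) t, derive_C (fun s => snd (f s)) t).

Fixpoint is_Ck {V W : NormedModule R_AbsRing} (k : nat) (F : V -> W) : Prop :=
  (forall p, continuous F p) /\
  match k with
  | 0%nat => True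
  | S k' => forall v : V, exists F' : V -> W,
      (forall p, is_derive (fun t : R => F (plus p (scal t v))) 0 (F' p)) /\
      is_Ck k' F'
  end.

Definition smooth {V W : NormedModule R_AbsRing} (F : V -> W) : Prop :=
  forall k, is_Ck k F.

(** * The Dirac operator of M(r,d,T) *)

Definition heis_frame (d T : R) (i : nat) : heis_lie :=
  match i with
  | 0%nat => scal (- d) lieX
  | 1%nat => scal (- d) lieY
  | _ => scal (/ T) lieZ
  end.

Definition heis_metric (d T : R) (A B : heis_lie) : R :=
  let '(a, b, c) := A in
  let '(a', b', c') := B in (a * a' + b * b') / d ^ 2 + T ^ 2 * (c * c').

Lemma heis_frame_orthonormal (d T : R) (i j : nat) :
  0 < d -> 0 < T -> (i < 3)%nat -> (j < 3)%nat ->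
  heis_metric d T (heis_frame d T i) (heis_frame d T j) =
  if Nat.eqb i j then 1 else 0.
Proof.
  intros Hd HT Hi Hj.
  destruct i as [|[|[|i]]]; [| | |lia];
  (destruct j as [|[|[|j]]]; [| | |lia]);
  cbv -[Rplus Rmult Ropp Rinv IZR Rlt] in *; field; lra.
Qed.

(** [<nabla_{e_i} e_j, e_k>] for the Levi-Civita connection, by the Koszul formula
    for left invariant fields. *)
Definition heis_connection (d T : R) (i j k : nat) : R :=
  let e := heis_frame d T in
  let br a b c := heis_metric d T (lie_bracket (e a) (e b)) (e c) in
  / 2 * (br i j k - br j k i + br k i j).

Definition left_invariant_derivative (A : heis_lie) (s : heis -> spinor)
    (p : heis) : spinor :=
  derive_spinor (fun t => s (heis_mul p (lie_exp (scal t A)))) 0.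

(** Spinor fields are written in the trivialization induced by the left invariant
    frame. *)
Definition spinor_connection (d T : R) (i : nat) (s : heis -> spinor)
    (p : heis) : spinor :=
  plus (left_invariant_derivative (heis_frame d T i) s p)
    (scal (RtoC (/ 4))
      (sum_n (fun j => sum_n (fun k =>
         scal (RtoC (heis_connection d T i j k)) (clifford j (clifford k (s p))))
       2) 2)).

Definition heis_dirac (d T : R) (s : heis -> spinor) (p : heis) : spinor :=
  sum_n (fun i => clifford i (spinor_connection d T i s p)) 2.

Definition heis_equivariant (r : nat) (d1 d2 d3 : R) (s : heis -> spinor) : Prop :=
  forall (x y z : Z) (p : heis),
    s (heis_mul (INR r * IZR x, IZR y, IZR z) p) =
    scal (RtoC (powerRZ d1 x * powerRZ d2 y * powerRZ d3 z)) (s p).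

Definition heis_eigenspace (r : nat) (d1 d2 d3 d T mu : R)
    (s : heis -> spinor) : Prop :=
  smooth s /\ heis_equivariant r d1 d2 d3 s /\
  forall p, heis_dirac d T s p = scal (RtoC mu) (s p).

(** * The Dirac operator of the flat torus *)

Definition torus_derivative (v : R * R) (s : R * R -> spinor) (p : R * R) : spinor :=
  derive_spinor (fun t => s (plus p (scal t v))) 0.

(** The metric is [d^-2 (dx^2 + dy^2)], with parallel orthonormal frame
    [d * d/dx, d * d/dy]; [clifford 0] and [clifford 1] make [C^2] the spinor
    module of dimension two. *)
Definition torus_dirac (d : R) (s : R * R -> spinor) (p : R * R) : spinor :=
  plus (clifford 0 (torus_derivative (d, 0) s p))
       (clifford 1 (torus_derivative (0, d) s p)).

Definition torus_equivariant (r : nat) (d1 d2 : R) (s : R * R -> spinor) : Prop :=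
  forall (x y : Z) (p : R * R),
    s (plus (INR r * IZR x, IZR y) p) =
    scal (RtoC (powerRZ d1 x * powerRZ d2 y)) (s p).

Definition torus_eigenspace (r : nat) (d1 d2 d mu : R) (s : R * R -> spinor) : Prop :=
  smooth s /\ torus_equivariant r d1 d2 s /\
  forall p, torus_dirac d s p = scal (RtoC mu) (s p).

Definition torus_eigenvalue (r : nat) (d1 d2 d mu : R) : Prop :=
  exists s, torus_eigenspace r d1 d2 d mu s /\ exists p, s p <> zero.

(** * Multiplicities and numbered families of eigenvalues *)

Fixpoint lincomb {A : Type} (n : nat) (c : nat -> C) (b : nat -> A -> spinor)
    (p : A) : spinor :=
  match n with
  | 0%nat => zero
  | S m => plus (lincomb m c b p) (scal (c m) (b m p))
  end.

Definition has_dim {A : Type} (E : (A -> spinor) -> Prop) (n : nat) : Prop :=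
  exists b : nat -> A -> spinor,
    (forall s, E s <-> exists c, forall p, s p = lincomb n c b p) /\
    (forall c, (forall p, lincomb n c b p = zero) ->
       forall i, (i < n)%nat -> c i = RtoC 0).

Definition has_card (P : nat -> Prop) (n : nat) : Prop :=
  exists l : list nat, NoDup l /\ length l = n /\ forall j, In j l <-> P j.

Definition dirac_numbering (r : nat) (d1 d2 d3 d : R) (ev : nat -> R -> R) : Prop :=
  (forall j T, 0 < T -> continuous (ev j) T) /\
  (forall T, 0 < T -> forall mu, exists n,
     has_dim (heis_eigenspace r d1 d2 d3 d T mu) n /\
     has_card (fun j => ev j T = mu) n).

Definition collapse_limit (f : R -> R) (l : Rbar) : Prop :=
  filterlim f (at_right 0) (Rbar_locally l).

Definition collapse_infinite (f : R -> R) : Prop :=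
  collapse_limit f p_infty \/ collapse_limit f m_infty.

(* Main.v *)
Require Import Defs.
From Stdlib Require Import FinFun Cantor Reals Ranalysis5 ZArith List Arith Lra Lia Psatz.
From Stdlib Require Import FunctionalExtensionality Classical ClassicalEpsilon.
From Coquelicot Require Import Coquelicot.
Open Scope R_scope.

(* In the left invariant frame the Dirac operator is a first order operator plus the
   constant d^2 T / 4.  Decompose an eigensection into Fourier modes along the fibre.
   The modes of frequency 0, present only for delta_3 = 1, descend to the torus; they are
   its eigensections, with the torus eigenvalue shifted by d^2 T / 4.  For a frequency
   tau <> 0 the equivariance under the lattice turns the remaining Fourier coefficients
   into translates of a bounded solution of a harmonic oscillator, that is of a Hermite
   function, so that the eigensection is a theta series and its eigenvalue is
   d^2 T / 4 +- sqrt ((2 pi tau / T)^2 + 4 pi d^2 |tau| k).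
   Hence at every T a continuous branch of eigenvalues, minus d^2 T / 4, either is one of
   the discretely many torus eigenvalues or has absolute value at least pi / T.  By the
   intermediate value theorem, if it is smaller than pi / T_0 in absolute value somewhere
   on (0, T_0], it is constant there; if it never is, it tends to infinity with a fixed
   sign. *)

(** * Calculus in normed modules *)

(** No Hilbert space theory is used: that the explicit sections span an eigenspace is not read off
    from an orthonormal basis. Each section gets a dual linear functional built from Fourier
    integrals and point evaluation. Inside one eigenspace sections and functionals are biorthogonal,
    and an eigensection killed by all functionals has only zero Fourier coefficients, hence
    vanishes. This needs uniqueness of Fourier coefficients, but no convergence of Fourier series. A
    second obstacle is that the claim concerns every continuous numbering, whose branches may switch
    between the explicit families where these cross. Only the set of possible values at each [T] is
    known. Discreteness is made quantitative by scaling: for a shifted branch [f], the number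
    [(f r / (pi d))^2] is an integer at every torus value. Multiplicities of limits are compared at
    a single parameter: a branch has limit [mu] exactly if its value at [T_0 = pi / (|mu| + 1)] is
    [mu + d^2 T_0 / 4], and the eigensections for that value all come from the torus. *)

Ltac eqR := match goal with |- @eq _ ?x ?y => change (@eq R x y) end; cbv beta.

Ltac eqC := match goal with |- @eq _ ?x ?y => change (@eq C x y) end; cbv beta.

Lemma choice {A B : Type} (P : A -> B -> Prop) :
  (forall x, exists y, P x y) -> exists f, forall x, P x (f x).
Proof.
  intros H. exists (fun x => proj1_sig (constructive_indefinite_description _ (H x))).
  intros x. apply proj2_sig.
Qed.

Lemma Ceq (z w : C) : Re z = Re w -> Im z = Im w -> z = w.
Proof. destruct z, w; unfold Re, Im; simpl; congruence. Qed.

Lemma is_derive_Rplus (f g : R -> R) (x a b : R) : is_derive f x a -> is_derive g x b ->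
  is_derive (fun t => f t + g t) x (a + b).
Proof. apply @is_derive_plus. Qed.

Lemma is_derive_Rminus (f g : R -> R) (x a b : R) : is_derive f x a -> is_derive g x b ->
  is_derive (fun t => f t - g t) x (a - b).
Proof. apply @is_derive_minus. Qed.

Lemma is_derive_Ropp (f : R -> R) (x a : R) : is_derive f x a ->
  is_derive (fun t => - f t) x (- a).
Proof. apply @is_derive_opp. Qed.

Lemma is_derive_Rid (x : R) : is_derive (fun t : R => t) x 1.
Proof. apply @is_derive_id. Qed.

Lemma is_derive_Rmult (f g : R -> R) (x a b : R) : is_derive f x a -> is_derive g x b ->
  is_derive (fun t => f t * g t) x (a * g x + f x * b).
Proof. apply Derive.is_derive_mult. Qed.

Lemma is_derive_Rcomp (f g : R -> R) (x a b : R) : is_derive f (g x) a -> is_derive g x b ->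
  is_derive (fun t => f (g t)) x (b * a).
Proof. apply @is_derive_comp. Qed.

Lemma is_derive_linear {V W : NormedModule R_AbsRing} (A : V -> W) (f : R -> V)
    (x : R) (l : V) :
  is_linear A -> is_derive f x l -> is_derive (fun t => A (f t)) x (A l).
Proof.
  intros HA Hf.
  eapply filterdiff_ext_lin.
  - apply (filterdiff_comp' f A x (fun y => scal y l) A Hf).
    now apply filterdiff_linear.
  - intros y; exact (linear_scal A HA y l).
Qed.

Lemma is_derive_pair {V W : NormedModule R_AbsRing} (f : R -> V) (g : R -> W)
    (x : R) (l : V) (m : W) :
  is_derive f x l -> is_derive g x m -> is_derive (fun t => (f t, g t)) x (l, m).
Proof.
  intros Hf Hg.
  assert (H1 : is_linear (fun v : V => (v, @zero W))).
  { apply (is_linear_prod (fun v => v) (fun _ => zero)).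
    apply is_linear_id. apply is_linear_zero. }
  assert (H2 : is_linear (fun w : W => (@zero V, w))).
  { apply (is_linear_prod (fun _ => zero) (fun w => w)).
    apply is_linear_zero. apply is_linear_id. }
  pose proof (is_derive_plus _ _ _ _ _ (is_derive_linear _ _ _ _ H1 Hf)
                (is_derive_linear _ _ _ _ H2 Hg)) as H.
  replace (l, m) with (plus (l, @zero W) (@zero V, m)).
  2:{ unfold plus at 1; simpl; unfold prod_plus; simpl; f_equal; [apply plus_zero_r|apply plus_zero_l]. }
  eapply is_derive_ext; [|exact H].
  intros t; unfold plus at 1; simpl; unfold prod_plus; simpl; f_equal; [apply plus_zero_r|apply plus_zero_l].
Qed.

Lemma continuous_pair {U V W : UniformSpace} (f : U -> V) (g : U -> W) (x : U) :
  continuous f x -> continuous g x -> continuous (fun t => (f t, g t)) x.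
Proof.
  intros Hf Hg.
  apply (continuous_comp_2 f g (fun a b => (a, b))); try assumption.
  eapply continuous_ext; [|apply continuous_id].
  now intros [? ?].
Qed.

Section Ck.
Context {V W : NormedModule R_AbsRing}.

Lemma is_Ck_ext k (F G : V -> W) : (forall p, F p = G p) -> is_Ck k F -> is_Ck k G.
Proof.
  destruct k; intros E [Hc Hd]; split; auto;
    try (intros p; eapply continuous_ext; [apply E|apply Hc]).
  intros v; destruct (Hd v) as [F' [H1 H2]]; exists F'; split; auto.
  intros p; eapply is_derive_ext; [|apply H1]; intros; apply E.
Qed.

(** [is_Ck] speaks of derivatives at parameter 0 only, but at every base point; moving the base
    point along the line gives the derivative at every parameter. *)
Lemma is_derive_line (F F' : V -> W) v :
  (forall p, is_derive (fun t : R => F (plus p (scal t v))) 0 (F' p)) ->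
  forall p t, is_derive (fun t : R => F (plus p (scal t v))) t (F' (plus p (scal t v))).
Proof.
  intros H p t.
  replace (F' (plus p (scal t v))) with (scal 1 (F' (plus p (scal t v)))) by exact (scal_one _).
  eapply is_derive_ext; [|apply (is_derive_comp (fun s => F (plus (plus p (scal t v)) (scal s v)))
     (fun s => s - t))].
  - intros s; simpl. f_equal. rewrite <- plus_assoc; f_equal.
    rewrite <- scal_distr_r; f_equal; unfold plus; simpl; ring.
  - replace (t - t) with 0 by ring. apply H.
  - auto_derive; auto; ring.
Qed.
End Ck.

Lemma is_Ck_linear_comp {V W W' : NormedModule R_AbsRing} (A : W -> W') k (F : V -> W) :
  is_linear A -> is_Ck k F -> is_Ck k (fun p => A (F p)).
Proof.
  intros HA; revert F; induction k; intros F [Hc Hd]; split; auto.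
  1,2: intros p; apply (continuous_comp F A); [apply Hc|now apply linear_cont].
  intros v; destruct (Hd v) as [F' [H1 H2]]; exists (fun p => A (F' p)); split; auto.
  intros p; now apply is_derive_linear.
Qed.

Lemma is_Ck_comp_linear {U V W : NormedModule R_AbsRing} (B : U -> V) k (F : V -> W) :
  is_linear B -> is_Ck k F -> is_Ck k (fun p => F (B p)).
Proof.
  intros HB; revert F; induction k; intros F [Hc Hd]; split; auto.
  1,2: intros p; apply (continuous_comp B F); [now apply linear_cont|apply Hc].
  intros v; destruct (Hd (B v)) as [F' [H1 H2]]; exists (fun p => F' (B p)); split; auto.
  intros p; eapply is_derive_ext; [|apply H1].
  intros t. now rewrite (linear_plus B HB), (linear_scal B HB).
Qed.

Lemma is_Ck_pair {V W W' : NormedModule R_AbsRing} k (F : V -> W) (G : V -> W') :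
  is_Ck k F -> is_Ck k G -> is_Ck k (fun p => (F p, G p)).
Proof.
  revert F G; induction k; intros F G [Fc Fd] [Gc Gd]; split; auto.
  1,2: intros p; apply continuous_pair; auto.
  intros v; destruct (Fd v) as [F' [H1 H2]], (Gd v) as [G' [H3 H4]].
  exists (fun p => (F' p, G' p)); split; auto.
  intros p; now apply is_derive_pair.
Qed.

Lemma is_Ck_plus {V W : NormedModule R_AbsRing} k (F G : V -> W) :
  is_Ck k F -> is_Ck k G -> is_Ck k (fun p => plus (F p) (G p)).
Proof.
  intros HF HG.
  apply (is_Ck_linear_comp (fun t : W * W => plus (fst t) (snd t)) k (fun p => (F p, G p))).
  apply is_linear_plus. now apply is_Ck_pair.
Qed.

Lemma is_linear_plus_fun {V W : NormedModule R_AbsRing} (A B : V -> W) :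
  is_linear A -> is_linear B -> is_linear (fun x => plus (A x) (B x)).
Proof.
  intros HA HB.
  apply (is_linear_comp (fun x => (A x, B x)) (fun t : W * W => plus (fst t) (snd t))).
  now apply is_linear_prod. apply is_linear_plus.
Qed.

Lemma is_linear_scal_fun {V W : NormedModule R_AbsRing} (k : R) (A : V -> W) :
  is_linear A -> is_linear (fun x => scal k (A x)).
Proof.
  intros HA; apply (is_linear_comp A (fun y => scal k y)); auto.
  exact (is_linear_scal_r (K := R_AbsRing) k Rmult_comm).
Qed.

Lemma is_linear_Re : is_linear (U := C_R_NormedModule) (V := R_NormedModule) Re.
Proof. apply (is_linear_fst (U := R_NormedModule) (V := R_NormedModule)). Qed.

Lemma is_linear_Im : is_linear (U := C_R_NormedModule) (V := R_NormedModule) Im.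
Proof. apply (is_linear_snd (U := R_NormedModule) (V := R_NormedModule)). Qed.

Lemma is_linear_Cmult (c : C) : is_linear (U := C_R_NormedModule) (V := C_R_NormedModule) (Cmult c).
Proof.
  apply (is_linear_ext (U := C_R_NormedModule) (V := prod_NormedModule R_AbsRing R_NormedModule R_NormedModule)
    (fun z : C => (plus (scal (Re c) (Re z)) (scal (- Im c) (Im z)),
                   plus (scal (Re c) (Im z)) (scal (Im c) (Re z))) : C)).
  - intros z; unfold Cmult, plus, scal, Re, Im; simpl; unfold mult; simpl; f_equal; ring.
  - apply (is_linear_prod (U := R_NormedModule) (V := R_NormedModule));
      apply (is_linear_plus_fun (V := C_R_NormedModule) (W := R_NormedModule));
      apply (is_linear_scal_fun (V := C_R_NormedModule) (W := R_NormedModule));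
      first [exact is_linear_Re | exact is_linear_Im].
Qed.

Lemma is_derive_Re (f : R -> C) x l : is_derive f x l -> is_derive (fun t => Re (f t)) x (Re l).
Proof. apply is_derive_linear, is_linear_Re. Qed.

Lemma is_derive_Im (f : R -> C) x l : is_derive f x l -> is_derive (fun t => Im (f t)) x (Im l).
Proof. apply is_derive_linear, is_linear_Im. Qed.

Lemma is_derive_RC (f : R -> C) x (l : C) :
  is_derive (fun t => Re (f t)) x (Re l) -> is_derive (fun t => Im (f t)) x (Im l) ->
  is_derive f x l.
Proof.
  intros H1 H2. pose proof (is_derive_pair _ _ _ _ _ H1 H2) as H.
  rewrite (surjective_pairing l).
  eapply is_derive_ext; [|exact H]. intros t; simpl. now destruct (f t).
Qed.

Lemma derive_C_eq (f : R -> C) x l : is_derive f x l -> derive_C f x = l.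
Proof.
  intros H; unfold derive_C; destruct l as [l1 l2]; apply (f_equal2 pair); apply is_derive_unique.
  exact (is_derive_Re _ _ _ H). exact (is_derive_Im _ _ _ H).
Qed.

Lemma derive_spinor_eq (f : R -> spinor) x (l : spinor) : is_derive f x l -> derive_spinor f x = l.
Proof.
  intros H; unfold derive_spinor. destruct l as [l1 l2].
  f_equal; apply derive_C_eq.
  - apply (is_derive_linear (V := prod_NormedModule R_AbsRing C_R_NormedModule C_R_NormedModule) (W := C_R_NormedModule) fst f x (l1, l2)); [apply is_linear_fst|exact H].
  - apply (is_derive_linear (V := prod_NormedModule R_AbsRing C_R_NormedModule C_R_NormedModule) (W := C_R_NormedModule) snd f x (l1, l2)); [apply is_linear_snd|exact H].
Qed.

Lemma is_Ck_Cmult {V : NormedModule R_AbsRing} k (c : C) (F : V -> C) :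
  is_Ck k F -> is_Ck k (fun p => (c * F p)%C).
Proof. apply (is_Ck_linear_comp (W := C_R_NormedModule) (W' := C_R_NormedModule) (Cmult c)), is_linear_Cmult. Qed.

Lemma is_Ck_Cplus {V : NormedModule R_AbsRing} k (F G : V -> C) :
  is_Ck k F -> is_Ck k G -> is_Ck k (fun p => (F p + G p)%C).
Proof. exact (is_Ck_plus (W := C_R_NormedModule) k F G). Qed.

(** * Characters and integrals over a period *)

Definition cis (x : R) : C := (cos x, sin x).

Lemma cis_plus x y : cis (x + y) = (cis x * cis y)%C.
Proof. unfold cis, Cmult; simpl. rewrite cos_plus, sin_plus. f_equal; ring. Qed.

Lemma cis_0 : cis 0 = RtoC 1.
Proof. unfold cis; now rewrite cos_0, sin_0. Qed.

Lemma Cmod_cis x : Cmod (cis x) = 1.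
Proof.
  unfold Cmod, cis; simpl fst; simpl snd.
  replace (cos x ^ 2 + sin x ^ 2) with 1; [apply sqrt_1|].
  pose proof (sin2_cos2 x). unfold Rsqr in *. simpl; lra.
Qed.

Lemma cis_2PI_Z (n : Z) : cis (2 * PI * IZR n) = RtoC 1.
Proof.
  unfold cis. rewrite <- (Rplus_0_l (2 * PI * IZR n)).
  rewrite (Rmult_comm (2 * PI)).
  destruct (Z_le_dec 0 n) as [H|H].
  - rewrite <- (Z2Nat.id n H), <- INR_IZR_INZ.
    replace (0 + INR (Z.to_nat n) * (2 * PI)) with (0 + 2 * INR (Z.to_nat n) * PI) by ring.
    rewrite cos_period, sin_period, cos_0, sin_0; reflexivity.
  - replace (IZR n) with (- INR (Z.to_nat (- n))).
    2:{ rewrite INR_IZR_INZ, Z2Nat.id by lia. rewrite opp_IZR; ring. }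
    set (m := Z.to_nat (- n)).
    rewrite <- (cos_period (0 + - INR m * (2 * PI)) m), <- (sin_period (0 + - INR m * (2 * PI)) m).
    replace (0 + - INR m * (2 * PI) + 2 * INR m * PI) with 0 by ring.
    rewrite cos_0, sin_0; reflexivity.
Qed.

Lemma is_derive_cis (g : R -> R) x l : is_derive g x l ->
  is_derive (fun t => cis (g t)) x (Ci * RtoC l * cis (g x))%C.
Proof.
  intros Hg. apply is_derive_RC; unfold cis; simpl.
  - evar_last. apply (is_derive_Rcomp cos g _ _ _ (is_derive_cos _) Hg). eqR; ring.
  - evar_last. apply (is_derive_Rcomp sin g _ _ _ (is_derive_sin _) Hg). eqR; ring.
Qed.

(** Tube lemma: joint continuity along the compact segment gives one neighbourhood of [p0] that
    works for all [t]. The parameter space is arbitrary because both the group and the plane occur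
    later. *)
Lemma locally_uniform {U : UniformSpace} (G : U -> R -> R) (p0 : U) :
  (forall t, continuous (fun x : U * R => G (fst x) (snd x)) (p0, t)) ->
  forall eps, 0 < eps ->
    locally p0 (fun p => forall t, 0 <= t <= 1 -> Rabs (G p t - G p0 t) < eps).
Proof.
  intros HG eps He.
  assert (H : forall t, exists d : posreal, forall p s, ball p0 d p -> Rabs (s - t) < d ->
     Rabs (G p s - G p0 t) < eps / 2).
  { intros t. specialize (HG t (fun y => Rabs (y - G p0 t) < eps / 2)).
    destruct HG as [d Hd].
    { exists (mkposreal (eps / 2) ltac:(lra)). intros y Hy. exact Hy. }
    exists d. intros p s Hp Hs. apply (Hd (p, s)). split; [exact Hp|exact Hs]. }
  destruct (choice (fun t (d : posreal) => forall p s, ball p0 d p -> Rabs (s - t) < d ->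
     Rabs (G p s - G p0 t) < eps / 2) H) as [delta Hdelta].
  (* Compactness yields one radius [d]: every [s] is [delta t]-close to some [t] with
     [d <= delta t]. This is provided in doubly negated form, hence [NNPP]. *)
  destruct (compactness_value_1d 0 1 delta) as [d Hd].
  exists d. intros p Hp s Hs. apply NNPP. intros HN. apply (Hd s Hs). intros [t [Ht [Hst Hdt]]].
  apply HN.
  pose proof (Hdelta t p s (ball_le _ _ _ Hdt _ Hp) Hst) as A.
  pose proof (Hdelta t p0 s (ball_center _ _) Hst) as B.
  replace (G p s - G p0 s) with ((G p s - G p0 t) - (G p0 s - G p0 t)) by ring.
  eapply Rle_lt_trans; [apply Rabs_triang|]. rewrite Rabs_Ropp. lra.
Qed.

Lemma ex_RInt_cont (f : R -> R) a b : (forall t, continuous f t) -> ex_RInt f a b.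
Proof. intros H. apply @ex_RInt_continuous. intros; apply H. Qed.

Lemma continuous_slice {U V W : UniformSpace} (G : U -> V -> W) (p : U) (t : V) :
  continuous (fun x : U * V => G (fst x) (snd x)) (p, t) -> continuous (G p) t.
Proof.
  intros H. apply (continuous_comp (fun t => (p, t)) (fun x : U * V => G (fst x) (snd x))); auto.
  apply continuous_pair; [apply continuous_const|apply continuous_id].
Qed.

Lemma continuous_RInt_param {U : UniformSpace} (G : U -> R -> R) (p0 : U) :
  (forall p t, continuous (fun x : U * R => G (fst x) (snd x)) (p, t)) ->
  continuous (fun p => RInt (G p) 0 1) p0.
Proof.
  intros HG P [eps HP].
  assert (Hi : forall p, ex_RInt (G p) 0 1).
  { intros p; apply ex_RInt_cont; intros t; apply continuous_slice, HG. }
  change (locally p0 (fun p => P (RInt (G p) 0 1))).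
  apply (filter_imp (fun p => forall t, 0 <= t <= 1 -> Rabs (G p t - G p0 t) < eps / 2)).
  2:{ apply locally_uniform; auto. apply is_pos_div_2. }
  intros p Hp. apply HP. change (Rabs (RInt (G p) 0 1 - RInt (G p0) 0 1) < eps).
  pose proof (cond_pos eps) as He.
  apply Rle_lt_trans with ((1 - 0) * (eps / 2)); [|lra].
  replace (RInt (G p) 0 1 - RInt (G p0) 0 1) with (RInt (fun t => minus (G p t) (G p0 t)) 0 1)
    by (exact (RInt_minus _ _ _ _ (Hi p) (Hi p0))).
  apply abs_RInt_le_const; [lra|exact (ex_RInt_minus _ _ _ _ (Hi p) (Hi p0))|].
  intros t Ht. left; now apply Hp.
Qed.

Lemma is_derive_RInt_param_cont (f f' : R -> R -> R) (x : R) :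
  (forall y t, is_derive (fun u => f u t) y (f' y t)) ->
  (forall y t, continuous (f y) t) ->
  (forall y t, continuous (fun z : R * R => f' (fst z) (snd z)) (y, t)) ->
  is_derive (fun y => RInt (f y) 0 1) x (RInt (f' x) 0 1).
Proof.
  intros Hd Hc Hc'.
  rewrite (RInt_ext (f' x) (fun t => Derive (fun u => f u t) x)).
  2:{ intros t _. symmetry. apply is_derive_unique, Hd. }
  apply is_derive_RInt_param.
  - apply filter_forall; intros y t _. exists (f' y t); apply Hd.
  - intros t _. apply continuity_2d_pt_ext with f'.
    + intros y s. symmetry. apply is_derive_unique, Hd.
    + apply continuity_2d_pt_filterlim. apply (Hc' x t).
  - apply filter_forall; intros y. now apply ex_RInt_cont.
Qed.

(** One fixed interval suffices, because integrands are rescaled so that their period, up to a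
    multiplier, is 1. *)
Definition cRInt (h : R -> C) : C := (RInt (fun t => Re (h t)) 0 1, RInt (fun t => Im (h t)) 0 1).

Lemma continuous_Re {U : UniformSpace} (f : U -> C) x : continuous f x -> continuous (fun t => Re (f t)) x.
Proof. intros H. apply (continuous_comp f Re); [exact H|]. destruct (f x). apply (continuous_fst (U := R_UniformSpace) (V := R_UniformSpace)). Qed.

Lemma continuous_Im {U : UniformSpace} (f : U -> C) x : continuous f x -> continuous (fun t => Im (f t)) x.
Proof. intros H. apply (continuous_comp f Im); [exact H|]. destruct (f x). apply (continuous_snd (U := R_UniformSpace) (V := R_UniformSpace)). Qed.

Lemma continuous_RC {U : UniformSpace} (f : U -> C) x :
  continuous (fun t => Re (f t)) x -> continuous (fun t => Im (f t)) x -> continuous f x.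
Proof.
  intros H1 H2. eapply (continuous_ext (fun t => (Re (f t), Im (f t)))).
  - intros t; now destruct (f t).
  - now apply continuous_pair.
Qed.

Lemma continuous_Rmult {U : UniformSpace} (f g : U -> R) x :
  continuous f x -> continuous g x -> continuous (fun t => f t * g t) x.
Proof. apply (continuous_mult (K := R_AbsRing)). Qed.

Lemma continuous_Rplus {U : UniformSpace} (f g : U -> R) x :
  continuous f x -> continuous g x -> continuous (fun t => f t + g t) x.
Proof. apply (continuous_plus (V := R_NormedModule)). Qed.

Lemma continuous_Rminus {U : UniformSpace} (f g : U -> R) x :
  continuous f x -> continuous g x -> continuous (fun t => f t - g t) x.
Proof. apply (continuous_minus (V := R_NormedModule)). Qed.

Lemma continuous_Cmult {U : UniformSpace} (f g : U -> C) x :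
  continuous f x -> continuous g x -> continuous (fun t => (f t * g t)%C) x.
Proof.
  intros Hf Hg.
  pose proof (continuous_Re f x Hf) as A1. pose proof (continuous_Im f x Hf) as A2.
  pose proof (continuous_Re g x Hg) as B1. pose proof (continuous_Im g x Hg) as B2.
  apply continuous_RC.
  - exact (continuous_Rminus _ _ _ (continuous_Rmult _ _ _ A1 B1) (continuous_Rmult _ _ _ A2 B2)).
  - exact (continuous_Rplus _ _ _ (continuous_Rmult _ _ _ A1 B2) (continuous_Rmult _ _ _ A2 B1)).
Qed.

Lemma continuous_Cplus {U : UniformSpace} (f g : U -> C) x :
  continuous f x -> continuous g x -> continuous (fun t => (f t + g t)%C) x.
Proof.
  intros Hf Hg. apply continuous_RC.
  - exact (continuous_Rplus _ _ _ (continuous_Re f x Hf) (continuous_Re g x Hg)).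
  - exact (continuous_Rplus _ _ _ (continuous_Im f x Hf) (continuous_Im g x Hg)).
Qed.

Lemma continuous_cis {U : UniformSpace} (g : U -> R) x : continuous g x -> continuous (fun t => cis (g t)) x.
Proof.
  intros H. apply continuous_RC; unfold cis; simpl.
  - now apply (continuous_comp g cos), continuous_cos.
  - now apply (continuous_comp g sin), continuous_sin.
Qed.

Lemma cRInt_ext h k : (forall t, h t = k t) -> cRInt h = cRInt k.
Proof. intros H; unfold cRInt; f_equal; apply RInt_ext; intros; now rewrite H. Qed.

Lemma cRInt_plus h k : (forall t, continuous h t) -> (forall t, continuous k t) ->
  cRInt (fun t => (h t + k t)%C) = (cRInt h + cRInt k)%C.
Proof.
  intros Hh Hk. unfold cRInt, Cplus; simpl. f_equal.
  - apply (RInt_plus (V := R_CompleteNormedModule)); apply ex_RInt_cont; intros; now apply continuous_Re.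
  - apply (RInt_plus (V := R_CompleteNormedModule)); apply ex_RInt_cont; intros; now apply continuous_Im.
Qed.

Lemma RInt_Rscal (f : R -> R) k a b : ex_RInt f a b -> RInt (fun t => k * f t) a b = k * RInt f a b.
Proof. exact (RInt_scal (V := R_CompleteNormedModule) f a b k). Qed.

Lemma RInt_Rplus (f g : R -> R) a b : ex_RInt f a b -> ex_RInt g a b ->
  RInt (fun t => f t + g t) a b = RInt f a b + RInt g a b.
Proof. exact (RInt_plus (V := R_CompleteNormedModule) f g a b). Qed.

Lemma RInt_Rminus (f g : R -> R) a b : ex_RInt f a b -> ex_RInt g a b ->
  RInt (fun t => f t - g t) a b = RInt f a b - RInt g a b.
Proof. exact (RInt_minus (V := R_CompleteNormedModule) f g a b). Qed.

Lemma ex_RInt_Rscal (f : R -> R) k a b : ex_RInt f a b -> ex_RInt (fun t => k * f t) a b.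
Proof. exact (ex_RInt_scal (V := R_CompleteNormedModule) f a b k). Qed.

Lemma cRInt_Cmult c h : (forall t, continuous h t) ->
  cRInt (fun t => (c * h t)%C) = (c * cRInt h)%C.
Proof.
  intros Hh.
  assert (H1 : ex_RInt (fun t => Re (h t)) 0 1) by (apply ex_RInt_cont; intros; now apply continuous_Re).
  assert (H2 : ex_RInt (fun t => Im (h t)) 0 1) by (apply ex_RInt_cont; intros; now apply continuous_Im).
  unfold cRInt, Cmult; simpl. f_equal.
  - rewrite RInt_Rminus, !RInt_Rscal; auto; now apply ex_RInt_Rscal.
  - rewrite RInt_Rplus, !RInt_Rscal; auto; now apply ex_RInt_Rscal.
Qed.

Lemma cRInt_const c : cRInt (fun _ => c) = c.
Proof.
  unfold cRInt. rewrite !RInt_const. unfold scal; simpl; unfold mult; simpl.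
  rewrite Rminus_0_r, !Rmult_1_l. now destruct c.
Qed.

Lemma Cmod_le_components z : Cmod z <= Rabs (Re z) + Rabs (Im z).
Proof.
  rewrite <- (Rabs_pos_eq (Cmod z)) by apply Cmod_ge_0.
  rewrite <- (Rabs_pos_eq (Rabs (Re z) + Rabs (Im z))) by (pose proof (Rabs_pos (Re z)); pose proof (Rabs_pos (Im z)); lra).
  apply Rsqr_le_abs_0. unfold Cmod. rewrite Rsqr_sqrt.
  - unfold Rsqr. rewrite <- (pow2_abs (fst z)), <- (pow2_abs (snd z)).
    unfold Re, Im. pose proof (Rabs_pos (fst z)); pose proof (Rabs_pos (snd z)). simpl; nra.
  - pose proof (pow2_ge_0 (fst z)); pose proof (pow2_ge_0 (snd z)); lra.
Qed.

Lemma Rabs_Re_le z : Rabs (Re z) <= Cmod z.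
Proof. eapply Rle_trans; [apply Rmax_l|apply Rmax_Cmod]. Qed.

Lemma Rabs_Im_le z : Rabs (Im z) <= Cmod z.
Proof. eapply Rle_trans; [apply Rmax_r|apply Rmax_Cmod]. Qed.

Lemma RInt_shift (h : R -> R) a b s : (forall t, continuous h t) ->
  RInt (fun t => h (t + s)) a b = RInt h (a + s) (b + s).
Proof.
  intros Hc.
  pose proof (RInt_comp_lin (V := R_CompleteNormedModule) h 1 s a b
    (ex_RInt_cont h _ _ Hc)) as H.
  rewrite !Rmult_1_l in H. rewrite <- H. apply RInt_ext. intros t _.
  unfold scal; simpl; unfold mult; simpl. now rewrite !Rmult_1_l.
Qed.

Lemma RInt_periodic_shift (h : R -> R) a : (forall t, continuous h t) -> (forall t, h (t + 1) = h t) ->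
  RInt h a (a + 1) = RInt h 0 1.
Proof.
  intros Hc Hp.
  assert (E : forall a b, ex_RInt h a b) by (intros; now apply ex_RInt_cont).
  assert (H1 : RInt h 1 (a + 1) = RInt h 0 a).
  { rewrite <- (Rplus_0_l 1) at 1. rewrite <- (RInt_shift h 0 a 1) by auto.
    apply RInt_ext. intros t _; apply Hp. }
  pose proof (RInt_Chasles h 0 a (a + 1) (E _ _) (E _ _)) as A.
  pose proof (RInt_Chasles h 0 1 (a + 1) (E _ _) (E _ _)) as B.
  unfold plus in *; simpl in *. rewrite H1 in B. lra.
Qed.

Lemma cRInt_shift h s : (forall t, continuous h t) -> (forall t, h (t + 1) = h t) ->
  cRInt (fun t => h (t + s)) = cRInt h.
Proof.
  intros Hc Hp. unfold cRInt. f_equal.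
  - pose proof (RInt_shift (fun t => Re (h t)) 0 1 s ltac:(intros; now apply continuous_Re)) as A.
    rewrite Rplus_0_l, (Rplus_comm 1 s) in A. rewrite A. apply RInt_periodic_shift; intros.
    now apply continuous_Re. now rewrite Hp.
  - pose proof (RInt_shift (fun t => Im (h t)) 0 1 s ltac:(intros; now apply continuous_Im)) as A.
    rewrite Rplus_0_l, (Rplus_comm 1 s) in A. rewrite A. apply RInt_periodic_shift; intros.
    now apply continuous_Im. now rewrite Hp.
Qed.

(** * Uniqueness of Fourier coefficients *)

(** This is [cos^2 (pi (t - t0))], a trigonometric polynomial with values in [[0, 1]] that equals 1
    only at [t0] modulo 1. Its powers are therefore finite combinations of characters that peak at
    [t0]. *)
Definition fejer (t0 t : R) : R := (1 + cos (2 * PI * (t - t0))) / 2.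

Lemma cos_Rabs x : cos (Rabs x) = cos x.
Proof. unfold Rabs; destruct Rcase_abs; auto; now rewrite cos_neg. Qed.

Lemma fejer_range t0 t : 0 <= fejer t0 t <= 1.
Proof. unfold fejer. pose proof (COS_bound (2 * PI * (t - t0))). lra. Qed.

Lemma fejer_decr t0 t e : 0 <= e <= 1 / 2 ->
  (Rabs (t - t0) <= e -> (1 + cos (2 * PI * e)) / 2 <= fejer t0 t) /\
  (e <= Rabs (t - t0) <= 1 / 2 -> fejer t0 t <= (1 + cos (2 * PI * e)) / 2).
Proof.
  intros He. pose proof PI_RGT_0. pose proof (Rabs_pos (t - t0)).
  assert (E : cos (2 * PI * (t - t0)) = cos (2 * PI * Rabs (t - t0))).
  { rewrite <- cos_Rabs, Rabs_mult, (Rabs_pos_eq (2 * PI)) by lra. reflexivity. }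
  unfold fejer; rewrite E; split; intros Ht.
  - assert (cos (2 * PI * e) <= cos (2 * PI * Rabs (t - t0))) by (apply cos_decr_1; nra). lra.
  - assert (cos (2 * PI * Rabs (t - t0)) <= cos (2 * PI * e)) by (apply cos_decr_1; nra). lra.
Qed.

Lemma continuous_fejer t0 t : continuous (fejer t0) t.
Proof. apply @ex_derive_continuous. unfold fejer. auto_derive. auto. Qed.

Lemma continuous_pow (f : R -> R) n t : continuous f t -> continuous (fun t => f t ^ n) t.
Proof.
  intros H; induction n; simpl; [apply continuous_const|now apply continuous_Rmult].
Qed.

(* The powers of the kernel concentrate at t0. *)
Lemma fejer_moments_le0 (g : R -> R) t0 :
  (forall t, continuous g t) -> (forall t, g (t + 1) = g t) ->
  (forall n, RInt (fun t => fejer t0 t ^ n * g t) 0 1 = 0) -> g t0 <= 0.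
Proof.
  intros Hc Hp Hn. apply Rnot_lt_le; intros Hpos.
  pose proof PI_RGT_0 as Hpi.
  set (c := g t0 / 2).
  assert (Hd : exists del, 0 < del < 1 / 2 /\ forall t, Rabs (t - t0) < del -> c < g t).
  { destruct (Hc t0 (fun y => Rabs (y - g t0) < c)) as [d Hd].
    { exists (mkposreal c ltac:(unfold c; lra)). intros y Hy; exact Hy. }
    exists (Rmin d (1 / 4)). pose proof (cond_pos d).
    pose proof (Rmin_l d (1 / 4)). pose proof (Rmin_r d (1 / 4)).
    split; [split; [apply Rmin_glb_lt|]; lra|].
    intros t Ht. specialize (Hd t). assert (B : ball t0 d t) by (change (Rabs (t - t0) < d); lra).
    apply Hd, Rabs_lt_between in B. unfold c in *; lra. }
  destruct Hd as [del [Hdel Hg]].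
  set (a := t0 - 1 / 2).
  destruct (bounded_continuity g a (a + 1)) as [M HM]; [intros; apply Hc|].
  assert (HM' : forall t, a <= t <= a + 1 -> Rabs (g t) <= M) by (intros t Ht; left; exact (HM t Ht)).
  assert (HM0 : 0 <= M) by (eapply Rle_trans; [apply Rabs_pos|apply (HM' a); lra]).
  set (rho := (1 + cos (2 * PI * del)) / 2). set (rho' := (1 + cos (2 * PI * (del / 2))) / 2).
  assert (Hc0 : 0 < c) by (unfold c; lra).
  assert (Hrho : 0 <= rho < rho').
  { unfold rho, rho'. pose proof (COS_bound (2 * PI * del)).
    assert (cos (2 * PI * del) < cos (2 * PI * (del / 2))) by (apply cos_decreasing_1; nra). lra. }
  assert (Cq : forall n t, continuous (fun t => fejer t0 t ^ n) t).
  { intros; apply continuous_pow, continuous_fejer. }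
  assert (I0 : forall n, RInt (fun t => fejer t0 t ^ n * g t) a (a + 1) = 0).
  { intros n. rewrite RInt_periodic_shift; [apply Hn| |].
    - intros t; apply continuous_Rmult; [apply Cq|apply Hc].
    - intros t. rewrite Hp. f_equal. f_equal. unfold fejer. f_equal. f_equal.
      replace (2 * PI * (t + 1 - t0)) with (2 * PI * (t - t0) + 2 * INR 1 * PI) by (simpl; ring).
      apply cos_period. }
  (* Pointwise, [fejer^n * g >= c * fejer^n - (M + c) * rho^n]: within [del] of [t0] because [g > c]
     there, and elsewhere because [fejer <= rho] and [|g| <= M]. *)
  assert (I1 : forall n, c * RInt (fun t => fejer t0 t ^ n) a (a + 1) <= (M + c) * rho ^ n).
  { intros n.
    assert (L : RInt (fun t => c * fejer t0 t ^ n - (M + c) * rho ^ n) a (a + 1)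
       <= RInt (fun t => fejer t0 t ^ n * g t) a (a + 1)).
    { apply RInt_le; [lra| | |].
      - apply ex_RInt_cont; intros t. apply continuous_Rminus; [|apply continuous_const].
        apply continuous_Rmult; [apply continuous_const|apply Cq].
      - apply ex_RInt_cont; intros t. apply continuous_Rmult; [apply Cq|apply Hc].
      - intros t Ht. pose proof (fejer_range t0 t) as Hq.
        assert (Hqn : 0 <= fejer t0 t ^ n) by (apply pow_le; tauto).
        assert (Hrn : 0 <= rho ^ n) by (apply pow_le; tauto).
        destruct (Rlt_le_dec (Rabs (t - t0)) del) as [H|H].
        + specialize (Hg t H). nra.
        + assert (Hq2 : fejer t0 t <= rho).
          { apply (fejer_decr t0 t del); [lra|]. split; auto. apply Rabs_le_between. unfold a in Ht; lra. }
          assert (Hq3 : fejer t0 t ^ n <= rho ^ n) by (apply pow_incr; tauto).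
          specialize (HM' t ltac:(lra)). apply Rabs_le_between in HM'.
          assert (fejer t0 t ^ n * (c - g t) <= rho ^ n * (M + c)).
          { apply Rle_trans with (fejer t0 t ^ n * (M + c)); [apply Rmult_le_compat_l; lra|apply Rmult_le_compat_r; lra]. }
          lra. }
    rewrite I0, RInt_Rminus, RInt_Rscal, RInt_const in L;
      try (apply ex_RInt_cont; intros; first [apply Cq|apply continuous_const|apply continuous_Rmult; [apply continuous_const|apply Cq]]).
    unfold scal in L; simpl in L; unfold mult in L; simpl in L. lra. }
  assert (I2 : forall n, del * rho' ^ n <= RInt (fun t => fejer t0 t ^ n) a (a + 1)).
  { intros n.
    assert (E : forall x y, ex_RInt (fun t => fejer t0 t ^ n) x y) by (intros; apply ex_RInt_cont, Cq).
    rewrite <- (RInt_Chasles _ a (t0 - del / 2) (a + 1) (E _ _) (E _ _)).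
    rewrite <- (RInt_Chasles _ (t0 - del / 2) (t0 + del / 2) (a + 1) (E _ _) (E _ _)).
    assert (A : 0 <= RInt (fun t => fejer t0 t ^ n) a (t0 - del / 2)).
    { apply RInt_ge_0; [unfold a; lra|apply E|intros; apply pow_le, fejer_range]. }
    assert (B : 0 <= RInt (fun t => fejer t0 t ^ n) (t0 + del / 2) (a + 1)).
    { apply RInt_ge_0; [unfold a; lra|apply E|intros; apply pow_le, fejer_range]. }
    assert (D : RInt (fun t => rho' ^ n) (t0 - del / 2) (t0 + del / 2) <=
       RInt (fun t => fejer t0 t ^ n) (t0 - del / 2) (t0 + del / 2)).
    { apply RInt_le; [lra|apply ex_RInt_cont; intros; apply continuous_const|apply E|].
      intros t Ht. apply pow_incr. split; [lra|].
      apply (fejer_decr t0 t (del / 2)); [lra|]. apply Rabs_le_between; lra. }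
    rewrite RInt_const in D. unfold scal in D; simpl in D; unfold mult in D; simpl in D.
    unfold plus; simpl. lra. }
  (* [I1] and [I2] give [c * del * rho'^n <= (M + c) * rho^n] for every [n]; as [rho < rho'], this
     fails for large [n]. *)
  destruct (pow_lt_1_zero (rho / rho')) with (y := c * del / (M + c)) as [N HN].
  { rewrite Rabs_pos_eq; [|apply Rdiv_le_0_compat; lra].
    apply Rmult_lt_reg_r with rho'; [lra|]. unfold Rdiv. rewrite Rmult_assoc, Rinv_l by lra. lra. }
  { apply Rdiv_lt_0_compat; [apply Rmult_lt_0_compat|]; lra. }
  specialize (HN N (Nat.le_refl _)). apply Rabs_lt_between in HN. destruct HN as [_ HN].
  specialize (I1 N). specialize (I2 N).
  assert (Hr : 0 < rho' ^ N) by (apply pow_lt; lra).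
  assert (HE : rho ^ N = (rho / rho') ^ N * rho' ^ N).
  { rewrite <- Rpow_mult_distr. f_equal. field; lra. }
  rewrite HE in I1.
  assert ((M + c) * (rho / rho') ^ N < c * del).
  { apply Rmult_lt_compat_l with (r := M + c) in HN; [|lra].
    replace ((M + c) * (c * del / (M + c))) with (c * del) in HN by (field; lra). lra. }
  assert (c * (del * rho' ^ N) <= c * RInt (fun t => fejer t0 t ^ N) a (a + 1)) by (apply Rmult_le_compat_l; lra).
  nra.
Qed.

(** Only the frequencies -1, 0 and 1 occur, so multiplying a function by the kernel replaces its
    [m]-th Fourier coefficient by a combination of those at [m - 1], [m], [m + 1]. Vanishing of all
    coefficients thus survives multiplication by powers of the kernel. *)
Lemma fejer_cis t0 t : RtoC (fejer t0 t) =
  (RtoC (1 / 2) + (RtoC (1 / 4) * cis (- (2 * PI * t0)) * cis (2 * PI * t)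
    + RtoC (1 / 4) * cis (2 * PI * t0) * cis (- (2 * PI * t))))%C.
Proof.
  rewrite <- !Cmult_assoc, <- !cis_plus. unfold fejer.
  replace (2 * PI * (t - t0)) with (- (2 * PI * t0) + 2 * PI * t) by ring.
  replace (2 * PI * t0 + - (2 * PI * t)) with (- (- (2 * PI * t0) + 2 * PI * t)) by ring.
  unfold cis, RtoC, Cplus, Cmult; simpl. rewrite cos_neg, sin_neg. f_equal; field.
Qed.

(** By induction on [n] all coefficients of [fejer^n * h] vanish; the one of frequency 0 says that
    [h] has zero moments against the powers of the kernel. Concentration at [t0], applied to plus
    and minus the real and imaginary parts, gives [h t0 = 0]. *)
Lemma fourier_uniqueness_periodic (h : R -> C) :
  (forall t, continuous h t) -> (forall t, h (t + 1) = h t) ->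
  (forall m : Z, cRInt (fun t => cis (- (2 * PI * IZR m * t)) * h t)%C = RtoC 0) ->
  forall t, h t = RtoC 0.
Proof.
  intros Hc Hp H0 t0.
  assert (Cc : forall (k : R -> C) m t, continuous k t -> continuous (fun t => cis (- (2 * PI * IZR m * t)) * k t)%C t).
  { intros k m t Hk. apply continuous_Cmult; auto. apply continuous_cis.
    apply @ex_derive_continuous. auto_derive; auto. }
  assert (Cq : forall n t, continuous (fun t => RtoC (fejer t0 t ^ n) * h t)%C t).
  { intros n t. apply continuous_Cmult; auto. apply continuous_RC; simpl; [|apply continuous_const].
    apply continuous_pow, continuous_fejer. }
  assert (H : forall n m, cRInt (fun t => cis (- (2 * PI * IZR m * t)) * (RtoC (fejer t0 t ^ n) * h t))%C = RtoC 0).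
  { induction n as [|n IH]; intros m.
    - rewrite <- (H0 m). apply cRInt_ext; intros t; simpl. ring.
    - rewrite (cRInt_ext _ (fun t =>
       (RtoC (1 / 2) * (cis (- (2 * PI * IZR m * t)) * (RtoC (fejer t0 t ^ n) * h t)) +
       ((RtoC (1 / 4) * cis (- (2 * PI * t0))) * (cis (- (2 * PI * IZR (m - 1) * t)) * (RtoC (fejer t0 t ^ n) * h t)) +
       (RtoC (1 / 4) * cis (2 * PI * t0)) * (cis (- (2 * PI * IZR (m + 1) * t)) * (RtoC (fejer t0 t ^ n) * h t))))%C)).
      + assert (CF : forall m t, continuous (fun t => cis (- (2 * PI * IZR m * t)) * (RtoC (fejer t0 t ^ n) * h t))%C t)
          by (intros; apply Cc, Cq).
        assert (CG : forall c m t, continuous (fun t => c * (cis (- (2 * PI * IZR m * t)) * (RtoC (fejer t0 t ^ n) * h t)))%C t).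
        { intros c k t. apply (continuous_Cmult (fun _ => c)); [apply continuous_const|apply CF]. }
        rewrite cRInt_plus, cRInt_plus, !cRInt_Cmult, !IH; auto.
        * ring.
        * intros t. apply continuous_Cplus; apply CG.
      + intros t. simpl pow. rewrite RtoC_mult, fejer_cis.
        rewrite minus_IZR, plus_IZR.
        replace (- (2 * PI * (IZR m - 1) * t)) with (- (2 * PI * IZR m * t) + 2 * PI * t) by ring.
        replace (- (2 * PI * (IZR m + 1) * t)) with (- (2 * PI * IZR m * t) + - (2 * PI * t)) by ring.
        rewrite !cis_plus. ring. }
  assert (HR : forall n, RInt (fun t => fejer t0 t ^ n * Re (h t)) 0 1 = 0 /\ RInt (fun t => fejer t0 t ^ n * Im (h t)) 0 1 = 0).
  { intros n. specialize (H n 0%Z).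
    rewrite (cRInt_ext _ (fun t => (RtoC (fejer t0 t ^ n) * h t)%C)) in H.
    2:{ intros t. replace (- (2 * PI * 0 * t)) with 0 by ring. rewrite cis_0. ring. }
    unfold cRInt in H. injection H as E1 E2. split; [refine (eq_trans _ E1)|refine (eq_trans _ E2)]; apply RInt_ext; intros t _; unfold Re, Im; eqR; ring. }
  assert (HO : forall g : R -> R, (forall t, continuous g t) -> (forall t, g (t + 1) = g t) ->
     (forall n, RInt (fun t => fejer t0 t ^ n * g t) 0 1 = 0) -> g t0 = 0).
  { intros g G1 G2 G3. apply Rle_antisym; [now apply fejer_moments_le0|].
    enough (- g t0 <= 0) by lra. apply (fejer_moments_le0 (fun t => - g t)).
    - intros t; apply (continuous_opp g), G1.
    - intros t; now rewrite G2.
    - intros n. rewrite (RInt_ext _ (fun t => -1 * (fejer t0 t ^ n * g t))) by (intros; eqR; ring).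
      rewrite RInt_Rscal, G3; [eqR; ring|]. apply ex_RInt_cont; intros t. apply continuous_Rmult; auto.
      apply continuous_pow, continuous_fejer. }
  apply Ceq.
  - refine (HO (fun t => Re (h t)) _ _ _).
    + intros; now apply continuous_Re.
    + intros; now rewrite Hp.
    + intros n; exact (proj1 (HR n)).
  - refine (HO (fun t => Im (h t)) _ _ _).
    + intros; now apply continuous_Im.
    + intros; now rewrite Hp.
    + intros n; exact (proj2 (HR n)).
Qed.

Lemma fourier_uniqueness (th : R) (h : R -> C) :
  (forall t, continuous h t) -> (forall t, h (t + 1) = (cis (2 * PI * th) * h t)%C) ->
  (forall m : Z, cRInt (fun t => cis (- (2 * PI * (th + IZR m) * t)) * h t)%C = RtoC 0) ->
  forall t, h t = RtoC 0.
Proof.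
  intros Hc Hp H0 t.
  assert (E : (cis (- (2 * PI * th * t)) * h t)%C = RtoC 0).
  { apply (fourier_uniqueness_periodic (fun t => cis (- (2 * PI * th * t)) * h t)%C).
    - intros s. apply continuous_Cmult; auto. apply continuous_cis.
      apply @ex_derive_continuous. auto_derive; auto.
    - intros s. rewrite Hp, Cmult_assoc, <- cis_plus. f_equal. f_equal. ring.
    - intros m. rewrite <- (H0 m). apply cRInt_ext; intros s.
      rewrite Cmult_assoc, <- cis_plus. f_equal. f_equal. ring. }
  transitivity (cis (2 * PI * th * t) * (cis (- (2 * PI * th * t)) * h t))%C.
  - rewrite Cmult_assoc, <- cis_plus, Rplus_opp_r, cis_0. ring.
  - rewrite E; ring.
Qed.

(** * Hermite functions and the harmonic oscillator *)

(* [herm a k w = (- sqrt a) ^ k * H_k (w / sqrt a) * exp (- w ^ 2 / (2 * a))] with the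
   physicists' Hermite polynomials [H_k]. *)
Fixpoint herm (a : R) (k : nat) (w : R) : R :=
  match k with
  | 0%nat => exp (- w ^ 2 / (2 * a))
  | S k' => - 2 * w * herm a k' w - 2 * a * INR k' *
      match k' with 0%nat => 0 | S k'' => herm a k'' w end
  end.

Lemma herm_S a k w :
  herm a (S k) w = - 2 * w * herm a k w - 2 * a * INR k * herm a (pred k) w.
Proof. destruct k; simpl; ring. Qed.

(** By [herm_S], multiplication by [- 2 w] is the sum of raising and lowering; [2 a d/dw] is their
    difference. The value at [pred 0 = 0] is harmless, since it carries the factor [INR 0]. Two
    consecutive levels are proved together because the recurrence has two terms. *)
Lemma herm_derive a k w : a <> 0 ->
  is_derive (herm a k) w ((herm a (S k) w - 2 * a * INR k * herm a (pred k) w) / (2 * a)).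
Proof.
  intros Ha.
  enough (H : is_derive (herm a k) w ((herm a (S k) w - 2 * a * INR k * herm a (pred k) w) / (2 * a))
    /\ is_derive (herm a (S k)) w ((herm a (S (S k)) w - 2 * a * INR (S k) * herm a k w) / (2 * a)))
    by apply H.
  induction k as [|k [IH1 IH2]].
  - assert (H0 : is_derive (herm a 0) w ((herm a 1 w - 2 * a * INR 0 * herm a (pred 0) w) / (2 * a))).
    { simpl. auto_derive; auto. unfold Rdiv. generalize (exp (- (w * (w * 1)) * / (2 * a))). intros e. field; auto. }
    split; [exact H0|].
    apply (is_derive_ext (fun w => -2 * (w * herm a 0 w))).
    { intros t; simpl; eqR; ring. }
    simpl herm. 
    auto_derive; auto. simpl. unfold Rdiv. generalize (exp (- (w * (w * 1)) * / (2 * a))). intros e. field; auto.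
  - split; [exact IH2|].
    apply (is_derive_ext (fun w => -2 * (w * herm a (S k) w) + - 2 * a * INR (S k) * herm a k w)).
    { intros t; rewrite (herm_S a (S k)); simpl pred; eqR; ring. }
    evar_last.
    + apply is_derive_Rplus.
      * apply is_derive_scal. apply is_derive_Rmult. apply is_derive_Rid. exact IH2.
      * apply is_derive_scal. exact IH1.
    + rewrite (herm_S a (S (S k))), (herm_S a (S k)). simpl pred.
      replace (2 * a * INR k * herm a (pred k) w) with (- 2 * w * herm a k w - herm a (S k) w)
        by (rewrite herm_S; ring).
      rewrite !S_INR. eqR. field; auto.
Qed.

(** At level 0 the Gaussian is split into [n = N + 1] equal factors, and each of [N] of them absorbs
    one factor [1 + w^2], at the cost of [c = 1 + 2 a n], by [1 + x <= exp x]. Taking [N + 1] rather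
    than [N] avoids division by zero at [N = 0]. *)
Lemma herm_bound a k N : 0 < a ->
  exists M, 0 <= M /\ forall w, (1 + w ^ 2) ^ N * Rabs (herm a k w) <= M.
Proof.
  intros Ha.
  assert (H0 : forall N, exists M, 0 <= M /\ forall w, (1 + w ^ 2) ^ N * Rabs (herm a 0 w) <= M).
  { clear N; intros N. set (n := INR N + 1). assert (Hn : 0 < n) by (unfold n; pose proof (pos_INR N); lra).
    set (c := 1 + 2 * a * n). assert (Hc : 1 <= c) by (unfold c; nra).
    exists (c ^ N * 1); split. { apply Rmult_le_pos; [apply pow_le|]; lra. }
    intros w; simpl herm. rewrite Rabs_pos_eq by (left; apply exp_pos).
    assert (Hw : 0 <= w ^ 2) by nra.
    set (e := exp (- w ^ 2 / (2 * a * n))).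
    assert (He : exp (- w ^ 2 / (2 * a)) <= e ^ N).
    { rewrite <- (Rpower_pow N e) by apply exp_pos. unfold Rpower, e. rewrite ln_exp.
      assert (Hx : - w ^ 2 / (2 * a) <= INR N * (- w ^ 2 / (2 * a * n))).
      { replace (INR N * (- w ^ 2 / (2 * a * n))) with (- w ^ 2 / (2 * a) + w ^ 2 / (2 * a * n))
          by (unfold n; field; unfold n in Hn; split; lra).
        assert (0 <= w ^ 2 / (2 * a * n)) by (apply Rdiv_le_0_compat; nra). lra. }
      destruct (Rle_lt_or_eq_dec _ _ Hx) as [Hlt|Heq]; [left; now apply exp_increasing|].
      now rewrite Heq; right. }
    assert (He2 : (1 + w ^ 2) * e <= c).
    { assert (H1 : 1 + w ^ 2 / (2 * a * n) <= exp (w ^ 2 / (2 * a * n))) by apply exp_ineq1_le.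
      assert (H2 : e * exp (w ^ 2 / (2 * a * n)) = 1).
      { unfold e. rewrite <- exp_plus. replace (_ + _) with 0 by (field; lra). apply exp_0. }
      assert (H3 : 0 < e) by apply exp_pos.
      assert (H4 : 1 + w ^ 2 <= c * (1 + w ^ 2 / (2 * a * n))).
      { unfold c. replace ((1 + 2 * a * n) * (1 + w ^ 2 / (2 * a * n)))
          with (1 + w ^ 2 + (2 * a * n + w ^ 2 / (2 * a * n))) by (field; lra).
        assert (0 <= w ^ 2 / (2 * a * n)) by (apply Rdiv_le_0_compat; nra). nra. }
      apply Rle_trans with (c * (e * exp (w ^ 2 / (2 * a * n)))); [|rewrite H2; lra].
      replace (c * (e * exp (w ^ 2 / (2 * a * n)))) with (c * exp (w ^ 2 / (2 * a * n)) * e) by ring.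
      apply Rmult_le_compat_r; [lra|].
      eapply Rle_trans; [exact H4|]. apply Rmult_le_compat_l; lra. }
    apply Rle_trans with ((1 + w ^ 2) ^ N * e ^ N).
    - apply Rmult_le_compat_l; [apply pow_le; lra|exact He].
    - rewrite <- Rpow_mult_distr, Rmult_1_r. apply pow_incr. split; [|exact He2].
      apply Rmult_le_pos; [lra|left; apply exp_pos]. }
  (* The factor [w] in the recurrence costs one power of [1 + w^2], so the induction must keep [N]
     universal and carry the two preceding levels. *)
  enough (H : forall N, (exists M, 0 <= M /\ forall w, (1 + w ^ 2) ^ N * Rabs (herm a k w) <= M) /\
     (exists M, 0 <= M /\ forall w, (1 + w ^ 2) ^ N * Rabs (herm a (pred k) w) <= M)) by apply H.
  clear N; induction k as [|k IH]; intros N; [split; apply H0|].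
  simpl pred; split; [|apply IH].
  destruct (IH (S N)) as [[M1 [P1 H1]] _], (IH N) as [_ [M2 [P2 H2]]].
  exists (2 * M1 + 2 * a * INR k * M2); split.
  { pose proof (pos_INR k). assert (0 <= a * INR k * M2) by (repeat apply Rmult_le_pos; lra). lra. }
  intros w. rewrite herm_S. specialize (H1 w). specialize (H2 w).
  set (u := 1 + w ^ 2) in *. assert (Hu : 0 <= u ^ N) by (apply pow_le; unfold u; nra).
  assert (Hw : Rabs w <= u) by (unfold u; rewrite <- (pow2_abs w); pose proof (Rabs_pos w); nra).
  pose proof (pos_INR k).
  apply Rle_trans with (u ^ N * (2 * (Rabs w * Rabs (herm a k w)) + 2 * a * INR k * Rabs (herm a (pred k) w))).
  - apply Rmult_le_compat_l; auto.
    unfold Rminus. eapply Rle_trans; [apply Rabs_triang|].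
    rewrite Rabs_Ropp, !Rabs_mult, (Rabs_left (-2)), (Rabs_pos_eq 2), (Rabs_pos_eq a), (Rabs_pos_eq (INR k)) by lra.
    lra.
  - simpl in H1.
    assert (u ^ N * (Rabs w * Rabs (herm a k w)) <= u * u ^ N * Rabs (herm a k w)).
    { pose proof (Rabs_pos (herm a k w)).
      assert (0 <= u ^ N * Rabs (herm a k w)) by (apply Rmult_le_pos; lra). nra. }
    assert (a * INR k * (u ^ N * Rabs (herm a (pred k) w)) <= a * INR k * M2).
    { apply Rmult_le_compat_l; [apply Rmult_le_pos; lra|exact H2]. }
    nra.
Qed.

(** If level [k + 1] vanished identically, so would its derivative, which by the recurrence is then
    [- 2 (k + 1)] times level [k]. *)
Lemma herm_neq0 a k : 0 < a -> exists w, herm a k w <> 0.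
Proof.
  intros Ha; induction k as [|k [w Hw]].
  - exists 0. simpl. apply Rgt_not_eq, exp_pos.
  - apply not_all_not_ex; intros H.
    assert (H' : forall t, herm a (S k) t = 0) by (intros t; apply NNPP, H).
    assert (D : is_derive (herm a (S k)) w 0).
    { apply is_derive_ext with (fun _ => 0); [intros; now rewrite H'|apply @is_derive_const]. }
    pose proof (is_derive_unique _ _ _ (herm_derive a (S k) w ltac:(lra))) as E1.
    rewrite (is_derive_unique _ _ _ D) in E1.
    rewrite (herm_S a (S k)), H' in E1. simpl pred in E1.
    apply Hw. rewrite S_INR in E1. pose proof (pos_INR k).
    assert (E2 : (INR k + 1) * herm a k w = 0).
    { apply Rmult_eq_reg_l with (-2). 2: lra. rewrite Rmult_0_r, E1. field. lra. }
    apply Rmult_integral in E2; destruct E2; lra.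
Qed.

(** Modes are bounded, but lowering multiplies by [a * x + b]; polynomial growth is the class stable
    under this and still small enough to exclude the growing solutions. *)
Definition poly_bounded (f : R -> R) : Prop :=
  exists M m, forall x, Rabs (f x) <= M * (1 + x ^ 2) ^ m.

Lemma poly_bounded_plus f g : poly_bounded f -> poly_bounded g -> poly_bounded (fun x => f x + g x).
Proof.
  intros [M [m H]] [M' [m' H']]. exists (Rabs M + Rabs M'), (m + m')%nat. intros x.
  specialize (H x); specialize (H' x).
  assert (Hu : 1 <= 1 + x ^ 2) by nra.
  pose proof (Rle_pow _ m (m + m') Hu ltac:(lia)). pose proof (Rle_pow _ m' (m + m') Hu ltac:(lia)).
  assert (P1 := pow_le (1 + x ^ 2) m ltac:(lra)). assert (P2 := pow_le (1 + x ^ 2) m' ltac:(lra)).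
  pose proof (Rle_abs M). pose proof (Rle_abs M'). pose proof (Rabs_pos M). pose proof (Rabs_pos M').
  eapply Rle_trans; [apply Rabs_triang|].
  rewrite Rmult_plus_distr_r. apply Rplus_le_compat; [eapply Rle_trans; [exact H|]|eapply Rle_trans; [exact H'|]].
  - apply Rle_trans with (Rabs M * (1 + x ^ 2) ^ m); nra.
  - apply Rle_trans with (Rabs M' * (1 + x ^ 2) ^ m'); nra.
Qed.

Lemma poly_bounded_mult f g : poly_bounded f -> poly_bounded g -> poly_bounded (fun x => f x * g x).
Proof.
  intros [M [m H]] [M' [m' H']]. exists (M * M'), (m + m')%nat. intros x.
  rewrite Rabs_mult, pow_add.
  replace (M * M' * ((1 + x ^ 2) ^ m * (1 + x ^ 2) ^ m'))
    with ((M * (1 + x ^ 2) ^ m) * (M' * (1 + x ^ 2) ^ m')) by ring.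
  apply Rmult_le_compat; auto using Rabs_pos.
Qed.

Lemma poly_bounded_affine a b : poly_bounded (fun x => a * x + b).
Proof.
  exists (Rabs a + Rabs b), 1%nat. intros x. rewrite pow_1.
  eapply Rle_trans; [apply Rabs_triang|]. rewrite Rabs_mult.
  pose proof (Rabs_pos a). pose proof (Rabs_pos b). pose proof (Rabs_pos x).
  rewrite <- (pow2_abs x).
  assert (Rabs x <= 1 + Rabs x ^ 2) by nra. assert (1 <= 1 + Rabs x ^ 2) by nra. nra.
Qed.

(* Taylor at order two: f1 x is within f''(eta) of f (x + 1) - f x. *)
Lemma poly_bounded_derive (f f1 f2 : R -> R) :
  (forall x, is_derive f x (f1 x)) -> (forall x, is_derive f1 x (f2 x)) ->
  poly_bounded f -> poly_bounded f2 -> poly_bounded f1.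
Proof.
  intros D1 D2 [M [m H]] [M' [m' H']].
  exists (2 * Rabs M * 3 ^ m + Rabs M' * 3 ^ m'), (m + m')%nat. intros x.
  destruct (MVT_gen f x (x + 1) f1) as [xi [Hxi E]]; [intros; apply D1| |].
  { intros y _. apply derivable_continuous_pt. exists (f1 y). now apply is_derive_Reals. }
  rewrite Rmin_left, Rmax_right in Hxi by lra.
  destruct (MVT_gen f1 x xi f2) as [eta [Heta E']]; [intros; apply D2| |].
  { intros y _. apply derivable_continuous_pt. exists (f2 y). now apply is_derive_Reals. }
  rewrite Rmin_left, Rmax_right in Heta by lra.
  assert (B : forall (g : R -> R) N n, (forall x, Rabs (g x) <= N * (1 + x ^ 2) ^ n) ->
      forall y, x <= y <= x + 1 -> Rabs (g y) <= Rabs N * (3 ^ n * (1 + x ^ 2) ^ n)).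
  { intros g N n Hg y Hy. eapply Rle_trans; [apply Hg|].
    rewrite <- Rpow_mult_distr.
    assert (P := pow_le (1 + y ^ 2) n ltac:(nra)).
    apply Rle_trans with (Rabs N * (1 + y ^ 2) ^ n).
    - apply Rmult_le_compat_r; auto. apply Rle_abs.
    - apply Rmult_le_compat_l; [apply Rabs_pos|]. apply pow_incr. split; [nra|].
      assert ((y - x) ^ 2 <= 1) by nra. pose proof (pow2_ge_0 (x - (y - x))).
      replace y with (x + (y - x)) by ring. nra. }
  assert (B1 := B _ _ _ H (x + 1) ltac:(lra)). assert (B0 := B _ _ _ H x ltac:(lra)).
  assert (B2 := B _ _ _ H' eta ltac:(lra)).
  replace (f1 x) with (f (x + 1) + - f x + - (f2 eta * (xi - x))) by lra.
  assert (Hu : 1 <= 1 + x ^ 2) by nra.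
  pose proof (Rle_pow _ m (m + m') Hu ltac:(lia)) as Q1. pose proof (Rle_pow _ m' (m + m') Hu ltac:(lia)) as Q2.
  pose proof (Rabs_pos M). pose proof (Rabs_pos M').
  assert (T1 : 0 < 3 ^ m) by (apply pow_lt; lra). assert (T2 : 0 < 3 ^ m') by (apply pow_lt; lra).
  assert (U1 : Rabs M * (3 ^ m * (1 + x ^ 2) ^ m) <= Rabs M * 3 ^ m * (1 + x ^ 2) ^ (m + m')).
  { rewrite Rmult_assoc. apply Rmult_le_compat_l; auto. apply Rmult_le_compat_l; lra. }
  assert (U2 : Rabs M' * (3 ^ m' * (1 + x ^ 2) ^ m') <= Rabs M' * 3 ^ m' * (1 + x ^ 2) ^ (m + m')).
  { rewrite Rmult_assoc. apply Rmult_le_compat_l; auto. apply Rmult_le_compat_l; lra. }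
  eapply Rle_trans; [apply Rabs_triang|]. eapply Rle_trans; [apply Rplus_le_compat_r, Rabs_triang|].
  rewrite !Rabs_Ropp, Rabs_mult, (Rabs_pos_eq (xi - x)) by lra.
  pose proof (Rabs_pos (f2 eta)).
  assert (Rabs (f2 eta) * (xi - x) <= Rabs (f2 eta)) by nra. lra.
Qed.

(* A polynomially bounded f with f'' = q f, q >= eps > 0, cannot be positive:
   otherwise f - delta (1 + eta x^2)^n would have a positive interior maximum for
   small delta and eta, where its second derivative is positive. *)
Lemma convex_poly_bounded_le0 (f f1 q : R -> R) (eps : R) :
  0 < eps -> (forall x, eps <= q x) ->
  (forall x, is_derive f x (f1 x)) -> (forall x, is_derive f1 x (q x * f x)) ->
  poly_bounded f -> forall x, f x <= 0.
Proof.
  intros He Hq D1 D2 [M0 [m H0]] x0.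
  apply Rnot_lt_le; intros Hx0.
  assert (H : forall x, Rabs (f x) <= Rabs M0 * (1 + x ^ 2) ^ m).
  { intros x. eapply Rle_trans; [apply H0|]. apply Rmult_le_compat_r; [apply pow_le; nra|apply Rle_abs]. }
  set (M := Rabs M0) in *. assert (HM : 0 <= M) by apply Rabs_pos.
  (* The comparison function is [u^(m + 2)], two powers above the growth of [f]. One extra power is
     consumed by [B'' <= eps * B]. *)
  set (n := INR m + 2). assert (Hn : 2 <= n) by (unfold n; pose proof (pos_INR m); lra).
  (* Since [eta * x^2 <= u], the second derivative of [u^n] is at most
     [(2 n + 4 n^2) * eta * u^(n - 1)]; this choice of [eta] makes it at most [eps * u^n]. *)
  set (eta := Rmin 1 (eps / (2 * n + 4 * n ^ 2))).
  assert (Heta : 0 < eta <= 1 /\ (2 * n + 4 * n ^ 2) * eta <= eps).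
  { assert (0 < eps / (2 * n + 4 * n ^ 2)) by (apply Rdiv_lt_0_compat; nra).
    unfold eta; split; [split; [apply Rmin_glb_lt; lra|apply Rmin_l]|].
    apply Rle_trans with ((2 * n + 4 * n ^ 2) * (eps / (2 * n + 4 * n ^ 2))).
    - apply Rmult_le_compat_l; [nra|apply Rmin_r].
    - right; field; nra. }
  destruct Heta as [[He0 He1] He2].
  set (u := fun x => 1 + eta * x ^ 2).
  assert (Hu : forall x, 1 <= u x) by (intros x; unfold u; nra).
  set (B := fun x => u x ^ (S (S m))).
  set (B1 := fun x => n * (2 * eta * x) * u x ^ S m).
  set (B2 := fun x => 2 * n * eta * u x ^ S m + n * (n - 1) * (2 * eta * x) ^ 2 * u x ^ m).
  assert (DB1 : forall x, is_derive B x (B1 x)).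
  { intros x; unfold B, B1, u. evar_last. apply (is_derive_pow (fun x => 1 + eta * x ^ 2) (S (S m)) x (2 * eta * x)).
    auto_derive; auto; eqR; ring. rewrite !S_INR. simpl pred. unfold n. ring. }
  assert (DB2 : forall x, is_derive B1 x (B2 x)).
  { intros x; unfold B1, B2. evar_last. apply is_derive_Rmult.
    - instantiate (1 := n * (2 * eta)). auto_derive; auto; eqR; ring.
    - apply (is_derive_pow u (S m) x (2 * eta * x)). unfold u. auto_derive; auto; eqR; ring.
    - rewrite S_INR. simpl pred. unfold n; ring. }
  assert (HB2 : forall x, B2 x <= eps * B x).
  { intros x. specialize (Hu x).
    assert (P : 0 < u x ^ m) by (apply pow_lt; lra).
    assert (X : 0 <= eta * x ^ 2 <= u x) by (unfold u; split; nra).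
    replace (B2 x) with ((2 * n * eta * u x + n * (n - 1) * (4 * eta) * (eta * x ^ 2)) * u x ^ m)
      by (unfold B2; simpl; ring).
    replace (eps * B x) with (eps * (u x * u x) * u x ^ m) by (unfold B; simpl; ring).
    apply Rmult_le_compat_r; [lra|].
    assert (0 <= n * (n - 1) * (4 * eta)) by (repeat apply Rmult_le_pos; lra).
    assert (n * (n - 1) * (4 * eta) * (eta * x ^ 2) <= n * (n - 1) * (4 * eta) * u x)
      by (apply Rmult_le_compat_l; tauto).
    apply Rle_trans with ((2 * n + 4 * n ^ 2) * eta * u x).
    - assert (0 <= n * eta * u x) by (repeat apply Rmult_le_pos; lra). nra.
    - apply Rle_trans with (eps * u x); [apply Rmult_le_compat_r; lra|].
      assert (u x <= u x * u x) by nra. apply Rmult_le_compat_l; lra. }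
  set (del := f x0 / (2 * B x0)).
  assert (HBp : forall x, 0 < B x) by (intros x; apply pow_lt; specialize (Hu x); lra).
  assert (Hdel : 0 < del) by (apply Rdiv_lt_0_compat; [lra|specialize (HBp x0); lra]).
  set (h := fun x => f x - del * B x). set (h1 := fun x => f1 x - del * B1 x).
  assert (Hh0 : 0 < h x0).
  { unfold h, del. specialize (HBp x0). replace (f x0 / (2 * B x0) * B x0) with (f x0 / 2) by (field; lra). lra. }
  assert (Dh : forall x, is_derive h x (h1 x)).
  { intros x; apply is_derive_Rminus; [apply D1|apply is_derive_scal, DB1]. }
  assert (Dh1 : forall x, is_derive h1 x (q x * f x - del * B2 x)).
  { intros x; apply is_derive_Rminus; [apply D2|apply is_derive_scal, DB2]. }
  (* With this [K], [f <= del * K * u^m], which is below [del * u^(m + 2)] as soon as [u > K]; [N]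
     is a radius beyond which that holds. *)
  set (K := M * (/ eta) ^ m / del).
  assert (HK : 0 <= K).
  { apply Rdiv_le_0_compat; auto. apply Rmult_le_pos; auto. apply pow_le. left; now apply Rinv_0_lt_compat. }
  set (N := Rabs x0 + 1 + K / eta).
  assert (HKe : 0 <= K / eta) by (apply Rdiv_le_0_compat; auto).
  pose proof (Rabs_pos x0) as Hax.
  assert (Hout : forall x, N <= Rabs x -> h x < 0).
  { intros x Hx.
    assert (Hx2 : N <= x ^ 2) by (rewrite <- pow2_abs; unfold N in *; nra).
    assert (Hux : K < u x).
    { unfold u. assert (K = eta * (K / eta)) by (field; lra).
      assert (eta * (K / eta) <= eta * x ^ 2) by (apply Rmult_le_compat_l; unfold N in *; lra). lra. }
    assert (Hf : f x <= M * (/ eta) ^ m * u x ^ m).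
    { eapply Rle_trans; [apply Rle_abs|]. eapply Rle_trans; [apply H|].
      rewrite Rmult_assoc, <- Rpow_mult_distr. apply Rmult_le_compat_l; auto.
      apply pow_incr. split; [nra|]. unfold u.
      replace (/ eta * (1 + eta * x ^ 2)) with (/ eta + x ^ 2) by (field; lra).
      assert (1 <= / eta) by (rewrite <- Rinv_1; apply Rinv_le_contravar; lra). lra. }
    unfold h, B. simpl pow. specialize (Hu x).
    assert (P : 0 < u x ^ m) by (apply pow_lt; lra).
    replace (M * (/ eta) ^ m) with (del * K) in Hf by (unfold K; field; lra).
    assert (K * 1 < u x * u x) by nra.
    assert (del * K * u x ^ m < del * (u x * u x) * u x ^ m).
    { apply Rmult_lt_compat_r; auto. apply Rmult_lt_compat_l; lra. }
    lra. }
  destruct (continuity_ab_maj h (- N) N) as [x1 [Hmax Hx1]].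
  { unfold N; lra. }
  { intros c _. apply derivable_continuous_pt. exists (h1 c). now apply is_derive_Reals. }
  assert (Hxr : - N <= x0 <= N).
  { assert (Rabs x0 <= N) by (unfold N; lra). now apply Rabs_le_between. }
  assert (Hh1 : 0 < h x1) by (specialize (Hmax x0 Hxr); lra).
  assert (Hin : - N < x1 < N).
  { apply Rabs_lt_between. apply Rnot_le_lt; intros HH. apply Hout in HH. lra. }
  assert (Ez : h1 x1 = 0).
  { assert (pr : derivable_pt h x1) by (exists (h1 x1); now apply is_derive_Reals).
    rewrite <- (deriv_maximum h (- N) N x1 pr); try tauto.
    - symmetry. apply derive_pt_eq_0. now apply is_derive_Reals.
    - intros x Hx1' Hx2'. apply Hmax; lra. }
  (* At the maximum [f > del * B] and [B'' <= eps * B <= q * B], so the second derivative is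
     positive and [h] increases to the right of [x1]. *)
  assert (Hl : 0 < q x1 * f x1 - del * B2 x1).
  { assert (del * B x1 < f x1) by (unfold h in Hh1; lra).
    assert (del * B2 x1 <= del * (eps * B x1)) by (apply Rmult_le_compat_l; [lra|apply HB2]).
    assert (0 < del * B x1) by (apply Rmult_lt_0_compat; auto).
    specialize (Hq x1). nra. }
  specialize (Dh1 x1). apply is_derive_Reals in Dh1.
  destruct (Dh1 _ Hl) as [rho Hrho].
  set (y := Rmin (rho / 2) ((N - x1) / 2)).
  assert (Hy : 0 < y /\ y < rho /\ x1 + y < N).
  { pose proof (cond_pos rho). unfold y. pose proof (Rmin_l (rho / 2) ((N - x1) / 2)). pose proof (Rmin_r (rho / 2) ((N - x1) / 2)).
    split; [apply Rmin_glb_lt|]; lra. }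
  destruct (MVT_cor2 h h1 x1 (x1 + y)) as [c [Ec Hc]]; [lra|intros; now apply is_derive_Reals|].
  assert (Hpos : 0 < h1 c).
  { specialize (Hrho (c - x1) ltac:(lra)). rewrite Rabs_pos_eq in Hrho by lra.
    specialize (Hrho ltac:(lra)). replace (x1 + (c - x1)) with c in Hrho by ring.
    rewrite Ez, Rminus_0_r in Hrho. apply Rabs_lt_between in Hrho.
    assert (Hq' : 0 < h1 c / (c - x1)) by lra.
    replace (h1 c) with (h1 c / (c - x1) * (c - x1)) by (field; lra).
    apply Rmult_lt_0_compat; lra. }
  specialize (Hmax (x1 + y) ltac:(lra)). nra.
Qed.

(** The equation is [- f'' + (a x + b)^2 f = (lam + a) f]. Subtracting the ground state energy [a]
    makes [2 a k], with [k] natural, the admissible values of [lam]. *)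
Definition oscillator (a b lam : R) (f f1 : R -> R) : Prop :=
  (forall x, is_derive f x (f1 x)) /\
  (forall x, is_derive f1 x (((a * x + b) ^ 2 - a - lam) * f x)).

(** This is the annihilation operator [d/dx + (a x + b)]; its commutator with the oscillator lowers
    the parameter by [2 a]. *)
Lemma oscillator_lower a b lam f f1 : oscillator a b lam f f1 ->
  oscillator a b (lam - 2 * a) (fun x => f1 x + (a * x + b) * f x)
    (fun x => ((a * x + b) ^ 2 - lam) * f x + (a * x + b) * f1 x).
Proof.
  intros [H1 H2]; split; intros x.
  - evar_last. apply is_derive_Rplus; [apply H2|].
    apply is_derive_Rmult; [|apply H1]. instantiate (1 := a). auto_derive; auto; eqR; ring.
    eqR; ring.
  - evar_last. apply is_derive_Rplus.
    + apply is_derive_Rmult; [|apply H1].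
      instantiate (1 := 2 * a * (a * x + b)). auto_derive; auto; eqR; ring.
    + apply is_derive_Rmult; [|apply H2].
      instantiate (1 := a). auto_derive; auto; eqR; ring.
    + eqR; ring.
Qed.

Lemma oscillator_poly_bounded a b lam f f1 : oscillator a b lam f f1 ->
  poly_bounded f -> poly_bounded f1.
Proof.
  intros [H1 H2] Hf. eapply poly_bounded_derive; [exact H1|exact H2|exact Hf|].
  apply poly_bounded_mult; auto.
  destruct (poly_bounded_plus _ _ (poly_bounded_mult _ _ (poly_bounded_affine a b) (poly_bounded_affine a b))
    (poly_bounded_affine 0 (- a - lam))) as [M [m H]].
  exists M, m. intros x. rewrite <- H. right; f_equal; ring.
Qed.

Lemma oscillator_lower_poly_bounded a b lam f f1 : oscillator a b lam f f1 ->
  poly_bounded f -> poly_bounded (fun x => f1 x + (a * x + b) * f x).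
Proof.
  intros Ho Hf. apply poly_bounded_plus. eapply oscillator_poly_bounded; eauto.
  apply poly_bounded_mult; auto. apply poly_bounded_affine.
Qed.

(** The coefficient of [f] is then bounded below by [- a - lam > 0], so the maximum principle
    applies to [f] and to [- f]. *)
Lemma oscillator_neg a b lam f f1 : lam < - a -> oscillator a b lam f f1 ->
  poly_bounded f -> forall x, f x = 0.
Proof.
  intros Hl [H1 H2] Hf x. apply Rle_antisym.
  - apply (convex_poly_bounded_le0 f f1 (fun x => (a * x + b) ^ 2 - a - lam) (- a - lam)); auto; [lra|].
    intros y; cbv beta; pose proof (pow2_ge_0 (a * y + b)); lra.
  - enough (- f x <= 0) by lra.
    apply (convex_poly_bounded_le0 (fun x => - f x) (fun x => - f1 x)
       (fun x => (a * x + b) ^ 2 - a - lam) (- a - lam)); [lra|intros y; cbv beta; pose proof (pow2_ge_0 (a * y + b)); lra| | |].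
    + intros y. apply is_derive_Ropp, H1.
    + intros y. evar_last. apply is_derive_Ropp, H2. eqR; ring.
    + destruct Hf as [M [m Hf]]. exists M, m. intros y. now rewrite Rabs_Ropp.
Qed.

Lemma is_derive_zero_fun (f f1 : R -> R) x :
  (forall x, is_derive f x (f1 x)) -> (forall x, f x = 0) -> f1 x = 0.
Proof.
  intros H H0. rewrite <- (is_derive_unique _ _ _ (H x)).
  rewrite (Derive_ext f (fun _ => 0)) by apply H0. apply Derive_const.
Qed.

(** Differentiating [f' = - (a x + b) f] and comparing with the equation leaves [lam * f = 0]. *)
Lemma oscillator_lower_kernel a b lam f f1 : oscillator a b lam f f1 ->
  (forall x, f1 x + (a * x + b) * f x = 0) -> lam <> 0 -> forall x, f x = 0.
Proof.
  intros Ho H0 Hl x. pose proof (proj1 (oscillator_lower _ _ _ _ _ Ho)) as D.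
  pose proof (is_derive_zero_fun _ _ x D H0) as E. simpl in E.
  specialize (H0 x). apply Rmult_eq_reg_l with lam; auto.
  replace (f1 x) with (- (a * x + b) * f x) in E by lra. nra.
Qed.

(** Lowering often enough reaches [lam < - a], where only zero is left. The way back up is
    injective, because the parameter never passes through 0. *)
Lemma oscillator_nonquantized a b lam f f1 : 0 < a -> (forall k, lam <> 2 * a * INR k) ->
  oscillator a b lam f f1 -> poly_bounded f -> forall x, f x = 0.
Proof.
  intros Ha Hk Ho Hf.
  assert (exists n, lam < 2 * a * INR n - a) as [n Hn].
  { destruct (nfloor_ex (Rabs ((lam + a) / (2 * a)))) as [n [_ Hn]]; [apply Rabs_pos|].
    exists (S n). rewrite S_INR. pose proof (Rle_abs ((lam + a) / (2 * a))).
    assert (E : lam + a = 2 * a * ((lam + a) / (2 * a))) by (field; lra).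
    assert (2 * a * ((lam + a) / (2 * a)) < 2 * a * (INR n + 1)) by (apply Rmult_lt_compat_l; lra). lra. }
  revert lam f f1 Hn Hk Ho Hf. induction n as [|n IH]; intros lam f f1 Hn Hk Ho Hf.
  - simpl in Hn. apply (oscillator_neg a b lam f f1); auto. lra.
  - apply (oscillator_lower_kernel a b lam f f1); auto.
    + apply (IH (lam - 2 * a) _ _) with (3 := oscillator_lower _ _ _ _ _ Ho).
      * rewrite S_INR in Hn; lra.
      * intros k E. apply (Hk (S k)). rewrite S_INR; lra.
      * now apply (oscillator_lower_poly_bounded a b lam).
    + specialize (Hk 0%nat). simpl in Hk. lra.
Qed.

Lemma herm_affine_derive a b k x : a <> 0 ->
  is_derive (fun x => herm a k (a * x + b)) x
    ((herm a (S k) (a * x + b) - 2 * a * INR k * herm a (pred k) (a * x + b)) / 2).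
Proof.
  intros Ha. evar_last.
  - apply (is_derive_Rcomp (herm a k) (fun x => a * x + b)).
    apply herm_derive; auto. instantiate (1 := a). auto_derive; auto; eqR; ring.
  - eqR; field; auto.
Qed.

(** At level 0 the lowered function has parameter [- 2 a] and vanishes, so [f] times the inverse
    Gaussian is constant. At level [k + 1] the lowered function is [M] times level [k]; its
    derivative then determines [f] algebraically, since [lam] is nonzero, which is the origin of the
    constant [- M / (2 a (k + 1))]. *)
Lemma oscillator_quantized a b k f f1 : 0 < a ->
  oscillator a b (2 * a * INR k) f f1 -> poly_bounded f ->
  exists M, forall x, f x = M * herm a k (a * x + b).
Proof.
  intros Ha. revert f f1; induction k as [|k IH]; intros f f1 Ho Hf.
  - assert (H0 : forall x, f1 x + (a * x + b) * f x = 0).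
    { apply (oscillator_neg a b (2 * a * INR 0 - 2 * a) _ _) with (2 := oscillator_lower _ _ _ _ _ Ho).
      simpl; lra. now apply (oscillator_lower_poly_bounded a b _ f f1 Ho). }
    set (g := fun x => f x * exp ((a * x + b) ^ 2 / (2 * a))).
    assert (Dg : forall x, is_derive g x 0).
    { intros x; unfold g. evar_last. apply is_derive_Rmult. apply (proj1 Ho).
      apply (is_derive_Rcomp exp (fun x => (a * x + b) ^ 2 / (2 * a)) x (exp ((a * x + b) ^ 2 / (2 * a))) (a * x + b)).
      apply is_derive_exp. auto_derive; auto. field; lra.
      replace (f1 x) with (- (a * x + b) * f x) by (specialize (H0 x); lra). simpl; ring. }
    assert (Eg : forall x, g x = g 0).
    { intros x. destruct (MVT_gen g 0 x (fun _ => 0)) as [c [_ E]]; [intros; apply Dg| |lra].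
      intros y _. apply derivable_continuous_pt. exists 0. now apply is_derive_Reals. }
    exists (g 0). intros x. rewrite <- (Eg x). unfold g. simpl herm.
    rewrite Rmult_assoc, <- exp_plus.
    replace (_ + _) with 0 by (simpl; field; lra). rewrite exp_0; ring.
  - destruct (IH (fun x => f1 x + (a * x + b) * f x)
      (fun x => ((a * x + b) ^ 2 - 2 * a * INR (S k)) * f x + (a * x + b) * f1 x)) as [M HM].
    + replace (2 * a * INR k) with (2 * a * INR (S k) - 2 * a) by (rewrite S_INR; ring).
      now apply oscillator_lower.
    + now apply (oscillator_lower_poly_bounded a b _ f f1 Ho).
    + exists (- M / (2 * a * INR (S k))). intros x.
      assert (Hk : 0 < INR (S k)) by (apply lt_0_INR; lia).
      pose proof (proj1 (oscillator_lower _ _ _ _ _ Ho) x) as D.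
      pose proof (is_derive_scal _ x M _ (herm_affine_derive a b k x ltac:(lra))) as D'.
      assert (E : ((a * x + b) ^ 2 - 2 * a * INR (S k)) * f x + (a * x + b) * f1 x =
        M * ((herm a (S k) (a * x + b) - 2 * a * INR k * herm a (pred k) (a * x + b)) / 2)).
      { transitivity (Derive (fun x => f1 x + (a * x + b) * f x) x).
        - symmetry. exact (is_derive_unique _ _ _ D).
        - rewrite (Derive_ext _ (fun x => M * herm a k (a * x + b))) by (intros; apply HM).
          exact (is_derive_unique _ _ _ D'). }
      specialize (HM x).
      assert (E2 : f1 x = M * herm a k (a * x + b) - (a * x + b) * f x) by lra.
      rewrite E2 in E.
      assert (E3 : - (2 * a * INR (S k)) * f x = M * herm a (S k) (a * x + b)).
      { pose proof (herm_S a k (a * x + b)) as E4.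
        replace (2 * a * INR k * herm a (pred k) (a * x + b)) with
          (- 2 * (a * x + b) * herm a k (a * x + b) - herm a (S k) (a * x + b)) in E by lra.
        lra. }
      apply Rmult_eq_reg_l with (- (2 * a * INR (S k))); [|nra].
      rewrite E3. field. split; lra.
Qed.

(** * Series over the integers *)

Definition weight (j : Z) : R := / (1 + IZR j ^ 2).

(** Pairing [n] with [- n - 1] meets every integer exactly once and turns a two-sided sum into an
    ordinary series. *)
Definition paired (f : Z -> R) (n : nat) : R := f (Z.of_nat n) + f (- Z.of_nat n - 1)%Z.

Definition sumZ (f : Z -> R) : R := Series (paired f).

Definition dominated (M : R) (f : Z -> R) : Prop := forall j, Rabs (f j) <= M * weight j.

Lemma weight_pos j : 0 < weight j.
Proof. apply Rinv_0_lt_compat. pose proof (pow2_ge_0 (IZR j)). lra. Qed.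

Lemma dominated_pos M f : dominated M f -> 0 <= M.
Proof.
  intros H. specialize (H 0%Z). pose proof (weight_pos 0). pose proof (Rabs_pos (f 0%Z)).
  apply Rnot_lt_le; intros HM. nra.
Qed.

(** The majorant is chosen to telescope: it sums to 8 and its tail beyond [N] is [8 / (N + 2)],
    which gives explicit error terms. *)
Lemma weight_paired n : weight (Z.of_nat n) + weight (- Z.of_nat n - 1) <= 8 / ((INR n + 1) * (INR n + 2)).
Proof.
  unfold weight. rewrite minus_IZR, opp_IZR, <- INR_IZR_INZ. pose proof (pos_INR n) as H.
  set (x := INR n) in *.
  assert (H1 : / (1 + x ^ 2) <= 4 / ((x + 1) * (x + 2))).
  { apply Rmult_le_reg_r with ((1 + x ^ 2) * ((x + 1) * (x + 2))); [nra|].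
    replace (/ (1 + x ^ 2) * ((1 + x ^ 2) * ((x + 1) * (x + 2)))) with ((x + 1) * (x + 2)) by (field; nra).
    replace (4 / ((x + 1) * (x + 2)) * ((1 + x ^ 2) * ((x + 1) * (x + 2)))) with (4 * (1 + x ^ 2)) by (field; nra).
    nra. }
  assert (H2 : / (1 + (- x - 1) ^ 2) <= / (1 + x ^ 2)) by (apply Rinv_le_contravar; nra).
  replace (8 / ((x + 1) * (x + 2))) with (2 * (4 / ((x + 1) * (x + 2)))) by (field; nra). lra.
Qed.

Lemma sum_telescope N : sum_f_R0 (fun n => 8 / ((INR n + 1) * (INR n + 2))) N = 8 - 8 / (INR N + 2).
Proof.
  induction N as [|N IH]; [simpl; field|].
  rewrite tech5, IH, S_INR. pose proof (pos_INR N). field. lra.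
Qed.

Lemma arch_inv K eps : 0 <= K -> 0 < eps -> exists N : nat, K / (INR N + 2) < eps.
Proof.
  intros HK He. destruct (nfloor_ex (K / eps)) as [N [_ HN]]; [apply Rdiv_le_0_compat; auto|].
  exists N. pose proof (pos_INR N).
  apply Rmult_lt_reg_r with (INR N + 2); [lra|].
  replace (K / (INR N + 2) * (INR N + 2)) with (K / eps * eps) by (field; lra). nra.
Qed.

Lemma is_series_telescope : is_series (fun n => 8 / ((INR n + 1) * (INR n + 2))) 8.
Proof.
  apply is_series_Reals. intros eps He.
  destruct (arch_inv 8 eps ltac:(lra) He) as [N HN]. exists N. intros n Hn.
  rewrite sum_telescope. unfold Rdist. pose proof (pos_INR n).
  replace (8 - 8 / (INR n + 2) - 8) with (- (8 / (INR n + 2))) by ring.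
  rewrite Rabs_Ropp, Rabs_pos_eq by (apply Rdiv_le_0_compat; lra).
  eapply Rle_lt_trans; [|exact HN]. apply le_INR in Hn. pose proof (pos_INR N).
  unfold Rdiv. apply Rmult_le_compat_l; [lra|]. apply Rinv_le_contravar; lra.
Qed.

Lemma paired_dominated M f n : dominated M f ->
  Rabs (paired f n) <= M * (8 / ((INR n + 1) * (INR n + 2))).
Proof.
  intros H. unfold paired. eapply Rle_trans; [apply Rabs_triang|].
  pose proof (H (Z.of_nat n)). pose proof (H (- Z.of_nat n - 1)%Z).
  pose proof (weight_paired n). pose proof (dominated_pos _ _ H). nra.
Qed.

Lemma ex_series_paired M f : dominated M f -> ex_series (paired f).
Proof.
  intros H. apply (@ex_series_le R_AbsRing R_CompleteNormedModule _ (fun n => M * (8 / ((INR n + 1) * (INR n + 2))))).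
  - intros n. now apply paired_dominated.
  - apply (ex_series_scal_l (K := R_AbsRing) (V := R_NormedModule) M (fun n => 8 / ((INR n + 1) * (INR n + 2)))). eexists; apply is_series_telescope.
Qed.

Lemma sumZ_tail M f N : dominated M f ->
  Rabs (sumZ f - sum_f_R0 (paired f) N) <= M * 8 / (INR N + 2).
Proof.
  intros H. unfold sumZ. rewrite (Series_incr_n _ (S N)); [|lia|now apply ex_series_paired with M].
  simpl pred. match goal with |- Rabs (?a + ?b - ?a) <= _ => replace (a + b - a) with b by ring end.
  set (T := fun n => 8 / ((INR n + 1) * (INR n + 2))).
  assert (HT : Series (fun k => T (S N + k)%nat) = 8 / (INR N + 2)).
  { pose proof (Series_incr_n T (S N) ltac:(lia) ltac:(eexists; apply is_series_telescope)) as E.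
    rewrite (is_series_unique T 8 is_series_telescope) in E. simpl pred in E.
    unfold T in E at 1. rewrite sum_telescope in E. lra. }
  assert (HE : ex_series (fun k => M * T (S N + k)%nat)).
  { apply (ex_series_scal_l (K := R_AbsRing) (V := R_NormedModule) M (fun k => T (S N + k)%nat)).
    apply (ex_series_incr_n T (S N)). eexists; apply is_series_telescope. }
  assert (HL : forall k, 0 <= Rabs (paired f (S N + k)) <= M * T (S N + k)%nat).
  { intros k; split; [apply Rabs_pos|now apply paired_dominated]. }
  eapply Rle_trans; [apply Series_Rabs|].
  - apply (@ex_series_le R_AbsRing R_CompleteNormedModule _ (fun k => M * T (S N + k)%nat)); auto.
    intros k. change (Rabs (Rabs (paired f (S N + k))) <= M * T (S N + k)%nat). rewrite Rabs_Rabsolu. apply HL.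
  - eapply Rle_trans; [apply (Series_le _ (fun k => M * T (S N + k)%nat)); auto|].
    rewrite Series_scal_l, HT. right; unfold Rdiv; ring.
Qed.

Lemma sumZ_bound M f : dominated M f -> Rabs (sumZ f) <= 8 * M.
Proof.
  intros H. pose proof (sumZ_tail M f 0 H) as A. simpl sum_f_R0 in A.
  pose proof (paired_dominated M f 0 H) as B. simpl INR in *.
  replace (sumZ f) with ((sumZ f - paired f 0) + paired f 0) by ring.
  eapply Rle_trans; [apply Rabs_triang|]. lra.
Qed.

(** A sum is recognized from any number that its partial sums approach at rate [1 / N]. This is how
    reindexing and exchange with integrals are proved. *)
Lemma sumZ_unique M K f s : dominated M f ->
  (forall N, Rabs (s - sum_f_R0 (paired f) N) <= K / (INR N + 2)) -> s = sumZ f.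
Proof.
  intros H Hs. apply Rminus_diag_uniq. apply Rabs_eq_0. apply Rle_antisym; [|apply Rabs_pos].
  apply Rnot_lt_le; intros Hp.
  pose proof (dominated_pos _ _ H) as HM.
  destruct (arch_inv (Rabs K + M * 8) _ ltac:(pose proof (Rabs_pos K); lra) Hp) as [N HN].
  apply (Rlt_irrefl (Rabs (s - sumZ f))). eapply Rle_lt_trans; [|exact HN].
  replace (s - sumZ f) with ((s - sum_f_R0 (paired f) N) - (sumZ f - sum_f_R0 (paired f) N)) by ring.
  eapply Rle_trans; [apply Rabs_triang|]. rewrite Rabs_Ropp.
  pose proof (sumZ_tail M f N H). specialize (Hs N). pose proof (pos_INR N).
  assert (K / (INR N + 2) <= Rabs K / (INR N + 2)).
  { unfold Rdiv. apply Rmult_le_compat_r; [left; apply Rinv_0_lt_compat; lra|apply Rle_abs]. }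
  unfold Rdiv in *; lra.
Qed.

Lemma sumZ_ext f g : (forall j, f j = g j) -> sumZ f = sumZ g.
Proof. intros H; apply Series_ext; intros n; unfold paired; now rewrite !H. Qed.

Lemma dominated_plus M N f g : dominated M f -> dominated N g -> dominated (M + N) (fun j => f j + g j).
Proof.
  intros H1 H2 j. eapply Rle_trans; [apply Rabs_triang|]. specialize (H1 j). specialize (H2 j). lra.
Qed.

Lemma dominated_scal M c f : dominated M f -> dominated (Rabs c * M) (fun j => c * f j).
Proof.
  intros H j. rewrite Rabs_mult, Rmult_assoc. apply Rmult_le_compat_l; [apply Rabs_pos|apply H].
Qed.

Lemma sumZ_plus M N f g : dominated M f -> dominated N g ->
  sumZ (fun j => f j + g j) = sumZ f + sumZ g.
Proof.
  intros H1 H2. unfold sumZ. rewrite <- Series_plus by (eapply ex_series_paired; eauto).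
  apply Series_ext; intros n; unfold paired; ring.
Qed.

Lemma sumZ_scal c f : sumZ (fun j => c * f j) = c * sumZ f.
Proof. unfold sumZ. rewrite <- Series_scal_l. apply Series_ext; intros n; unfold paired; ring. Qed.

(** The constant works because [(1 + x^2) / (1 + (x + 1)^2)] never exceeds 3. *)
Lemma dominated_shift M f : dominated M f -> dominated (3 * M) (fun j => f (j + 1)%Z).
Proof.
  intros H j. eapply Rle_trans; [apply H|]. pose proof (dominated_pos _ _ H).
  enough (weight (j + 1) <= 3 * weight j) by nra.
  unfold weight. rewrite plus_IZR. set (x := IZR j).
  apply Rmult_le_reg_r with ((1 + (x + 1) ^ 2) * (1 + x ^ 2)); [nra|].
  replace (/ (1 + (x + 1) ^ 2) * ((1 + (x + 1) ^ 2) * (1 + x ^ 2))) with (1 + x ^ 2) by (field; nra).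
  replace (3 * / (1 + x ^ 2) * ((1 + (x + 1) ^ 2) * (1 + x ^ 2))) with (3 * (1 + (x + 1) ^ 2)) by (field; nra).
  pose proof (pow2_ge_0 (2 * x + 3)). nra.
Qed.

Lemma dominated_unshift M f : dominated M f -> dominated (3 * M) (fun j => f (j - 1)%Z).
Proof.
  intros H j.
  pose proof (dominated_shift M (fun j => f (- j)%Z)) as A.
  assert (B : dominated M (fun j => f (- j)%Z)).
  { intros i. specialize (H (- i)%Z). unfold weight in *. rewrite opp_IZR in H.
    now replace ((- IZR i) ^ 2) with (IZR i ^ 2) in H by ring. }
  specialize (A B (- j)%Z). cbv beta in A. unfold weight in *. rewrite opp_IZR in A.
  replace ((- IZR j) ^ 2) with (IZR j ^ 2) in A by ring.
  replace (- (- j + 1))%Z with (j - 1)%Z in A by ring. exact A.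
Qed.

(** A unit shift changes the [N]-th partial sum only by the boundary terms [f (N + 1)] and
    [f (- N - 1)], which are of order [1 / N]. *)
Lemma sumZ_shift1 M f : dominated M f -> sumZ (fun j => f (j + 1)%Z) = sumZ f.
Proof.
  intros H. symmetry.
  apply (sumZ_unique (3 * M) (2 * M + M * 8)); [now apply dominated_shift|].
  intros N.
  assert (E : sum_f_R0 (paired (fun j => f (j + 1)%Z)) N =
    sum_f_R0 (paired f) N + (f (Z.of_nat N + 1)%Z - f (- Z.of_nat N - 1)%Z)).
  { induction N as [|N IH].
    - simpl; unfold paired; simpl. ring.
    - rewrite !tech5, IH. unfold paired. rewrite Nat2Z.inj_succ.
      replace (- Z.succ (Z.of_nat N) - 1 + 1)%Z with (- Z.of_nat N - 1)%Z by lia.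
      unfold Z.succ. ring. }
  rewrite E. set (u := f (Z.of_nat N + 1)%Z). set (v := f (- Z.of_nat N - 1)%Z).
  replace (sumZ f - (sum_f_R0 (paired f) N + (u - v))) with ((sumZ f - sum_f_R0 (paired f) N) + (v - u)) by ring.
  eapply Rle_trans; [apply Rabs_triang|]. pose proof (sumZ_tail M f N H).
  pose proof (dominated_pos _ _ H) as HM. pose proof (pos_INR N) as HN.
  assert (B : forall i, IZR i ^ 2 = (INR N + 1) ^ 2 -> Rabs (f i) <= M / (INR N + 2)).
  { intros i Hi. eapply Rle_trans; [apply H|]. unfold Rdiv. apply Rmult_le_compat_l; auto.
    unfold weight. rewrite Hi. apply Rinv_le_contravar; nra. }
  assert (Rabs (v - u) <= 2 * M / (INR N + 2)).
  { eapply Rle_trans; [apply Rabs_triang|]. rewrite Rabs_Ropp.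
    pose proof (B (Z.of_nat N + 1)%Z ltac:(rewrite plus_IZR, <- INR_IZR_INZ; ring)).
    pose proof (B (- Z.of_nat N - 1)%Z ltac:(rewrite minus_IZR, opp_IZR, <- INR_IZR_INZ; ring)).
    fold u in H1. fold v in H2. unfold Rdiv in *. lra. }
  unfold Rdiv in *; lra.
Qed.

Lemma sumZ_shift M f (m : Z) : dominated M f -> sumZ (fun j => f (j + m)%Z) = sumZ f.
Proof.
  intros H.
  enough (A : exists M', dominated M' (fun j => f (j + m)%Z) /\ sumZ (fun j => f (j + m)%Z) = sumZ f)
    by (destruct A as [? [_ A]]; exact A).
  revert m; apply Z.peano_ind.
  - exists M; split; [intros j|apply sumZ_ext; intros j]; now rewrite Z.add_0_r.
  - intros m [M' [H1 H2]]. exists (3 * M').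
    assert (E : forall j, f (j + Z.succ m)%Z = f ((j + 1) + m)%Z) by (intros; f_equal; lia).
    split; [intros j; rewrite E; now apply (dominated_shift M' (fun j => f (j + m)%Z))|].
    rewrite (sumZ_ext _ _ E), <- H2. now apply (sumZ_shift1 M' (fun j => f (j + m)%Z)).
  - intros m [M' [H1 H2]]. exists (3 * M').
    assert (E : forall j, f (j + Z.pred m)%Z = f ((j - 1) + m)%Z) by (intros; f_equal; lia).
    assert (D : dominated (3 * M') (fun j => f (j + Z.pred m)%Z)).
    { intros j; rewrite E; now apply (dominated_unshift M' (fun j => f (j + m)%Z)). }
    split; [exact D|].
    rewrite <- H2. rewrite <- (sumZ_shift1 _ _ D). apply sumZ_ext. intros j; f_equal; lia.
Qed.

Lemma sumZ_single f : (forall j, j <> 0%Z -> f j = 0) -> sumZ f = f 0%Z.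
Proof.
  intros H. symmetry. apply (sumZ_unique (Rabs (f 0%Z)) 0).
  - intros j. destruct (Z.eq_dec j 0) as [->|Hj].
    + unfold weight. simpl. replace (1 + 0 * (0 * 1)) with 1 by ring. rewrite Rinv_1. lra.
    + rewrite (H j Hj), Rabs_R0. apply Rmult_le_pos; [apply Rabs_pos|left; apply weight_pos].
  - intros N. assert (E : sum_f_R0 (paired f) N = f 0%Z).
    { induction N as [|N IH].
      - simpl. unfold paired. rewrite (H (- Z.of_nat 0 - 1)%Z) by lia. simpl; ring.
      - rewrite tech5, IH. unfold paired. rewrite (H (Z.of_nat (S N))), (H (- Z.of_nat (S N) - 1)%Z) by lia. ring. }
    rewrite E, Rminus_diag, Rabs_R0. unfold Rdiv; lra.
Qed.

Lemma continuous_sum_f_R0 {U : UniformSpace} (F : nat -> U -> R) N x :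
  (forall n, continuous (F n) x) -> continuous (fun p => sum_f_R0 (fun n => F n p) N) x.
Proof. intros H; induction N; simpl; [apply H|now apply continuous_Rplus]. Qed.

Lemma continuous_sumZ {U : UniformSpace} (F : Z -> U -> R) M p0 :
  (forall j, continuous (F j) p0) -> locally p0 (fun p => dominated M (fun j => F j p)) ->
  continuous (fun p => sumZ (fun j => F j p)) p0.
Proof.
  intros Hc Hd P [eps HP].
  pose proof (cond_pos eps) as He.
  pose proof (locally_singleton _ _ Hd) as H0.
  pose proof (dominated_pos _ _ H0) as HM.
  destruct (arch_inv (M * 8) (eps / 3)) as [N HN]; [lra|lra|].
  assert (CS : continuous (fun p => sum_f_R0 (paired (fun j => F j p)) N) p0).
  { apply (continuous_sum_f_R0 (fun n p => paired (fun j => F j p) n)).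
    intros n. unfold paired. now apply continuous_Rplus. }
  specialize (CS (ball (sum_f_R0 (paired (fun j => F j p0)) N) (mkposreal (eps / 3) ltac:(lra)))
     ltac:(apply locally_ball)).
  change (locally p0 (fun p => P (sumZ (fun j => F j p)))).
  eapply filter_imp; [|exact (filter_and _ _ Hd CS)].
  intros p [Hp Hb]. apply HP.
  change (Rabs (sumZ (fun j => F j p) - sumZ (fun j => F j p0)) < eps).
  change (Rabs (sum_f_R0 (paired (fun j => F j p)) N - sum_f_R0 (paired (fun j => F j p0)) N) < eps / 3) in Hb.
  pose proof (sumZ_tail _ _ N Hp) as A. pose proof (sumZ_tail _ _ N H0) as B.
  apply Rabs_lt_between. apply Rabs_lt_between in Hb. apply Rabs_le_between in A. apply Rabs_le_between in B. lra.
Qed.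

Lemma RInt_sum_f_R0 (F : nat -> R -> R) N : (forall n t, continuous (F n) t) ->
  RInt (fun t => sum_f_R0 (fun n => F n t) N) 0 1 = sum_f_R0 (fun n => RInt (F n) 0 1) N.
Proof.
  intros H; induction N as [|N IH]; simpl; [reflexivity|].
  rewrite RInt_Rplus, IH; auto; apply ex_RInt_cont; auto.
  intros t. now apply (continuous_sum_f_R0 F).
Qed.

Lemma RInt_sumZ (F : Z -> R -> R) M :
  (forall j t, continuous (F j) t) -> (forall t, dominated M (fun j => F j t)) ->
  RInt (fun t => sumZ (fun j => F j t)) 0 1 = sumZ (fun j => RInt (F j) 0 1).
Proof.
  intros Hc Hd.
  assert (CS : forall t, continuous (fun t => sumZ (fun j => F j t)) t).
  { intros t; apply continuous_sumZ with M; [intros; apply Hc|now apply filter_forall]. }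
  apply (sumZ_unique M (M * 8)).
  - intros j. eapply Rle_trans; [apply abs_RInt_le_const; [lra|now apply ex_RInt_cont|intros; apply Hd]|]. lra.
  - intros N.
    replace (sum_f_R0 (paired (fun j => RInt (F j) 0 1)) N) with
      (RInt (fun t => sum_f_R0 (paired (fun j => F j t)) N) 0 1).
    2:{ rewrite (RInt_sum_f_R0 (fun n t => paired (fun j => F j t) n)).
        - apply sum_eq; intros n _; unfold paired. apply RInt_Rplus; now apply ex_RInt_cont.
        - intros; unfold paired; now apply continuous_Rplus. }
    assert (CN : forall t, continuous (fun t => sum_f_R0 (paired (fun j => F j t)) N) t).
    { intros t. apply (continuous_sum_f_R0 (fun n t => paired (fun j => F j t) n)).
      intros; unfold paired; now apply continuous_Rplus. }
    rewrite <- RInt_Rminus by now apply ex_RInt_cont.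
    eapply Rle_trans; [apply abs_RInt_le_const with (M := M * 8 / (INR N + 2)); [lra| |]|lra].
    + apply ex_RInt_cont; intros; now apply continuous_Rminus.
    + intros t _. now apply sumZ_tail.
Qed.

(* Termwise differentiation from a dominated second derivative (Taylor at order two). *)
Lemma is_derive_sumZ (g g' g'' : Z -> R -> R) M :
  (forall j t, Rabs t <= 1 -> is_derive (g j) t (g' j t)) ->
  (forall j t, Rabs t <= 1 -> is_derive (g' j) t (g'' j t)) ->
  (forall t, Rabs t <= 1 -> dominated M (fun j => g j t)) ->
  (forall t, Rabs t <= 1 -> dominated M (fun j => g' j t)) ->
  (forall t, Rabs t <= 1 -> dominated M (fun j => g'' j t)) ->
  is_derive (fun t => sumZ (fun j => g j t)) 0 (sumZ (fun j => g' j 0)).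
Proof.
  intros D1 D2 B0 B1 B2.
  assert (Z0 : Rabs 0 <= 1) by (rewrite Rabs_R0; lra).
  pose proof (dominated_pos _ _ (B0 0 Z0)) as HM.
  apply is_derive_Reals. intros eps He.
  assert (Hd : 0 < Rmin 1 (eps / (8 * M + 1))) by (apply Rmin_glb_lt; [lra|apply Rdiv_lt_0_compat; lra]).
  exists (mkposreal _ Hd). intros t Ht0 Ht. simpl in Ht. rewrite Rplus_0_l.
  pose proof (Rmin_l 1 (eps / (8 * M + 1))). pose proof (Rmin_r 1 (eps / (8 * M + 1))).
  assert (Ht1 : Rabs t <= 1) by lra.
  assert (E : sumZ (fun j => g j t) - sumZ (fun j => g j 0) - t * sumZ (fun j => g' j 0) =
    sumZ (fun j => g j t + (-1 * g j 0 + - t * g' j 0))).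
  { rewrite (sumZ_plus M (Rabs (-1) * M + Rabs (- t) * M) (fun j => g j t)), (sumZ_plus (Rabs (-1) * M) (Rabs (- t) * M)), !sumZ_scal; auto.
    - ring.
    - apply dominated_scal; auto.
    - apply dominated_scal; auto.
    - apply dominated_plus; apply dominated_scal; auto. }
  assert (Bd : dominated (t ^ 2 * M) (fun j => g j t + (-1 * g j 0 + - t * g' j 0))).
  { intros j. destruct (MVT_cor4 (g j) (g' j) 0 1) with (b := t) as [c [Ec Hc]].
    { intros c Hc; apply D1. now rewrite Rminus_0_r in Hc. }
    { now rewrite Rminus_0_r. }
    rewrite !Rminus_0_r in *.
    destruct (MVT_cor4 (g' j) (g'' j) 0 1) with (b := c) as [c' [Ec' Hc']].
    { intros c' Hc'; apply D2. now rewrite Rminus_0_r in Hc'. }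
    { rewrite Rminus_0_r; lra. }
    rewrite !Rminus_0_r in *.
    replace (g j t + (-1 * g j 0 + - t * g' j 0)) with (g'' j c' * (c * t)).
    2:{ replace (g'' j c' * (c * t)) with ((g'' j c' * c) * t) by ring. rewrite <- Ec'. lra. }
    rewrite !Rabs_mult. pose proof (B2 c' ltac:(lra) j) as B. cbv beta in B.
    replace (t ^ 2 * M * weight j) with ((M * weight j) * (Rabs t * Rabs t)) by (rewrite <- (pow2_abs t); ring).
    pose proof (Rabs_pos c). pose proof (Rabs_pos t). pose proof (Rabs_pos (g'' j c')).
    apply Rmult_le_compat; auto; nra. }
  apply sumZ_bound in Bd. rewrite <- E in Bd.
  replace ((sumZ (fun j => g j t) - sumZ (fun j => g j 0)) / t - sumZ (fun j => g' j 0))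
    with ((sumZ (fun j => g j t) - sumZ (fun j => g j 0) - t * sumZ (fun j => g' j 0)) / t) by (field; auto).
  unfold Rdiv. rewrite Rabs_mult, Rabs_inv.
  pose proof (Rabs_pos_lt _ Ht0) as Hp.
  apply Rmult_lt_reg_r with (Rabs t); auto. rewrite Rmult_assoc, Rinv_l, Rmult_1_r by lra.
  eapply Rle_lt_trans; [exact Bd|]. rewrite <- (pow2_abs t).
  assert (Rabs t * (8 * M + 1) < eps).
  { apply Rmult_lt_reg_r with (/ (8 * M + 1)); [apply Rinv_0_lt_compat; lra|].
    rewrite Rmult_assoc, Rinv_r, Rmult_1_r by lra. unfold Rdiv in *; lra. }
  nra.
Qed.

(** * Theta series *)

Lemma is_derive_RtoC_cis (f g : R -> R) x l m : is_derive f x l -> is_derive g x m ->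
  is_derive (fun t => (RtoC (f t) * cis (g t))%C) x
    (RtoC l * cis (g x) + Ci * RtoC m * (RtoC (f x) * cis (g x)))%C.
Proof.
  intros Hf Hg. apply is_derive_RC; unfold cis; simpl.
  - apply (is_derive_ext (fun t => f t * cos (g t))). intros t; eqR; ring.
    evar_last. apply (is_derive_Rmult f (fun t => cos (g t)) _ _ _ Hf (is_derive_Rcomp cos g _ _ _ (is_derive_cos _) Hg)).
    eqR; ring.
  - apply (is_derive_ext (fun t => f t * sin (g t))). intros t; eqR; ring.
    evar_last. apply (is_derive_Rmult f (fun t => sin (g t)) _ _ _ Hf (is_derive_Rcomp sin g _ _ _ (is_derive_sin _) Hg)).
    eqR; ring.
Qed.

Definition csumZ (F : Z -> C) : C := (sumZ (fun j => Re (F j)), sumZ (fun j => Im (F j))).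

Definition cdominated (M : R) (F : Z -> C) : Prop := forall j, Cmod (F j) <= M * weight j.

Lemma cdominated_Re M F : cdominated M F -> dominated M (fun j => Re (F j)).
Proof. intros H j; eapply Rle_trans; [apply Rabs_Re_le|apply H]. Qed.

Lemma cdominated_Im M F : cdominated M F -> dominated M (fun j => Im (F j)).
Proof. intros H j; eapply Rle_trans; [apply Rabs_Im_le|apply H]. Qed.

Lemma cdominated_plus M N F G : cdominated M F -> cdominated N G ->
  cdominated (M + N) (fun j => (F j + G j)%C).
Proof. intros H1 H2 j. eapply Rle_trans; [apply Cmod_triangle|]. specialize (H1 j). specialize (H2 j). lra. Qed.

Lemma cdominated_Cmult M c F : cdominated M F -> cdominated (Cmod c * M) (fun j => (c * F j)%C).
Proof.
  intros H j. rewrite Cmod_mult, Rmult_assoc. apply Rmult_le_compat_l; [apply Cmod_ge_0|apply H].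
Qed.

Lemma csumZ_ext F G : (forall j, F j = G j) -> csumZ F = csumZ G.
Proof. intros H; unfold csumZ; f_equal; apply sumZ_ext; intros; now rewrite H. Qed.

Lemma csumZ_plus M N F G : cdominated M F -> cdominated N G ->
  csumZ (fun j => (F j + G j)%C) = (csumZ F + csumZ G)%C.
Proof.
  intros H1 H2. apply Ceq; unfold csumZ; simpl.
  - exact (sumZ_plus M N _ _ (cdominated_Re _ _ H1) (cdominated_Re _ _ H2)).
  - exact (sumZ_plus M N _ _ (cdominated_Im _ _ H1) (cdominated_Im _ _ H2)).
Qed.

Lemma csumZ_Cmult M c F : cdominated M F -> csumZ (fun j => (c * F j)%C) = (c * csumZ F)%C.
Proof.
  intros H. pose proof (cdominated_Re _ _ H) as H1. pose proof (cdominated_Im _ _ H) as H2.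
  apply Ceq; unfold csumZ; simpl.
  - rewrite (sumZ_ext _ (fun j => fst c * Re (F j) + - snd c * Im (F j))) by (intros; unfold Re, Im; ring).
    rewrite (sumZ_plus (Rabs (fst c) * M) (Rabs (- snd c) * M)), !sumZ_scal by now apply dominated_scal.
    ring.
  - rewrite (sumZ_ext _ (fun j => fst c * Im (F j) + snd c * Re (F j))) by (intros; unfold Re, Im; ring).
    rewrite (sumZ_plus (Rabs (fst c) * M) (Rabs (snd c) * M)), !sumZ_scal by now apply dominated_scal.
    ring.
Qed.

Lemma csumZ_shift M F m : cdominated M F -> csumZ (fun j => F (j + m)%Z) = csumZ F.
Proof.
  intros H. unfold csumZ. f_equal.
  - exact (sumZ_shift M (fun j => Re (F j)) m (cdominated_Re _ _ H)).
  - exact (sumZ_shift M (fun j => Im (F j)) m (cdominated_Im _ _ H)).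
Qed.

Lemma is_derive_csumZ (g g' g'' : Z -> R -> C) M :
  (forall j t, is_derive (g j) t (g' j t)) ->
  (forall j t, is_derive (g' j) t (g'' j t)) ->
  (forall t, Rabs t <= 1 -> cdominated M (fun j => g j t)) ->
  (forall t, Rabs t <= 1 -> cdominated M (fun j => g' j t)) ->
  (forall t, Rabs t <= 1 -> cdominated M (fun j => g'' j t)) ->
  is_derive (fun t => csumZ (fun j => g j t)) 0 (csumZ (fun j => g' j 0)).
Proof.
  intros D1 D2 B0 B1 B2. apply is_derive_RC; unfold csumZ; simpl.
  - apply (is_derive_sumZ (fun j t => Re (g j t)) (fun j t => Re (g' j t)) (fun j t => Re (g'' j t)) M);
      intros; solve [now apply is_derive_Re|apply cdominated_Re; auto].
  - apply (is_derive_sumZ (fun j t => Im (g j t)) (fun j t => Im (g' j t)) (fun j t => Im (g'' j t)) M);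
      intros; solve [now apply is_derive_Im|apply cdominated_Im; auto].
Qed.

Lemma continuous_csumZ {U : UniformSpace} (F : Z -> U -> C) M p0 :
  (forall j, continuous (F j) p0) -> locally p0 (fun p => cdominated M (fun j => F j p)) ->
  continuous (fun p => csumZ (fun j => F j p)) p0.
Proof.
  intros Hc Hd. apply continuous_RC; unfold csumZ; simpl.
  - apply (continuous_sumZ (fun j p => Re (F j p)) M); [intros; now apply continuous_Re|].
    eapply filter_imp; [|exact Hd]. intros p Hp; now apply cdominated_Re.
  - apply (continuous_sumZ (fun j p => Im (F j p)) M); [intros; now apply continuous_Im|].
    eapply filter_imp; [|exact Hd]. intros p Hp; now apply cdominated_Im.
Qed.

Lemma cRInt_csumZ (F : Z -> R -> C) M :
  (forall j t, continuous (F j) t) -> (forall t, cdominated M (fun j => F j t)) ->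
  cRInt (fun t => csumZ (fun j => F j t)) = csumZ (fun j => cRInt (F j)).
Proof.
  intros Hc Hd. unfold cRInt, csumZ; simpl. f_equal.
  - apply (RInt_sumZ (fun j t => Re (F j t)) M); intros; [now apply continuous_Re|now apply cdominated_Re].
  - apply (RInt_sumZ (fun j t => Im (F j t)) M); intros; [now apply continuous_Im|now apply cdominated_Im].
Qed.

(** Translation by the half period [1 / (2 m)] changes the sign of the integrand but not its
    integral. *)
Lemma cRInt_cis_Z m : m <> 0%Z -> cRInt (fun t => cis (2 * PI * IZR m * t)) = RtoC 0.
Proof.
  intros Hm. apply not_0_IZR in Hm.
  set (h := fun t => cis (2 * PI * IZR m * t)).
  assert (Hc : forall t, continuous h t).
  { intros t; apply continuous_cis. apply @ex_derive_continuous. auto_derive; auto. }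
  assert (E : cRInt (fun t => h (t + / (2 * IZR m))) = cRInt h).
  { apply cRInt_shift; auto. intros t; unfold h.
    replace (2 * PI * IZR m * (t + 1)) with (2 * PI * IZR m * t + 2 * PI * IZR m) by ring.
    rewrite cis_plus, cis_2PI_Z. apply Cmult_1_r. }
  rewrite (cRInt_ext _ (fun t => (RtoC (-1) * h t)%C)) in E.
  2:{ intros t; unfold h.
      replace (2 * PI * IZR m * (t + / (2 * IZR m))) with (2 * PI * IZR m * t + PI) by (field; auto).
      rewrite cis_plus. unfold cis at 2. rewrite cos_PI, sin_PI. rewrite Cmult_comm. reflexivity. }
  rewrite cRInt_Cmult in E by auto. fold h.
  apply Ceq; [apply (f_equal Re) in E|apply (f_equal Im) in E]; unfold Re, Im in *; simpl in *; lra.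
Qed.

Lemma cis_powerRZ be d (n : Z) : d <> 0 -> cis (2 * PI * be) = RtoC d ->
  cis (2 * PI * be * IZR n) = RtoC (powerRZ d n).
Proof.
  intros Hd H. revert n; apply Z.peano_ind.
  - rewrite Rmult_0_r. apply cis_0.
  - intros n IH. unfold Z.succ. rewrite plus_IZR, powerRZ_add, RtoC_mult, <- IH by auto.
    rewrite Rmult_plus_distr_l, cis_plus, Rmult_1_r, H. simpl powerRZ. now rewrite Rmult_1_r.
  - intros n IH. unfold Z.pred.
    assert (E : (cis (2 * PI * be * IZR (n + -1)) * cis (2 * PI * be))%C = (RtoC (powerRZ d (n + -1)) * RtoC d)%C).
    { rewrite <- cis_plus. replace (2 * PI * be * IZR (n + -1) + 2 * PI * be) with (2 * PI * be * IZR n) by (rewrite plus_IZR; ring).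
      rewrite IH, <- RtoC_mult. f_equal. rewrite powerRZ_add by auto. simpl. field; auto. }
    rewrite H in E.
    apply (f_equal (fun z => (z * / RtoC d)%C)) in E. rewrite <- !Cmult_assoc, !Cinv_r, !Cmult_1_r in E; auto.
    all: intros E0; apply Hd; now apply RtoC_inj.
Qed.

Section Theta.
Context (L a sg be tau d1 : R).
Context (HL : 0 < L) (Ha : 0 < a) (Hsg : sg * sg = 1) (Hat : a = 2 * PI * (sg * tau)).
Context (Hd1 : d1 = 1 \/ d1 = -1).

(** In the application [tau] is the fibre frequency, [sg] its sign, [a = 2 pi |tau|], [L] the period
    in [x] and [be] a base frequency in [y]. Replacing [x] by [x + L] raises [j] by one in the
    argument; the matching frequency in [y] moves by [tau * L], as the twist of the lattice action
    demands. *)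
Definition theta_arg (j : Z) (x : R) : R := a * x + (2 * PI * (sg * be) + a * (L * IZR j)).
Definition theta_freq (j : Z) : R := be + IZR j * (tau * L).

Definition theta_term (n k : nat) (j : Z) (p : heis) : C :=
  let '(x, y, z) := p in
  (RtoC (powerRZ d1 j * IZR j ^ n * herm a k (theta_arg j x)) *
   cis (2 * PI * (theta_freq j * y + tau * z)))%C.

(* The factor [j ^ n] makes the family closed under differentiation. *)
Definition theta (n k : nat) (p : heis) : C := csumZ (fun j => theta_term n k j p).

(** The directional derivative as a recurrence in the indices: the component in [x] raises and
    lowers the Hermite level, and the part of the frequency in [y] that is linear in [j] raises the
    power of [j]. *)
Definition theta_dir (v : heis) (G : nat -> nat -> C) (n k : nat) : C :=
  let '(v1, v2, v3) := v in
  (RtoC (v1 / 2) * G n (S k) + (RtoC (- v1 * a * INR k) * G n (pred k) +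
   (Ci * RtoC (2 * PI * (v2 * be + v3 * tau)) * G n k +
    Ci * RtoC (2 * PI * (v2 * (tau * L))) * G (S n) k)))%C.

Lemma theta_term_derive n k j v p :
  is_derive (fun t : R => theta_term n k j (plus p (scal t v))) 0
    (theta_dir v (fun n k => theta_term n k j p) n k).
Proof using Ha.
  destruct p as [[x y] z], v as [[v1 v2] v3].
  change (is_derive (fun t : R =>
    (RtoC (powerRZ d1 j * IZR j ^ n * herm a k (theta_arg j (x + t * v1))) *
     cis (2 * PI * (theta_freq j * (y + t * v2) + tau * (z + t * v3))))%C) 0
    (theta_dir (v1, v2, v3) (fun n k => theta_term n k j (x, y, z)) n k)).
  evar_last.
  - apply (is_derive_RtoC_cis (fun t => powerRZ d1 j * IZR j ^ n * herm a k (theta_arg j (x + t * v1)))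
      (fun t => 2 * PI * (theta_freq j * (y + t * v2) + tau * (z + t * v3)))).
    + apply is_derive_scal. unfold theta_arg.
      apply (is_derive_Rcomp (fun x => herm a k (a * x + (2 * PI * (sg * be) + a * (L * IZR j)))) (fun t => x + t * v1)).
      * apply herm_affine_derive; lra.
      * instantiate (1 := v1). auto_derive; auto; eqR; ring.
    + instantiate (1 := 2 * PI * (theta_freq j * v2 + tau * v3)). auto_derive; auto; eqR; ring.
  - unfold theta_dir, theta_term. rewrite !Rmult_0_l, !Rplus_0_r. fold (theta_arg j x).
    generalize (cis (2 * PI * (theta_freq j * y + tau * z))). intros [c s].
    unfold theta_freq. simpl pow.
    apply Ceq; unfold Re, Im; simpl; field.
Qed.

Lemma powerRZ_abs1 j : Rabs (powerRZ d1 j) = 1.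
Proof using Hd1.
  assert (H : Rabs d1 = 1) by (destruct Hd1 as [-> | ->]; unfold Rabs; destruct Rcase_abs; lra).
  destruct j; simpl; [apply Rabs_R1| |];
    rewrite ?Rabs_inv, <- RPow_abs, H, pow1; [reflexivity|apply Rinv_1].
Qed.

(** Only [x] has to be bounded, as [y] and [z] enter through unimodular characters. For bounded [x]
    the Hermite argument is [a L j] up to a bounded error, so rapid decay in it beats [j^n] with a
    factor [1 + j^2] to spare. *)
Lemma theta_term_dominated n k B : exists M, forall p, Rabs (fst (fst p)) <= B ->
  cdominated M (fun j => theta_term n k j p).
Proof using HL Ha Hd1.
  set (s := a * L). assert (Hs : 0 < s) by (apply Rmult_lt_0_compat; auto).
  set (E := a * B + Rabs (2 * PI * (sg * be))).
  (* With [w] the Hermite argument and [s = a L], the difference [w - s j] is at most [E] in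
     absolute value; hence [s^2 j^2 <= 2 w^2 + 2 E^2] and [1 + j^2 <= K (1 + w^2)]. *)
  set (K := 1 + 2 / s ^ 2 + 2 * E ^ 2 / s ^ 2).
  assert (Hs2 : 0 < s ^ 2) by nra.
  assert (Hi : 0 <= 2 / s ^ 2) by (apply Rdiv_le_0_compat; lra).
  assert (Hi2 : 0 <= 2 * E ^ 2 / s ^ 2) by (apply Rdiv_le_0_compat; nra).
  destruct (herm_bound a k (S n) Ha) as [M [HM HB]].
  exists (K ^ S n * M). intros [[x y] z] Hx j. simpl fst in Hx.
  unfold theta_term. rewrite Cmod_mult, Cmod_cis, Cmod_R, Rmult_1_r, !Rabs_mult, powerRZ_abs1, Rmult_1_l.
  set (w := theta_arg j x). set (i := IZR j).
  assert (Hw : 1 + i ^ 2 <= K * (1 + w ^ 2)).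
  { assert (He : (w - s * i) ^ 2 <= E ^ 2).
    { replace (w - s * i) with (a * x + 2 * PI * (sg * be)) by (unfold w, theta_arg, s, i; ring).
      rewrite <- (pow2_abs (a * x + _)). apply pow_incr. split; [apply Rabs_pos|].
      eapply Rle_trans; [apply Rabs_triang|]. unfold E. rewrite Rabs_mult, (Rabs_pos_eq a) by lra. nra. }
    assert (H2 : s ^ 2 * i ^ 2 <= 2 * w ^ 2 + 2 * E ^ 2) by (pose proof (pow2_ge_0 (2 * w - s * i)); nra).
    assert (H3 : i ^ 2 <= 2 / s ^ 2 * w ^ 2 + 2 * E ^ 2 / s ^ 2).
    { apply Rmult_le_reg_l with (s ^ 2); auto.
      replace (s ^ 2 * (2 / s ^ 2 * w ^ 2 + 2 * E ^ 2 / s ^ 2)) with (2 * w ^ 2 + 2 * E ^ 2) by (field; lra). auto. }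
    pose proof (pow2_ge_0 w). unfold K. nra. }
  specialize (HB w). pose proof (pow2_ge_0 i) as Hi0. pose proof (Rabs_pos (herm a k w)) as Hh.
  assert (Hn : Rabs (i ^ n) * (1 + i ^ 2) <= (1 + i ^ 2) ^ S n).
  { simpl. rewrite (Rmult_comm (1 + _)). apply Rmult_le_compat_r; [simpl in Hi0; lra|].
    rewrite <- RPow_abs. apply pow_incr. split; [apply Rabs_pos|].
    change (i * (i * 1)) with (i ^ 2). rewrite <- (pow2_abs i). pose proof (Rabs_pos i). nra. }
  assert (Hp : (1 + i ^ 2) ^ S n <= K ^ S n * (1 + w ^ 2) ^ S n).
  { rewrite <- Rpow_mult_distr. apply pow_incr. split; [lra|auto]. }
  unfold weight. fold i. apply Rmult_le_reg_r with (1 + i ^ 2); [lra|].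
  rewrite (Rmult_assoc (_ * M)), Rinv_l, Rmult_1_r by lra.
  assert (HK : 0 <= K ^ S n) by (apply pow_le; unfold K; lra).
  apply Rle_trans with ((Rabs (i ^ n) * (1 + i ^ 2)) * Rabs (herm a k w)); [right; ring|].
  apply Rle_trans with (K ^ S n * (1 + w ^ 2) ^ S n * Rabs (herm a k w)).
  - apply Rmult_le_compat_r; lra.
  - rewrite Rmult_assoc. apply Rmult_le_compat_l; auto.
Qed.

Lemma cdominated_le M N F : M <= N -> cdominated M F -> cdominated N F.
Proof. intros H HF j. specialize (HF j). pose proof (weight_pos j). nra. Qed.

(* Derivatives of a dominated family of terms stay dominated: theta_dir is a fixed
   linear combination of four families. *)
Lemma theta_dir_dominated v (G : nat -> nat -> Z -> heis -> C) B :
  (forall n k, exists M, forall p, Rabs (fst (fst p)) <= B -> cdominated M (fun j => G n k j p)) ->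
  forall n k, exists M, forall p, Rabs (fst (fst p)) <= B ->
    cdominated M (fun j => theta_dir v (fun n k => G n k j p) n k).
Proof.
  intros H n k. destruct v as [[v1 v2] v3].
  destruct (H n (S k)) as [M1 H1], (H n (pred k)) as [M2 H2], (H n k) as [M3 H3], (H (S n) k) as [M4 H4].
  eexists; intros p Hp. unfold theta_dir.
  apply cdominated_plus; [apply cdominated_Cmult, H1, Hp|].
  apply cdominated_plus; [apply cdominated_Cmult, H2, Hp|].
  apply cdominated_plus; [apply cdominated_Cmult, H3, Hp|apply cdominated_Cmult, H4, Hp].
Qed.

Lemma theta_dir_csumZ v n k p :
  csumZ (fun j => theta_dir v (fun n k => theta_term n k j p) n k) = theta_dir v (fun n k => theta n k p) n k.
Proof using HL Ha Hd1.
  destruct v as [[v1 v2] v3]. unfold theta_dir, theta.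
  assert (H : forall n k, exists M, cdominated M (fun j => theta_term n k j p)).
  { intros n' k'. destruct (theta_term_dominated n' k' (Rabs (fst (fst p)))) as [M HM]. exists M. apply HM; lra. }
  destruct (H n (S k)) as [M1 H1], (H n (pred k)) as [M2 H2], (H n k) as [M3 H3], (H (S n) k) as [M4 H4].
  erewrite csumZ_plus; [|now eapply cdominated_Cmult; eauto|].
  2:{ apply cdominated_plus; [eapply cdominated_Cmult; eauto|].
      apply cdominated_plus; eapply cdominated_Cmult; eauto. }
  erewrite csumZ_plus; [|now eapply cdominated_Cmult; eauto|].
  2:{ apply cdominated_plus; eapply cdominated_Cmult; eauto. }
  erewrite csumZ_plus; [|now eapply cdominated_Cmult; eauto|now eapply cdominated_Cmult; eauto].
  erewrite !csumZ_Cmult by eauto. reflexivity.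
Qed.

Lemma theta_dir_derive v (G : nat -> nat -> R -> C) (G' : nat -> nat -> C) t n k :
  (forall n k, is_derive (G n k) t (G' n k)) ->
  is_derive (fun t => theta_dir v (fun n k => G n k t) n k) t (theta_dir v G' n k).
Proof.
  intros H. destruct v as [[v1 v2] v3]. unfold theta_dir.
  repeat first [apply (is_derive_plus (V := C_R_NormedModule))|
    apply (is_derive_linear (V := C_R_NormedModule) (W := C_R_NormedModule) (Cmult _)); [apply is_linear_Cmult|apply H]].
Qed.

Lemma theta_derive n k v p :
  is_derive (fun t : R => theta n k (plus p (scal t v))) 0 (theta_dir v (fun n k => theta n k p) n k).
Proof using HL Ha Hd1.
  rewrite <- theta_dir_csumZ.
  assert (D1 : forall n k j t, is_derive (fun t : R => theta_term n k j (plus p (scal t v))) t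
     (theta_dir v (fun n k => theta_term n k j (plus p (scal t v))) n k)).
  { intros n' k' j t.
    exact (is_derive_line (theta_term n' k' j) (fun p => theta_dir v (fun n k => theta_term n k j p) n' k') v
      (theta_term_derive n' k' j v) p t). }
  set (B := Rabs (fst (fst p)) + Rabs (fst (fst v))).
  assert (HB : forall t : R, Rabs t <= 1 -> Rabs (fst (fst (plus p (scal t v)))) <= B).
  { intros t Ht. destruct p as [[x y] z], v as [[v1 v2] v3].
    change (Rabs (x + t * v1) <= Rabs x + Rabs v1).
    eapply Rle_trans; [apply Rabs_triang|]. rewrite Rabs_mult. pose proof (Rabs_pos v1). nra. }
  pose proof (fun n k => theta_term_dominated n k B) as E0.
  pose proof (theta_dir_dominated v (fun n k j p => theta_term n k j p) B E0) as E1.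
  pose proof (theta_dir_dominated v (fun n k j p => theta_dir v (fun n k => theta_term n k j p) n k) B E1) as E2.
  destruct (E0 n k) as [M0 H0], (E1 n k) as [M1 H1], (E2 n k) as [M2 H2].
  set (M := Rmax M0 (Rmax M1 M2)).
  assert (L0 : M0 <= M) by apply Rmax_l.
  assert (L1 : M1 <= M) by (eapply Rle_trans; [apply Rmax_l|apply Rmax_r]).
  assert (L2 : M2 <= M) by (eapply Rle_trans; [apply Rmax_r|apply Rmax_r]).
  assert (Hp0 : plus p (scal 0 v) = p)
    by exact (eq_trans (f_equal (plus p) (scal_zero_l (K := R_AbsRing) v)) (plus_zero_r p)).
  evar_last; [apply (is_derive_csumZ (fun j t => theta_term n k j (plus p (scal t v)))
    (fun j t => theta_dir v (fun n k => theta_term n k j (plus p (scal t v))) n k)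
    (fun j t => theta_dir v (fun n k => theta_dir v (fun n k => theta_term n k j (plus p (scal t v))) n k) n k) M)|
    apply csumZ_ext; intros j; cbv beta; now rewrite Hp0].
  - intros j t; apply D1.
  - intros j t. apply (theta_dir_derive v (fun n k t => theta_term n k j (plus p (scal t v)))). intros; apply D1.
  - intros t Ht. apply cdominated_le with M0; auto.
  - intros t Ht. apply cdominated_le with M1; auto.
  - intros t Ht. apply cdominated_le with M2; auto.
Qed.

Lemma continuous_heis_x (p : heis) : continuous (fun p : heis => fst (fst p)) p.
Proof.
  apply (continuous_comp (fun p : heis => fst p) fst).
  - destruct p as [p z]. apply (continuous_fst (U := prod_UniformSpace R_UniformSpace R_UniformSpace) (V := R_UniformSpace)).
  - destruct p as [[x y] z]. apply (continuous_fst (U := R_UniformSpace) (V := R_UniformSpace)).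
Qed.

Lemma continuous_heis_y (p : heis) : continuous (fun p : heis => snd (fst p)) p.
Proof.
  apply (continuous_comp (fun p : heis => fst p) snd).
  - destruct p as [p z]. apply (continuous_fst (U := prod_UniformSpace R_UniformSpace R_UniformSpace) (V := R_UniformSpace)).
  - destruct p as [[x y] z]. apply (continuous_snd (U := R_UniformSpace) (V := R_UniformSpace)).
Qed.

Lemma continuous_heis_z (p : heis) : continuous (fun p : heis => snd p) p.
Proof.
  destruct p as [p z]. apply (continuous_snd (U := prod_UniformSpace R_UniformSpace R_UniformSpace) (V := R_UniformSpace)).
Qed.

Lemma theta_term_continuous n k j p : continuous (theta_term n k j) p.
Proof using Ha.
  apply (continuous_ext (fun p : heis =>
    (RtoC (powerRZ d1 j * IZR j ^ n * herm a k (theta_arg j (fst (fst p)))) *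
     cis (2 * PI * (theta_freq j * snd (fst p) + tau * snd p)))%C)).
  { intros [[x y] z]; reflexivity. }
  apply continuous_Cmult.
  - apply continuous_RC; simpl; [|apply continuous_const].
    apply continuous_Rmult; [apply continuous_const|].
    apply (continuous_comp (fun p : heis => fst (fst p)) (fun x => herm a k (theta_arg j x))); [apply continuous_heis_x|].
    apply @ex_derive_continuous. eexists. unfold theta_arg. apply herm_affine_derive. lra.
  - apply continuous_cis. apply continuous_Rmult; [apply continuous_const|].
    apply continuous_Rplus; apply continuous_Rmult;
      first [apply continuous_const|apply continuous_heis_y|apply continuous_heis_z].
Qed.

Lemma theta_continuous n k p : continuous (theta n k) p.
Proof using HL Ha Hd1.
  destruct (theta_term_dominated n k (Rabs (fst (fst p)) + 1)) as [M HM].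
  apply (continuous_csumZ (fun j p => theta_term n k j p) M).
  - intros; apply theta_term_continuous.
  - eapply filter_imp; [intros q Hq; apply HM, Hq|].
    pose proof (continuous_heis_x p (ball (fst (fst p)) (mkposreal 1 Rlt_0_1)) ltac:(apply locally_ball)) as H.
    eapply filter_imp; [|exact H]. intros q Hq. change (Rabs (fst (fst q) - fst (fst p)) < 1) in Hq.
    enough (A : forall u w : R, Rabs (u - w) < 1 -> Rabs u <= Rabs w + 1) by (apply A; exact Hq).
    intros u w Huw. pose proof (Rabs_triang_inv u w). lra.
Qed.

Lemma theta_smooth n k : smooth (W := C_R_NormedModule) (theta n k).
Proof using HL Ha Hd1.
  intros K. revert n k; induction K as [|K IH]; intros n k; (split; [apply theta_continuous|auto]).
  intros v. exists (fun p => theta_dir v (fun n k => theta n k p) n k). split.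
  - intros p; apply theta_derive.
  - destruct v as [[v1 v2] v3]. unfold theta_dir.
    repeat apply is_Ck_Cplus; apply is_Ck_Cmult, IH.
Qed.

Lemma theta_arg_freq j x : theta_arg j x = 2 * PI * (sg * (theta_freq j + x * tau)).
Proof using Hat. unfold theta_arg, theta_freq. rewrite Hat. ring. Qed.

(** At abscissa [x] the direction [(0, 1, x)] is the left invariant field [Y]. On the [j]-th term it
    multiplies by [i] times [2 pi (theta_freq j + x tau)], which is [sg] times the Hermite argument;
    the three-term recurrence then removes the dependence on [j]. *)
Lemma theta_dirY k x y z : theta_dir (0, 1, x) (fun n k => theta n k (x, y, z)) 0 k =
  (- (Ci * RtoC sg) * (RtoC (1 / 2) * theta 0 (S k) (x, y, z) + RtoC (a * INR k) * theta 0 (pred k) (x, y, z)))%C.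
Proof using HL Ha Hd1 Hat Hsg.
  set (p := (x, y, z)).
  assert (H : forall n k, exists M, cdominated M (fun j => theta_term n k j p)).
  { intros n' k'. destruct (theta_term_dominated n' k' (Rabs (fst (fst p)))) as [M HM]. exists M. apply HM; lra. }
  destruct (H 0%nat (S k)) as [M1 H1], (H 0%nat (pred k)) as [M2 H2].
  unfold theta at 2 3.
  rewrite <- (csumZ_Cmult _ _ _ H1), <- (csumZ_Cmult _ _ _ H2), <- theta_dir_csumZ.
  erewrite <- csumZ_plus by (eapply cdominated_Cmult; eauto).
  erewrite <- csumZ_Cmult by (apply cdominated_plus; eapply cdominated_Cmult; eauto).
  apply csumZ_ext; intros j. unfold theta_dir, theta_term, p.
  generalize (cis (2 * PI * (theta_freq j * y + tau * z))). intros [c s].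
  rewrite (herm_S a k). rewrite theta_arg_freq.
  set (h := herm a k _). set (h' := herm a (pred k) _). set (q := powerRZ d1 j).
  assert (E : forall X, X = sg * sg * X) by (intros; rewrite Hsg; ring).
  unfold theta_freq. simpl pow.
  apply Ceq; unfold Re, Im; simpl.
  - rewrite (E (_ + _)). field.
  - rewrite (E (_ + _)). field.
Qed.

(** Translation in [x] by [L * X] is undone by reindexing [j] to [j + X]. The resulting change of
    the frequency in [y] is a multiple of the integer [q = tau * L], invisible to integral
    translations, and [d1^2 = 1] lets the sign factor out. *)
Lemma theta_equivariant (q : Z) (d2 d3 : R) k (X Y Z : Z) p :
  tau * L = IZR q -> d2 <> 0 -> d3 <> 0 ->
  cis (2 * PI * be) = RtoC d2 -> cis (2 * PI * tau) = RtoC d3 ->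
  theta 0 k (heis_mul (L * IZR X, IZR Y, IZR Z) p) =
  (RtoC (powerRZ d1 X * powerRZ d2 Y * powerRZ d3 Z) * theta 0 k p)%C.
Proof using HL Ha Hd1.
  intros Hq H2 H3 C2 C3. destruct p as [[x y] z].
  destruct (theta_term_dominated 0 k (Rabs x)) as [M HM].
  specialize (HM (x, y, z) (Rle_refl _)).
  unfold theta. rewrite <- (csumZ_shift M _ X HM).
  (* Pulling the scalar out of the reindexed sum requires that the shifted family be dominated; each
     unit shift costs a factor 3. *)
  assert (HM' : cdominated (3 ^ Z.abs_nat X * M) (fun j => theta_term 0 k (j + X) (x, y, z))).
  { intros j. eapply Rle_trans; [apply HM|]. rewrite (Rmult_comm (3 ^ _)), Rmult_assoc.
    apply Rmult_le_compat_l.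
    { specialize (HM 0%Z). pose proof (weight_pos 0). pose proof (Cmod_ge_0 (theta_term 0 k 0 (x, y, z))).
      apply Rnot_lt_le; intros HH. nra. }
    clear. destruct (Z_le_dec 0 X) as [HX|HX].
    - replace X with (Z.of_nat (Z.abs_nat X)) at 1 by lia. generalize (Z.abs_nat X) as m; clear.
      intros m; induction m as [|m IH]; [rewrite Z.add_0_r; simpl; lra|].
      assert (D : dominated 1 weight) by (intros i; rewrite Rabs_pos_eq; pose proof (weight_pos i); lra).
      pose proof (dominated_shift _ _ D (j + Z.of_nat m)%Z) as E. cbv beta in E.
      rewrite Rabs_pos_eq in E by (left; apply weight_pos).
      replace (j + Z.of_nat (S m))%Z with (j + Z.of_nat m + 1)%Z by lia. simpl pow. lra.
    - replace X with (- Z.of_nat (Z.abs_nat X))%Z at 1 by lia. generalize (Z.abs_nat X) as m; clear.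
      intros m; induction m as [|m IH]; [rewrite Z.add_0_r; simpl; lra|].
      assert (D : dominated 1 weight) by (intros i; rewrite Rabs_pos_eq; pose proof (weight_pos i); lra).
      pose proof (dominated_unshift _ _ D (j + - Z.of_nat m)%Z) as E. cbv beta in E.
      rewrite Rabs_pos_eq in E by (left; apply weight_pos).
      replace (j + - Z.of_nat (S m))%Z with (j + - Z.of_nat m - 1)%Z by lia. simpl pow. lra. }
  rewrite <- (csumZ_Cmult _ _ _ HM').
  apply csumZ_ext; intros j. unfold theta_term, heis_mul.
  replace (theta_arg j (L * IZR X + x)) with (theta_arg (j + X) x)
    by (unfold theta_arg; rewrite plus_IZR; ring).
  replace (2 * PI * (theta_freq j * (IZR Y + y) + tau * (IZR Z + z + L * IZR X * y))) with
    (2 * PI * be * IZR Y + (2 * PI * tau * IZR Z + (2 * PI * IZR (j * q * Y) + 2 * PI * (theta_freq (j + X) * y + tau * z)))).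
  2:{ unfold theta_freq. rewrite !mult_IZR, <- Hq, plus_IZR. ring. }
  rewrite !cis_plus, cis_2PI_Z, (cis_powerRZ _ _ _ H2 C2), (cis_powerRZ _ _ _ H3 C3).
  assert (E : powerRZ d1 j = powerRZ d1 X * powerRZ d1 (j + X)).
  { assert (Hd0 : d1 <> 0) by (destruct Hd1; lra).
    rewrite powerRZ_add by auto. pose proof (powerRZ_abs1 X) as HA.
    assert (powerRZ d1 X * powerRZ d1 X = 1).
    { rewrite <- (Rabs_pos_eq (_ * _)) by apply Rle_0_sqr. rewrite Rabs_mult, HA. ring. }
    transitivity (powerRZ d1 j * (powerRZ d1 X * powerRZ d1 X)); [rewrite H; ring|ring]. }
  rewrite E, !RtoC_mult. simpl pow. ring.
Qed.

Lemma theta_character k t x y z :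
  theta 0 k (x, y, z + t) = (cis (2 * PI * tau * t) * theta 0 k (x, y, z))%C.
Proof using HL Ha Hd1.
  destruct (theta_term_dominated 0 k (Rabs x)) as [M HM].
  specialize (HM (x, y, z) (Rle_refl _)).
  unfold theta. rewrite <- (csumZ_Cmult _ _ _ HM). apply csumZ_ext; intros j. unfold theta_term.
  replace (2 * PI * (theta_freq j * y + tau * (z + t))) with
    (2 * PI * tau * t + 2 * PI * (theta_freq j * y + tau * z)) by ring.
  rewrite cis_plus. ring.
Qed.

(** Integrating term by term, orthogonality of characters keeps the term whose frequency [be + j q]
    is the tested one. For [q] nonzero at most one [j] survives, which isolates a single Hermite
    function. *)
Lemma theta_coefficient (q m : Z) k x : tau * L = IZR q ->
  cRInt (fun y => cis (- (2 * PI * (be + IZR m) * y)) * theta 0 k (x, y, 0))%C =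
  csumZ (fun j => if Z.eq_dec (j * q) m
                  then RtoC (powerRZ d1 j * herm a k (theta_arg j x)) else RtoC 0).
Proof using HL Ha Hd1.
  intros Hq.
  destruct (theta_term_dominated 0 k (Rabs x)) as [M HM].
  assert (HM' : forall y, cdominated M (fun j => (cis (- (2 * PI * (be + IZR m) * y)) * theta_term 0 k j (x, y, 0%R))%C)).
  { intros y j. rewrite Cmod_mult, Cmod_cis, Rmult_1_l. apply (HM (x, y, 0)), Rle_refl. }
  assert (E : forall j y, (cis (- (2 * PI * (be + IZR m) * y)) * theta_term 0 k j (x, y, 0%R))%C =
     (RtoC (powerRZ d1 j * herm a k (theta_arg j x)) * cis (2 * PI * IZR (j * q - m) * y))%C).
  { intros j y. unfold theta_term. simpl pow. rewrite Rmult_1_r.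
    replace (2 * PI * IZR (j * q - m) * y) with
      (- (2 * PI * (be + IZR m) * y) + 2 * PI * (theta_freq j * y + tau * 0)).
    2:{ unfold theta_freq. rewrite minus_IZR, mult_IZR, <- Hq. ring. }
    rewrite cis_plus. ring. }
  assert (Cc : forall n t, continuous (fun y => cis (2 * PI * IZR n * y)) t).
  { intros n t. apply continuous_cis. apply @ex_derive_continuous. auto_derive; auto. }
  rewrite (cRInt_ext _ (fun y => csumZ (fun j => cis (- (2 * PI * (be + IZR m) * y)) * theta_term 0 k j (x, y, 0))%C)).
  2:{ intros y. symmetry. apply (csumZ_Cmult M). apply (HM (x, y, 0)), Rle_refl. }
  rewrite (cRInt_csumZ (fun j y => cis (- (2 * PI * (be + IZR m) * y)) * theta_term 0 k j (x, y, 0))%C M).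
  - apply csumZ_ext; intros j. rewrite (cRInt_ext _ _ (E j)), cRInt_Cmult by auto.
    destruct (Z.eq_dec (j * q) m) as [Hj|Hj].
    + replace (j * q - m)%Z with 0%Z by lia.
      rewrite (cRInt_ext _ (fun _ => RtoC 1)), cRInt_const; [apply Cmult_1_r|].
      intros y. replace (2 * PI * 0 * y) with 0 by ring. apply cis_0.
    + rewrite cRInt_cis_Z by lia. apply Cmult_0_r.
  - intros j t. apply (continuous_ext (fun y => RtoC (powerRZ d1 j * herm a k (theta_arg j x)) * cis (2 * PI * IZR (j * q - m) * y))%C).
    + intros y; symmetry; apply E.
    + apply (continuous_Cmult (fun _ => _)); [apply continuous_const|apply Cc].
  - exact HM'.
Qed.

Lemma theta_coefficient_self (q : Z) k x : tau * L = IZR q -> q <> 0%Z ->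
  cRInt (fun y => cis (- (2 * PI * be * y)) * theta 0 k (x, y, 0))%C = RtoC (herm a k (theta_arg 0 x)).
Proof using HL Ha Hd1.
  intros Hq Hq0. rewrite (cRInt_ext _ (fun y => cis (- (2 * PI * (be + IZR 0) * y)) * theta 0 k (x, y, 0))%C).
  2:{ intros y. now rewrite Rplus_0_r. }
  rewrite (theta_coefficient q) by auto. unfold csumZ. rewrite !sumZ_single.
  - destruct (Z.eq_dec (0 * q) 0) as [_|H]; [|lia]. simpl powerRZ. unfold RtoC, Re, Im; simpl. now rewrite Rmult_1_l.
  - intros j Hj. destruct (Z.eq_dec (j * q) 0); [nia|reflexivity].
  - intros j Hj. destruct (Z.eq_dec (j * q) 0); [nia|reflexivity].
Qed.

Lemma theta_coefficient_other (q m : Z) k x : tau * L = IZR q -> (forall j, (j * q <> m)%Z) ->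
  cRInt (fun y => cis (- (2 * PI * (be + IZR m) * y)) * theta 0 k (x, y, 0))%C = RtoC 0.
Proof using HL Ha Hd1.
  intros Hq Hm. rewrite (theta_coefficient q) by auto.
  rewrite (csumZ_ext _ (fun _ => RtoC 0)).
  - unfold csumZ. now rewrite !sumZ_single by reflexivity.
  - intros j. destruct (Z.eq_dec (j * q) m) as [H|H]; [now apply Hm in H|reflexivity].
Qed.

End Theta.

(** * Averages along one-parameter lines and the Dirac operator *)

Definition ex : heis := (1, 0, 0).
Definition ey : heis := (0, 1, 0).
Definition ez : heis := (0, 0, 1).

(** The Fourier coefficient along the lines of direction [v], kept as a function on the group. Lines
    are straight in coordinates; for [ey] and [ez] they are orbits of left translation, so lattice
    equivariance makes the integrand periodic up to a multiplier. *)
Definition avg (v : heis) (th : R) (f : heis -> C) (p : heis) : C :=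
  cRInt (fun t => cis (- (2 * PI * th * t)) * f (plus p (scal t v)))%C.

Lemma continuous_cis_lin th t : continuous (fun t => cis (- (2 * PI * th * t))) t.
Proof. apply continuous_cis. apply @ex_derive_continuous. auto_derive; auto. Qed.

Lemma continuous_line_pt (v : heis) (p : heis) t :
  continuous (fun x : heis * R => plus (fst x) (scal (snd x) v) : heis) (p, t).
Proof.
  apply (continuous_plus (V := prod_NormedModule R_AbsRing (prod_NormedModule R_AbsRing R_NormedModule R_NormedModule) R_NormedModule)
    (fun x : heis * R => fst x) (fun x : heis * R => scal (snd x) v)).
  - apply (continuous_fst (U := prod_UniformSpace (prod_UniformSpace R_UniformSpace R_UniformSpace) R_UniformSpace) (V := R_UniformSpace)).
  - apply (continuous_scal_l (V := prod_NormedModule R_AbsRing (prod_NormedModule R_AbsRing R_NormedModule R_NormedModule) R_NormedModule)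
     (fun x : heis * R => snd x)).
    apply (continuous_snd (U := prod_UniformSpace (prod_UniformSpace R_UniformSpace R_UniformSpace) R_UniformSpace) (V := R_UniformSpace)).
Qed.

Lemma continuous_line (f : heis -> C) v p t : (forall p, continuous f p) ->
  continuous (fun t : R => f (plus p (scal t v))) t.
Proof.
  intros Hf. apply (continuous_comp (fun t : R => plus p (scal t v) : heis) f); [|exact (Hf _)].
  apply (continuous_slice (fun (p : heis) (t : R) => plus p (scal t v) : heis)). apply continuous_line_pt.
Qed.

Lemma continuous_avg_integrand v th (f : heis -> C) p t : (forall p, continuous f p) ->
  continuous (fun x : heis * R => (cis (- (2 * PI * th * snd x)) * f (plus (fst x) (scal (snd x) v)))%C) (p, t).
Proof.
  intros Hf.
  apply (continuous_Cmult (fun x : heis * R => cis (- (2 * PI * th * snd x)))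
    (fun x : heis * R => f (plus (fst x) (scal (snd x) v)))).
  - apply (continuous_comp (fun x : heis * R => snd x) (fun t => cis (- (2 * PI * th * t)))); [|apply continuous_cis_lin].
    apply (continuous_snd (U := prod_UniformSpace (prod_UniformSpace R_UniformSpace R_UniformSpace) R_UniformSpace) (V := R_UniformSpace)).
  - apply (continuous_comp (fun x : heis * R => plus (fst x) (scal (snd x) v) : heis) f); [exact (continuous_line_pt v p t)|exact (Hf _)].
Qed.

Lemma continuous_avg_line v th (f : heis -> C) p t : (forall p, continuous f p) ->
  continuous (fun t => (cis (- (2 * PI * th * t)) * f (plus p (scal t v)))%C) t.
Proof.
  intros Hf. apply (continuous_Cmult (fun t => cis (- (2 * PI * th * t))) (fun t => f (plus p (scal t v))));
    [apply continuous_cis_lin|now apply continuous_line].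
Qed.

Lemma continuous_avg v th f p : (forall p, continuous f p) -> continuous (avg v th f) p.
Proof.
  intros Hf. apply continuous_RC; unfold avg, cRInt; simpl.
  - apply (continuous_RInt_param (fun (p : heis) (t : R) => Re (cis (- (2 * PI * th * t)) * f (plus p (scal t v)))%C)).
    intros q t. apply (continuous_Re (fun x : heis * R => (cis (- (2 * PI * th * snd x)) * f (plus (fst x) (scal (snd x) v)))%C)).
    now apply continuous_avg_integrand.
  - apply (continuous_RInt_param (fun (p : heis) (t : R) => Im (cis (- (2 * PI * th * t)) * f (plus p (scal t v)))%C)).
    intros q t. apply (continuous_Im (fun x : heis * R => (cis (- (2 * PI * th * snd x)) * f (plus (fst x) (scal (snd x) v)))%C)).
    now apply continuous_avg_integrand.
Qed.

Lemma heis_plus_comm3 (p u v : heis) (s t : R) :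
  plus (plus p (scal s u)) (scal t v) = plus (plus p (scal t v)) (scal s u) :> heis.
Proof. rewrite <- !plus_assoc. f_equal. apply plus_comm. Qed.

Lemma heis_line_add (p v : heis) (s t : R) :
  plus (plus p (scal s v)) (scal t v) = plus p (scal (t + s) v) :> heis.
Proof.
  destruct p as [[x y] z], v as [[v1 v2] v3].
  change ((x + s * v1 + t * v1, y + s * v2 + t * v2, z + s * v3 + t * v3) =
    (x + (t + s) * v1, y + (t + s) * v2, z + (t + s) * v3)).
  apply (f_equal2 pair); [apply (f_equal2 pair)|]; ring.
Qed.

Lemma heis_plus_0 (p u : heis) : plus p (scal 0 u) = p :> heis.
Proof. exact (eq_trans (f_equal (plus p) (scal_zero_l (K := R_AbsRing) u)) (plus_zero_r p)). Qed.

(** Addition of coordinates commutes, so differentiating along [u] passes through the integral along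
    [v]. *)
Lemma avg_derive (v : heis) th (f f' : heis -> C) (u p : heis) : (forall p, continuous f p) -> (forall p, continuous f' p) ->
  (forall p, is_derive (fun t : R => f (plus p (scal t u))) 0 (f' p)) ->
  is_derive (fun t : R => avg v th f (plus p (scal t u))) 0 (avg v th f' p).
Proof.
  intros Hf Hf' Hd.
  set (F := fun (y t : R) => (cis (- (2 * PI * th * t)) * f (plus (plus p (scal y u)) (scal t v)))%C).
  set (F' := fun (y t : R) => (cis (- (2 * PI * th * t)) * f' (plus (plus p (scal y u)) (scal t v)))%C).
  assert (DF : forall y t, is_derive (fun y => F y t) y (F' y t)).
  { intros y t. unfold F, F'.
    apply (is_derive_linear (V := C_R_NormedModule) (W := C_R_NormedModule) (Cmult (cis (- (2 * PI * th * t)))));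
      [apply is_linear_Cmult|].
    rewrite heis_plus_comm3.
    eapply is_derive_ext; [intros s; rewrite heis_plus_comm3; reflexivity|].
    exact (is_derive_line f f' u Hd (plus p (scal t v)) y). }
  assert (CF : forall y t, continuous (F y) t) by (intros; now apply continuous_avg_line).
  assert (CF' : forall y t, continuous (fun z : R * R => F' (fst z) (snd z)) (y, t)).
  { intros y t.
    apply (continuous_comp (fun z : R * R => (plus p (scal (fst z) u) : heis, snd z))
      (fun x : heis * R => (cis (- (2 * PI * th * snd x)) * f' (plus (fst x) (scal (snd x) v)))%C)).
    - apply (continuous_pair (V := prod_UniformSpace (prod_UniformSpace R_UniformSpace R_UniformSpace) R_UniformSpace) (W := R_UniformSpace)).
      + apply (continuous_comp (fun z : R * R => fst z) (fun t : R => plus p (scal t u) : heis)).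
        * apply (continuous_fst (U := R_UniformSpace) (V := R_UniformSpace)).
        * apply (continuous_slice (fun (p : heis) (t : R) => plus p (scal t u) : heis)). apply continuous_line_pt.
      + apply (continuous_snd (U := R_UniformSpace) (V := R_UniformSpace)).
    - simpl. now apply continuous_avg_integrand. }
  assert (E : avg v th f' p = cRInt (F' 0)).
  { apply cRInt_ext; intros t. unfold F'. now rewrite heis_plus_0. }
  rewrite E. apply is_derive_RC; unfold avg, cRInt; simpl.
  - apply (is_derive_RInt_param_cont (fun y t => Re (F y t)) (fun y t => Re (F' y t))).
    + intros; apply is_derive_Re, DF.
    + intros; apply continuous_Re, CF.
    + intros; now apply (continuous_Re (fun z : R * R => F' (fst z) (snd z))).
  - apply (is_derive_RInt_param_cont (fun y t => Im (F y t)) (fun y t => Im (F' y t))).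
    + intros; apply is_derive_Im, DF.
    + intros; apply continuous_Im, CF.
    + intros; now apply (continuous_Im (fun z : R * R => F' (fst z) (snd z))).
Qed.

Lemma avg_ext (v : heis) th (f g : heis -> C) (p : heis) : (forall t : R, f (plus p (scal t v)) = g (plus p (scal t v))) ->
  avg v th f p = avg v th g p.
Proof. intros H; apply cRInt_ext; intros t; now rewrite H. Qed.

Lemma avg_plus (v : heis) th (f g : heis -> C) (p : heis) : (forall p, continuous f p) -> (forall p, continuous g p) ->
  avg v th (fun q => (f q + g q)%C) p = (avg v th f p + avg v th g p)%C.
Proof.
  intros Hf Hg. unfold avg. rewrite <- cRInt_plus by (intros; now apply continuous_avg_line).
  apply cRInt_ext; intros t; ring.
Qed.

Lemma avg_Cmult (v : heis) th c (f : heis -> C) (p : heis) : (forall p, continuous f p) ->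
  avg v th (fun q => (c * f q)%C) p = (c * avg v th f p)%C.
Proof.
  intros Hf. unfold avg. rewrite <- cRInt_Cmult by (intros; now apply continuous_avg_line).
  apply cRInt_ext; intros t; ring.
Qed.

Lemma avg_character (v : heis) th (f : heis -> C) (p : heis) s : (forall p, continuous f p) ->
  (forall p, f (plus p v) = (cis (2 * PI * th) * f p)%C) ->
  avg v th f (plus p (scal s v)) = (cis (2 * PI * th * s) * avg v th f p)%C.
Proof.
  intros Hf Hv. unfold avg.
  set (h := fun t : R => (cis (- (2 * PI * th * t)) * f (plus p (scal t v)))%C).
  assert (Hc : forall t, continuous h t) by (intros; now apply continuous_avg_line).
  fold h. rewrite <- (cRInt_shift h s Hc).
  - rewrite <- cRInt_Cmult.
    + apply cRInt_ext; intros t. unfold h. rewrite Cmult_assoc, <- cis_plus. f_equal.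
      * f_equal; ring.
      * f_equal. apply heis_line_add.
    + intros t. apply (continuous_comp (fun t => t + s) h); [|apply Hc].
      apply @ex_derive_continuous; auto_derive; auto.
  - intros t. unfold h.
    replace (plus p (scal (t + 1) v)) with (plus (plus p (scal t v)) v).
    + rewrite Hv, Cmult_assoc, <- cis_plus. f_equal. f_equal. ring.
    + rewrite <- plus_assoc. f_equal. destruct v as [[v1 v2] v3].
      change ((t * v1 + v1, t * v2 + v2, t * v3 + v3) = ((t + 1) * v1, (t + 1) * v2, (t + 1) * v3)).
      apply (f_equal2 pair); [apply (f_equal2 pair)|]; ring.
Qed.

Lemma avg_translate (v : heis) th c (f : heis -> C) (p w : heis) : (forall p, continuous f p) ->
  (forall p, f (plus p w) = (c * f p)%C) ->
  avg v th f (plus p w) = (c * avg v th f p)%C.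
Proof.
  intros Hf Hw. unfold avg. rewrite <- cRInt_Cmult by (intros; now apply continuous_avg_line).
  apply cRInt_ext; intros t.
  replace (plus (plus p w) (scal t v)) with (plus (plus p (scal t v)) w).
  - rewrite Hw. ring.
  - rewrite <- !plus_assoc. f_equal. apply plus_comm.
Qed.

(** Linearity of [D] in the direction is not included; the relations needed between different
    directions come from uniqueness of derivatives. *)
Definition C1_with (f : heis -> C) (D : heis -> heis -> C) : Prop :=
  (forall p, continuous f p) /\ (forall v p, continuous (D v) p) /\
  forall v p, is_derive (fun t : R => f (plus p (scal t v))) 0 (D v p).

Lemma is_Ck_C1_with (f : heis -> C) : is_Ck (W := C_R_NormedModule) 1 f -> exists D, C1_with f D.
Proof.
  intros [Hc Hd].
  destruct (choice _ Hd) as [D HD]. exists D. split; [exact Hc|split].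
  - intros v p. apply (HD v).
  - intros v p. apply (HD v).
Qed.

Lemma avg_C1_with v th f D : C1_with f D -> C1_with (avg v th f) (fun u => avg v th (D u)).
Proof.
  intros [H1 [H2 H3]]. split; [|split].
  - intros p; now apply continuous_avg.
  - intros u p; now apply continuous_avg.
  - intros u p; apply avg_derive; auto.
Qed.

Lemma is_derive_C_unique (f : R -> C) x l m : is_derive f x l -> is_derive f x m -> l = m.
Proof. intros H1 H2. rewrite <- (derive_C_eq _ _ _ H1). now apply derive_C_eq. Qed.

(** The zero order term of the operator: [[e_1, e_2] = d^2 T e_3], and the Clifford terms of the
    connection add up to a multiple of [e_1 e_2 e_3 = 1]. *)
Definition dirac_shift (d T : R) : R := d ^ 2 * T / 4.

(** Coordinate expressions of the orthonormal frame at a point with abscissa [x]. The curves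
    [p exp (t e_i)] are straight lines in coordinates, so left invariant derivatives are ordinary
    directional derivatives, and [Y = d/dy + x d/dz] gives the dependence on [x]. *)
Definition frameX (d : R) : heis := (- d, 0, 0).
Definition frameY (d x : R) : heis := (0, - d, - (d * x)).
Definition frameZ (T : R) : heis := (0, 0, / T).

Lemma heis_dirac_formula d T (s : heis -> spinor) Du Dv x y z :
  d <> 0 -> T <> 0 -> C1_with (fun p => fst (s p)) Du -> C1_with (fun p => snd (s p)) Dv ->
  let p := (x, y, z) in
  heis_dirac d T s p =
   ((Ci * Dv (frameX d) p + (Dv (frameY d x) p + (Ci * Du (frameZ T) p + RtoC (dirac_shift d T) * fst (s p))))%C,
    (Ci * Du (frameX d) p + (- (1) * Du (frameY d x) p + (- Ci * Dv (frameZ T) p + RtoC (dirac_shift d T) * snd (s p))))%C).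
Proof.
  intros Hd HT Hu Hv p.
  assert (HD : forall A w, (forall t, heis_mul p (lie_exp (scal t A)) = plus p (scal t w)) ->
     left_invariant_derivative A s p = (Du w p, Dv w p)).
  { intros A w HA. unfold left_invariant_derivative.
    apply derive_spinor_eq.
    apply (is_derive_ext (fun t : R => s (plus p (scal t w)))); [intros t; now rewrite HA|].
    apply (is_derive_ext (fun t : R => (fst (s (plus p (scal t w))), snd (s (plus p (scal t w)))))).
    { intros t; now destruct (s _). }
    apply (is_derive_pair (V := C_R_NormedModule) (W := C_R_NormedModule)); [apply Hu|apply Hv]. }
  assert (H0 : left_invariant_derivative (heis_frame d T 0) s p = (Du (frameX d) p, Dv (frameX d) p)).
  { apply HD. intros t. unfold p. cbv -[Rplus Rmult Ropp Rinv IZR].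
    apply (f_equal2 pair); [apply (f_equal2 pair)|]; field. }
  assert (H1 : left_invariant_derivative (heis_frame d T 1) s p = (Du (frameY d x) p, Dv (frameY d x) p)).
  { apply HD. intros t. unfold p. cbv -[Rplus Rmult Ropp Rinv IZR].
    apply (f_equal2 pair); [apply (f_equal2 pair)|]; field. }
  assert (H2 : left_invariant_derivative (heis_frame d T 2) s p = (Du (frameZ T) p, Dv (frameZ T) p)).
  { apply HD. intros t. unfold p. cbv -[Rplus Rmult Ropp Rinv IZR].
    apply (f_equal2 pair); [apply (f_equal2 pair)|]; field; auto. }
  unfold heis_dirac, spinor_connection. rewrite !sum_Sn, !sum_O, H0, H1, H2.
  generalize (Du (frameX d) p) (Dv (frameX d) p) (Du (frameY d x) p) (Dv (frameY d x) p) (Du (frameZ T) p) (Dv (frameZ T) p).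
  destruct (s p) as [[u1 u2] [v1 v2]].
  intros [a1 a2] [b1 b2] [c1 c2] [e1 e2] [f1 f2] [g1 g2].
  unfold dirac_shift, Rdiv. clear - Hd HT. cbv -[Rplus Rmult Ropp Rinv IZR].
  apply (f_equal2 pair); apply (f_equal2 pair). all: field; auto.
Qed.

(** * Fourier modes *)

(** Evaluation at [y = z = 0] loses nothing, since the doubly averaged function is a character in
    [y] and [z]. *)
Definition mode (be tau : R) (f : heis -> C) (x : R) : C := avg ey be (avg ez tau f) (x, 0, 0).

Lemma mode_eq be tau f x : mode be tau f x =
  cRInt (fun y => cis (- (2 * PI * be * y)) * cRInt (fun z => cis (- (2 * PI * tau * z)) * f (x, y, z)))%C.
Proof.
  unfold mode, avg. apply cRInt_ext; intros y. f_equal. apply cRInt_ext; intros z. f_equal. f_equal.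
  change ((x + y * 0 + z * 0, 0 + y * 1 + z * 0, 0 + y * 0 + z * 1) = (x, y, z)).
  apply (f_equal2 pair); [apply (f_equal2 pair)|]; ring.
Qed.

Lemma mode_ext be tau f g x : (forall y z, f (x, y, z) = g (x, y, z)) -> mode be tau f x = mode be tau g x.
Proof.
  intros H. rewrite !mode_eq. apply cRInt_ext; intros y. f_equal. apply cRInt_ext; intros z. now rewrite H.
Qed.

Lemma mode_plus be tau (f g : heis -> C) x : (forall p, continuous f p) -> (forall p, continuous g p) ->
  mode be tau (fun p => (f p + g p)%C) x = (mode be tau f x + mode be tau g x)%C.
Proof.
  intros Hf Hg. unfold mode. rewrite <- avg_plus by (intros; now apply continuous_avg).
  apply avg_ext; intros t. now apply avg_plus.
Qed.

Lemma mode_Cmult be tau c (f : heis -> C) x : (forall p, continuous f p) ->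
  mode be tau (fun p => (c * f p)%C) x = (c * mode be tau f x)%C.
Proof.
  intros Hf. unfold mode. rewrite <- avg_Cmult by (intros; now apply continuous_avg).
  apply avg_ext; intros t. now apply avg_Cmult.
Qed.

(** The lattice acts on spinors by scalars, so each component can be treated alone and the
    generators suffice. The generator in [x] shears [z] by [L y]. *)
Definition scalar_equivariant (L d1 d2 d3 : R) (f : heis -> C) : Prop :=
  (forall p, f (plus p ez) = (RtoC d3 * f p)%C) /\
  (forall p, f (plus p ey) = (RtoC d2 * f p)%C) /\
  (forall x y z, f (x + L, y, z) = (RtoC d1 * f (x, y, (z - L * y)%R))%C).

Lemma heis_equivariant_components r d1 d2 d3 s : heis_equivariant r d1 d2 d3 s ->
  scalar_equivariant (INR r) d1 d2 d3 (fun p => fst (s p)) /\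
  scalar_equivariant (INR r) d1 d2 d3 (fun p => snd (s p)).
Proof.
  intros H.
  assert (Hz : forall p, s (plus p ez) = scal (RtoC d3) (s p)).
  { intros [[x y] z]. pose proof (H 0%Z 0%Z 1%Z (x, y, z)) as E. simpl powerRZ in E.
    rewrite !Rmult_1_l, Rmult_1_r in E. refine (eq_trans (f_equal s _) E).
    change ((x + 0, y + 0, z + 1) = (INR r * 0 + x, 0 + y, 1 + z + INR r * 0 * y)).
    apply (f_equal2 pair); [apply (f_equal2 pair)|]; ring. }
  assert (Hy : forall p, s (plus p ey) = scal (RtoC d2) (s p)).
  { intros [[x y] z]. pose proof (H 0%Z 1%Z 0%Z (x, y, z)) as E. simpl powerRZ in E.
    rewrite !Rmult_1_l, !Rmult_1_r in E. refine (eq_trans (f_equal s _) E).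
    change ((x + 0, y + 1, z + 0) = (INR r * 0 + x, 1 + y, 0 + z + INR r * 0 * y)).
    apply (f_equal2 pair); [apply (f_equal2 pair)|]; ring. }
  assert (Hx : forall x y z, s (x + INR r, y, z) = scal (RtoC d1) (s (x, y, z - INR r * y))).
  { intros x y z. pose proof (H 1%Z 0%Z 0%Z (x, y, z - INR r * y)) as E. simpl powerRZ in E.
    rewrite !Rmult_1_r in E. refine (eq_trans (f_equal s _) E).
    change ((x + INR r, y, z) = (INR r + x, 0 + y, 0 + (z - INR r * y) + INR r * y)).
    apply (f_equal2 pair); [apply (f_equal2 pair)|]; ring. }
  repeat split; intros; rewrite ?Hz, ?Hy, ?Hx; reflexivity.
Qed.

Section Mode.
Context (L d1 d2 d3 : R) (f : heis -> C).
Context (Hc : forall p, continuous f p) (He : scalar_equivariant L d1 d2 d3 f).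
Context (be tau : R) (Hbe : cis (2 * PI * be) = RtoC d2) (Htau : cis (2 * PI * tau) = RtoC d3).

Lemma mode_field_z p t : avg ey be (avg ez tau f) (plus p (scal t ez)) =
  (cis (2 * PI * tau * t) * avg ey be (avg ez tau f) p)%C.
Proof using Hc He Htau.
  apply avg_translate; [intros; now apply continuous_avg|].
  intros q. apply avg_character; auto. intros q'. rewrite Htau. apply He.
Qed.

Lemma mode_field_y p t : avg ey be (avg ez tau f) (plus p (scal t ey)) =
  (cis (2 * PI * be * t) * avg ey be (avg ez tau f) p)%C.
Proof using Hc He Hbe.
  apply avg_character; [intros; now apply continuous_avg|].
  intros q. apply avg_translate; auto. intros q'. rewrite Hbe. apply He.
Qed.

Lemma mode_field x y z t t' : avg ey be (avg ez tau f) (x, y + t, z + t') =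
  (cis (2 * PI * tau * t') * (cis (2 * PI * be * t) * avg ey be (avg ez tau f) (x, y, z)))%C.
Proof using Hc He Hbe Htau.
  refine (eq_trans (f_equal (avg ey be (avg ez tau f)) _) (eq_trans (mode_field_z (x, y + t, z) t')
    (f_equal (Cmult _) (eq_trans (f_equal (avg ey be (avg ez tau f)) _) (mode_field_y (x, y, z) t))))).
  - change ((x, y + t, z + t') = (x + t' * 0, y + t + t' * 0, z + t' * 1)).
    apply (f_equal2 pair); [apply (f_equal2 pair)|]; ring.
  - change ((x, y + t, z) = (x + t * 0, y + t * 1, z + t * 0)).
    apply (f_equal2 pair); [apply (f_equal2 pair)|]; ring.
Qed.

Lemma mode_derive D x : C1_with f D -> is_derive (mode be tau f) x (mode be tau (D ex) x).
Proof using.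
  intros HD. pose proof (avg_C1_with ey be _ _ (avg_C1_with ez tau _ _ HD)) as [_ [_ H]].
  pose proof (is_derive_line _ _ ex (H ex) (0, 0, 0) x) as E.
  assert (A : forall t, plus (0, 0, 0) (scal t ex) = (t, 0, 0) :> heis).
  { intros t. change ((0 + t * 1, 0 + t * 0, 0 + t * 0) = (t, 0, 0)).
    apply (f_equal2 pair); [apply (f_equal2 pair)|]; ring. }
  rewrite A in E. eapply is_derive_ext; [|exact E]. intros t. cbv beta. now rewrite A.
Qed.

Lemma mode_frameX d D x : C1_with f D ->
  mode be tau (D (frameX d)) x = (RtoC (- d) * mode be tau (D ex) x)%C.
Proof using.
  intros HD. pose proof (avg_C1_with ey be _ _ (avg_C1_with ez tau _ _ HD)) as [_ [_ H]].
  apply (is_derive_C_unique (fun t => avg ey be (avg ez tau f) (plus (x, 0, 0) (scal t (frameX d)))) 0).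
  - apply H.
  - pose proof (is_derive_comp (V := C_R_NormedModule) (fun t : R => avg ey be (avg ez tau f) (plus (x, 0, 0) (scal t ex)))
      (fun t => - d * t) 0 (mode be tau (D ex) x) (- d)) as E.
    rewrite <- scal_R_Cmult.
    eapply is_derive_ext; [|apply E].
    + intros t. cbv beta. f_equal. change ((x + - d * t * 1, 0 + - d * t * 0, 0 + - d * t * 0) = (x + t * - d, 0 + t * 0, 0 + t * 0)).
      apply (f_equal2 pair); [apply (f_equal2 pair)|]; ring.
    + rewrite Rmult_0_r. apply H.
    + auto_derive; auto; eqR; ring.
Qed.

(** On a mode the field [Y] becomes multiplication by [2 pi i (be + x tau)]; this linear function of
    [x] is what produces the oscillator potential. *)
Lemma mode_frameY d D x : C1_with f D ->
  mode be tau (D (frameY d x)) x = (Ci * RtoC (- d * (2 * PI * (be + x * tau))) * mode be tau f x)%C.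
Proof using Hc He Hbe Htau.
  intros HD. pose proof (avg_C1_with ey be _ _ (avg_C1_with ez tau _ _ HD)) as [_ [_ H]].
  apply (is_derive_C_unique (fun t => avg ey be (avg ez tau f) (plus (x, 0, 0) (scal t (frameY d x)))) 0).
  - apply H.
  - apply (is_derive_ext (fun t : R => mode be tau f x * cis (- d * (2 * PI * (be + x * tau)) * t))%C).
    + intros t. refine (eq_trans _ (f_equal (avg ey be (avg ez tau f)) (_ : (x, 0 + - d * t, 0 + - d * x * t) = _))).
      * rewrite mode_field. fold (mode be tau f x).
        rewrite Cmult_assoc, <- cis_plus, Cmult_comm. f_equal. f_equal. ring.
      * change ((x, 0 + - d * t, 0 + - d * x * t) = (x + t * 0, 0 + t * - d, 0 + t * - (d * x))).
        apply (f_equal2 pair); [apply (f_equal2 pair)|]; ring.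
    + evar_last.
      * apply (is_derive_linear (V := C_R_NormedModule) (W := C_R_NormedModule) (Cmult (mode be tau f x))); [apply is_linear_Cmult|].
        apply (is_derive_cis (fun t => - d * (2 * PI * (be + x * tau)) * t)). 
        instantiate (1 := - d * (2 * PI * (be + x * tau))). auto_derive; auto; eqR; ring.
      * cbv beta. rewrite Rmult_0_r, cis_0, Cmult_1_r. apply Cmult_comm.
Qed.

Lemma mode_frameZ T D x : C1_with f D ->
  mode be tau (D (frameZ T)) x = (Ci * RtoC (2 * PI * tau / T) * mode be tau f x)%C.
Proof using Hc He Hbe Htau.
  intros HD. pose proof (avg_C1_with ey be _ _ (avg_C1_with ez tau _ _ HD)) as [_ [_ H]].
  apply (is_derive_C_unique (fun t => avg ey be (avg ez tau f) (plus (x, 0, 0) (scal t (frameZ T)))) 0).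
  - apply H.
  - apply (is_derive_ext (fun t : R => mode be tau f x * cis (2 * PI * tau / T * t))%C).
    + intros t. refine (eq_trans _ (f_equal (avg ey be (avg ez tau f)) (_ : (x, 0 + 0, 0 + / T * t) = _))).
      * rewrite mode_field, Rmult_0_r, cis_0, Cmult_1_l. fold (mode be tau f x).
        rewrite Cmult_comm. f_equal. f_equal. unfold Rdiv; ring.
      * change ((x, 0 + 0, 0 + / T * t) = (x + t * 0, 0 + t * 0, 0 + t * / T)).
        apply (f_equal2 pair); [apply (f_equal2 pair)|]; ring.
    + evar_last.
      * apply (is_derive_linear (V := C_R_NormedModule) (W := C_R_NormedModule) (Cmult (mode be tau f x))); [apply is_linear_Cmult|].
        apply (is_derive_cis (fun t => 2 * PI * tau / T * t)). 
        instantiate (1 := 2 * PI * tau / T). auto_derive; auto; eqR; unfold Rdiv; ring.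
      * cbv beta. rewrite Rmult_0_r, cis_0, Cmult_1_r. apply Cmult_comm.
Qed.

Lemma avg_z_periodic_y x y : avg ez tau f (x, y + 1, 0) = (RtoC d2 * avg ez tau f (x, y, 0%R))%C.
Proof using Hc He.
  rewrite <- (avg_translate ez tau (RtoC d2) f (x, y, 0) ey Hc); [|apply He].
  f_equal. change ((x, y + 1, 0) = (x + 0, y + 1, 0 + 0)).
  apply (f_equal2 pair); [apply (f_equal2 pair)|]; ring.
Qed.

(** The shear [z - L y], seen at fibre frequency [tau], adds [tau * L] to the frequency in [y]. For
    nonzero [tau] all modes whose frequencies agree modulo [tau * L] are thus translates of one
    function. *)
Lemma mode_shift x : mode be tau f (x + L) = (RtoC d1 * mode (be + tau * L) tau f x)%C.
Proof using Hc He Htau.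
  assert (E : forall y, avg ez tau f (x + L, y, 0) =
    (RtoC d1 * (cis (- (2 * PI * (tau * L) * y)) * avg ez tau f (x, y, 0%R)))%C).
  { intros y.
    transitivity (RtoC d1 * avg ez tau f (plus (x, y, 0%R) (scal (- (L * y))%R ez)))%C.
    - unfold avg. rewrite <- cRInt_Cmult by (intros; now apply continuous_avg_line).
      apply cRInt_ext; intros z.
      replace (plus (x + L, y, 0) (scal z ez)) with (x + L, y, z).
      + rewrite (proj2 (proj2 He)).
        replace (plus (plus (x, y, 0) (scal (- (L * y)) ez)) (scal z ez)) with (x, y, z - L * y); [ring|].
        change ((x, y, z - L * y) = (x + - (L * y) * 0 + z * 0, y + - (L * y) * 0 + z * 0, 0 + - (L * y) * 1 + z * 1)).
        apply (f_equal2 pair); [apply (f_equal2 pair)|]; ring.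
      + change ((x + L, y, z) = (x + L + z * 0, y + z * 0, 0 + z * 1)).
        apply (f_equal2 pair); [apply (f_equal2 pair)|]; ring.
    - f_equal. rewrite avg_character; auto.
      + f_equal. f_equal. ring.
      + intros q. rewrite Htau. apply He. }
  unfold mode. unfold avg at 1 3.
  assert (A : forall a t : R, plus (a, 0, 0) (scal t ey) = (a, t, 0) :> heis).
  { intros a t. change ((a + t * 0, 0 + t * 1, 0 + t * 0) = (a, t, 0)).
    apply (f_equal2 pair); [apply (f_equal2 pair)|]; ring. }
  rewrite <- cRInt_Cmult by (intros; apply continuous_avg_line; intros; now apply continuous_avg).
  apply cRInt_ext; intros y. rewrite !A, E.
  replace (- (2 * PI * (be + tau * L) * y)) with (- (2 * PI * be * y) + - (2 * PI * (tau * L) * y)) by ring.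
  rewrite cis_plus. ring.
Qed.
End Mode.

Lemma cRInt_norm_le h : (forall t, continuous h t) -> Cmod (cRInt h) <= 2 * RInt (fun t => Cmod (h t)) 0 1.
Proof.
  intros Hc.
  assert (CM : forall t, continuous (fun t => Cmod (h t)) t).
  { intros t. apply (continuous_comp h Cmod); [apply Hc|]. exact (filterlim_norm (V := C_NormedModule) (h t)). }
  assert (CR : forall t, continuous (fun t => Re (h t)) t) by (intros; now apply continuous_Re).
  assert (CI : forall t, continuous (fun t => Im (h t)) t) by (intros; now apply continuous_Im).
  assert (CAR : forall t, continuous (fun t => Rabs (Re (h t))) t).
  { intros t; apply (continuous_comp (fun t => Re (h t)) Rabs); [apply CR|apply continuous_Rabs]. }
  assert (CAI : forall t, continuous (fun t => Rabs (Im (h t))) t).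
  { intros t; apply (continuous_comp (fun t => Im (h t)) Rabs); [apply CI|apply continuous_Rabs]. }
  eapply Rle_trans; [apply Cmod_le_components|]. unfold cRInt. simpl Re. simpl Im.
  pose proof (abs_RInt_le (fun t => Re (h t)) 0 1 ltac:(lra) (ex_RInt_cont _ _ _ CR)) as A1.
  pose proof (abs_RInt_le (fun t => Im (h t)) 0 1 ltac:(lra) (ex_RInt_cont _ _ _ CI)) as A2.
  pose proof (RInt_le (fun t => Rabs (Re (h t))) (fun t => Cmod (h t)) 0 1 ltac:(lra) (ex_RInt_cont _ _ _ CAR)
    (ex_RInt_cont _ _ _ CM) ltac:(intros; apply Rabs_Re_le)) as B1.
  pose proof (RInt_le (fun t => Rabs (Im (h t))) (fun t => Cmod (h t)) 0 1 ltac:(lra) (ex_RInt_cont _ _ _ CAI)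
    (ex_RInt_cont _ _ _ CM) ltac:(intros; apply Rabs_Im_le)) as B2.
  unfold Re, Im in *. lra.
Qed.

(** The bound must not depend on the frequencies: bringing [x] back to one period changes [be]. *)
Lemma mode_bound_continuous (f : heis -> C) : (forall p, continuous f p) ->
  exists B : R -> R, (forall x, continuous B x) /\
    forall be tau x, Cmod (mode be tau f x) <= B x.
Proof.
  intros Hc.
  assert (CM : forall p, continuous (fun p => Cmod (f p)) p).
  { intros p. apply (continuous_comp f Cmod); [apply Hc|]. exact (filterlim_norm (V := C_NormedModule) (f p)). }
  set (G := fun (q : R * R) (z : R) => Cmod (f (q, z))).
  assert (CG : forall q z, continuous (fun x : (R * R) * R => G (fst x) (snd x)) (q, z)).
  { intros q z. apply (continuous_ext (fun x : heis => Cmod (f x))); [intros [q' z']; reflexivity|apply CM]. }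
  set (F := fun x y : R => RInt (G (x, y)) 0 1).
  assert (CF : forall x y, continuous (fun q : R * R => F (fst q) (snd q)) (x, y)).
  { intros x y. apply (continuous_ext (fun q : R * R => RInt (G q) 0 1)); [intros [x' y']; reflexivity|].
    apply (continuous_RInt_param G (x, y)). exact CG. }
  exists (fun x => 4 * RInt (F x) 0 1). split.
  { intros x. apply continuous_Rmult; [apply continuous_const|]. apply (continuous_RInt_param F x). exact CF. }
  intros be tau x. rewrite mode_eq.
  set (h := fun y => cRInt (fun z => cis (- (2 * PI * tau * z)) * f (x, y, z))%C).
  assert (Cz : forall y z, continuous (fun z => cis (- (2 * PI * tau * z)) * f (x, y, z))%C z).
  { intros y z. apply (continuous_Cmult (fun z => cis (- (2 * PI * tau * z))) (fun z => f (x, y, z))); [apply continuous_cis_lin|].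
    apply (continuous_slice (fun (q : R * R) (z : R) => f (q, z)) (x, y)).
    apply (continuous_ext f); [intros [q' z']; reflexivity|apply Hc]. }
  assert (Ch : forall y, continuous h y).
  { intros y. apply (continuous_ext (fun y => avg ez tau f (x, y, 0))).
    - intros y'. apply cRInt_ext; intros z. f_equal. f_equal.
      change ((x + z * 0, y' + z * 0, 0 + z * 1) = (x, y', z)).
      apply (f_equal2 pair); [apply (f_equal2 pair)|]; ring.
    - apply (continuous_comp (fun y => (x, y, 0) : heis) (avg ez tau f)); [|now apply continuous_avg].
      apply (continuous_pair (V := prod_UniformSpace R_UniformSpace R_UniformSpace) (W := R_UniformSpace));
        [|apply continuous_const].
      apply (continuous_pair (V := R_UniformSpace) (W := R_UniformSpace));
        [apply continuous_const|apply continuous_id]. }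
  assert (Hh : forall y, Cmod (h y) <= 2 * F x y).
  { intros y. eapply Rle_trans; [apply cRInt_norm_le, Cz|]. right. f_equal. apply RInt_ext; intros z _.
    rewrite Cmod_mult, Cmod_cis, Rmult_1_l. reflexivity. }
  assert (Chh : forall y, continuous (fun y => cis (- (2 * PI * be * y)) * h y)%C y).
  { intros y. apply (continuous_Cmult (fun y => cis (- (2 * PI * be * y))) h); [apply continuous_cis_lin|apply Ch]. }
  eapply Rle_trans; [apply cRInt_norm_le, Chh|].
  assert (CFx : forall y, continuous (F x) y) by (intros y; apply (continuous_slice F), CF).
  assert (I : RInt (fun t => Cmod (cis (- (2 * PI * be * t)) * h t)) 0 1 <= RInt (fun t => 2 * F x t) 0 1).
  { apply RInt_le; [lra| | |].
    - apply ex_RInt_cont; intros t. apply (continuous_comp (fun t => cis (- (2 * PI * be * t)) * h t)%C Cmod); [apply Chh|].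
      exact (filterlim_norm (V := C_NormedModule) _).
    - apply ex_RInt_cont; intros t. apply continuous_Rmult; [apply continuous_const|apply CFx].
    - intros t _. rewrite Cmod_mult, Cmod_cis, Rmult_1_l. apply Hh. }
  rewrite RInt_Rscal in I by now apply ex_RInt_cont. cbv beta. eapply Rle_trans; [apply Rmult_le_compat_l; [lra|exact I]|]. right; ring.
Qed.

Lemma mode_shift_Z L d1 d2 d3 (f : heis -> C) tau : d1 = 1 \/ d1 = -1 ->
  (forall p, continuous f p) -> scalar_equivariant L d1 d2 d3 f -> cis (2 * PI * tau) = RtoC d3 ->
  forall (j : Z) be x, Cmod (mode be tau f (x + L * IZR j)) = Cmod (mode (be + IZR j * (tau * L)) tau f x).
Proof.
  intros Hd1 Hc He Htau.
  assert (H1 : Cmod (RtoC d1) = 1).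
  { rewrite Cmod_R. destruct Hd1 as [-> | ->]; unfold Rabs; destruct Rcase_abs; lra. }
  apply (Z.peano_ind (fun j => forall be x, Cmod (mode be tau f (x + L * IZR j)) = Cmod (mode (be + IZR j * (tau * L)) tau f x))).
  - intros b x'. rewrite Rmult_0_r, Rmult_0_l, !Rplus_0_r. reflexivity.
  - intros j IH b x'. rewrite succ_IZR.
    replace (x' + L * (IZR j + 1)) with (x' + L * IZR j + L) by ring.
    rewrite (mode_shift L d1 d2 d3 f Hc He b tau Htau), Cmod_mult, H1, Rmult_1_l, IH.
    f_equal. f_equal. ring.
  - intros j IH b x'. rewrite <- Z.sub_1_r, minus_IZR.
    specialize (IH (b - tau * L) x').
    replace (x' + L * IZR j) with (x' + L * (IZR j - 1) + L) in IH by ring.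
    rewrite (mode_shift L d1 d2 d3 f Hc He (b - tau * L) tau Htau), Cmod_mult, H1, Rmult_1_l in IH.
    replace (b - tau * L + tau * L) with b in IH by ring. rewrite IH. f_equal. f_equal. ring.
Qed.

(** Every [x] is moved into [[0, L]] by whole periods, at the price of another frequency in [y], to
    which the bound is insensitive. Boundedness takes the place of square integrability on the
    line. *)
Lemma mode_bounded L d1 d2 d3 (f : heis -> C) be tau : 0 < L -> d1 = 1 \/ d1 = -1 ->
  (forall p, continuous f p) -> scalar_equivariant L d1 d2 d3 f -> cis (2 * PI * tau) = RtoC d3 ->
  exists M, forall x, Cmod (mode be tau f x) <= M.
Proof.
  intros HL Hd1 Hc He Htau.
  destruct (mode_bound_continuous f Hc) as [B [CB HB]].
  destruct (bounded_continuity B 0 L) as [M HM]; [intros; apply CB|].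
  exists M. intros x.
  destruct (archimed (x / L)) as [A1 A2].
  set (j := (up (x / L) - 1)%Z).
  assert (Hx : 0 <= x - L * IZR j <= L).
  { unfold j. rewrite minus_IZR. assert (E : x = L * (x / L)) by (field; lra).
    set (q := x / L) in *. set (u := IZR (up q)) in *. rewrite E. clearbody q u. split; nra. }
  replace x with (x - L * IZR j + L * IZR j) by ring.
  rewrite (mode_shift_Z L d1 d2 d3 f tau Hd1 Hc He Htau).
  eapply Rle_trans; [apply HB|]. eapply Rle_trans; [apply Rle_abs|]. left. exact (HM _ Hx).
Qed.

(** One-dimensional uniqueness is applied twice: in [y] to each fibre coefficient, then in [z] to
    the function itself. *)
Lemma mode_unique L d1 d2 d3 (f : heis -> C) th2 th3 :
  (forall p, continuous f p) -> scalar_equivariant L d1 d2 d3 f ->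
  cis (2 * PI * th2) = RtoC d2 -> cis (2 * PI * th3) = RtoC d3 ->
  (forall m n x, mode (th2 + IZR m) (th3 + IZR n) f x = RtoC 0) -> forall p, f p = RtoC 0.
Proof.
  intros Hc He H2 H3 H0 [[x y] z].
  assert (A : forall n y, avg ez (th3 + IZR n) f (x, y, 0) = RtoC 0).
  { intros n. apply (fourier_uniqueness th2).
    - intros t. apply (continuous_comp (fun y => (x, y, 0) : heis) (avg ez (th3 + IZR n) f)); [|now apply continuous_avg].
      apply (continuous_pair (V := prod_UniformSpace R_UniformSpace R_UniformSpace) (W := R_UniformSpace));
        [|apply continuous_const].
      apply (continuous_pair (V := R_UniformSpace) (W := R_UniformSpace));
        [apply continuous_const|apply continuous_id].
    - intros t. rewrite H2. now apply (avg_z_periodic_y L d1 d2 d3).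
    - intros m. rewrite <- (H0 m n x). unfold mode. apply cRInt_ext; intros t. f_equal. f_equal.
      change ((x, t, 0) = (x + t * 0, 0 + t * 1, 0 + t * 0)).
      apply (f_equal2 pair); [apply (f_equal2 pair)|]; ring. }
  apply (fourier_uniqueness th3 (fun z => f (x, y, z))).
  - intros t. apply (continuous_slice (fun (q : R * R) (z : R) => f (q, z)) (x, y)).
    apply (continuous_ext f); [intros [q' z']; reflexivity|apply Hc].
  - intros t. rewrite H3, <- (proj1 He). f_equal. 
    change ((x, y, t + 1) = (x + 0, y + 0, t + 1)).
    apply (f_equal2 pair); [apply (f_equal2 pair)|]; ring.
  - intros m. rewrite <- (A m y). apply cRInt_ext; intros t. f_equal. f_equal.
    change ((x, y, t) = (x + t * 0, y + t * 0, 0 + t * 1)).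
    apply (f_equal2 pair); [apply (f_equal2 pair)|]; ring.
Qed.

(** Under the Fourier transform in [y] and [z] the fields [Y] and [Z] become multiplications and
    only the derivative along [X] remains, so the eigenvalue equation becomes a first order system
    in [x]. *)
Lemma mode_ode r d1 d2 d3 d T mu (s : heis -> spinor) be tau : d <> 0 -> T <> 0 ->
  heis_eigenspace r d1 d2 d3 d T mu s ->
  cis (2 * PI * be) = RtoC d2 -> cis (2 * PI * tau) = RtoC d3 ->
  let u := mode be tau (fun p => fst (s p)) in
  let v := mode be tau (fun p => snd (s p)) in
  let nu := mu - dirac_shift d T in
  forall x,
  is_derive v x (RtoC (- (2 * PI * (be + x * tau))) * v x + Ci * RtoC ((nu + 2 * PI * tau / T) / d) * u x)%C /\ is_derive u x (RtoC (2 * PI * (be + x * tau)) * u x + Ci * RtoC ((nu - 2 * PI * tau / T) / d) * v x)%C.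
Proof.
  intros Hd HT [Hs [Heq HD]] Hbe Htau u v nu x.
  destruct (heis_equivariant_components _ _ _ _ _ Heq) as [Eu Ev].
  assert (Su : exists Du, C1_with (fun p => fst (s p)) Du).
  { apply is_Ck_C1_with. apply (is_Ck_linear_comp (W := prod_NormedModule R_AbsRing C_R_NormedModule C_R_NormedModule) (W' := C_R_NormedModule) fst 1 s).
    apply is_linear_fst. apply Hs. }
  assert (Sv : exists Dv, C1_with (fun p => snd (s p)) Dv).
  { apply is_Ck_C1_with. apply (is_Ck_linear_comp (W := prod_NormedModule R_AbsRing C_R_NormedModule C_R_NormedModule) (W' := C_R_NormedModule) snd 1 s).
    apply is_linear_snd. apply Hs. }
  destruct Su as [Du Su], Sv as [Dv Sv].
  assert (Cu := proj1 Su). assert (Cv := proj1 Sv).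
  assert (CDu := proj1 (proj2 Su)). assert (CDv := proj1 (proj2 Sv)).
  pose proof (mode_derive _ be tau Du x Su) as D1. pose proof (mode_derive _ be tau Dv x Sv) as D2.
  fold u in D1. fold v in D2.
  assert (CC : forall c (f : heis -> C) p, (forall p, continuous f p) -> continuous (fun p => c * f p)%C p).
  { intros c f p Hf. apply (continuous_Cmult (fun _ => c) f); [apply continuous_const|apply Hf]. }
  assert (CP : forall (f g : heis -> C) p, (forall p, continuous f p) -> (forall p, continuous g p) -> continuous (fun p => f p + g p)%C p).
  { intros f g p Hf Hg. now apply continuous_Cplus. }
  assert (EQ : forall y z, heis_dirac d T s (x, y, z) = scal (RtoC mu) (s (x, y, z))) by (intros; apply HD).
  assert (F1 : (Ci * mode be tau (Dv (frameX d)) x + (mode be tau (Dv (frameY d x)) x +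
     (Ci * mode be tau (Du (frameZ T)) x + RtoC (dirac_shift d T) * u x)) = RtoC mu * u x)%C).
  { unfold u. rewrite <- !mode_Cmult by auto.
    rewrite <- (mode_plus be tau (fun p => Ci * Du (frameZ T) p)%C) by (intros; auto).
    rewrite <- (mode_plus be tau (Dv (frameY d x))) by (intros; auto).
    rewrite <- (mode_plus be tau (fun p => Ci * Dv (frameX d) p)%C) by (intros; auto).
    apply mode_ext; intros y z. specialize (EQ y z).
    pose proof (heis_dirac_formula d T s Du Dv x y z Hd HT Su Sv) as Q.
    exact (eq_trans (f_equal fst (eq_sym Q)) (f_equal fst EQ)). }
  assert (F2 : (Ci * mode be tau (Du (frameX d)) x + (- (1) * mode be tau (Du (frameY d x)) x +
     (- Ci * mode be tau (Dv (frameZ T)) x + RtoC (dirac_shift d T) * v x)) = RtoC mu * v x)%C).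
  { unfold v. rewrite <- !mode_Cmult by auto.
    rewrite <- (mode_plus be tau (fun p => - Ci * Dv (frameZ T) p)%C) by (intros; auto).
    rewrite <- (mode_plus be tau (fun p => - (1) * Du (frameY d x) p)%C) by (intros; auto).
    rewrite <- (mode_plus be tau (fun p => Ci * Du (frameX d) p)%C) by (intros; auto).
    apply mode_ext; intros y z. specialize (EQ y z).
    pose proof (heis_dirac_formula d T s Du Dv x y z Hd HT Su Sv) as Q.
    exact (eq_trans (f_equal snd (eq_sym Q)) (f_equal snd EQ)). }
  rewrite (mode_frameX _ be tau d Dv x Sv), (mode_frameY _ _ _ _ _ Cv Ev be tau Hbe Htau d Dv x Sv),
    (mode_frameZ _ _ _ _ _ Cu Eu be tau Hbe Htau T Du x Su) in F1.
  rewrite (mode_frameX _ be tau d Du x Su), (mode_frameY _ _ _ _ _ Cu Eu be tau Hbe Htau d Du x Su),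
    (mode_frameZ _ _ _ _ _ Cv Ev be tau Hbe Htau T Dv x Sv) in F2.
  fold u v in F1, F2.
  set (u' := mode be tau (Du ex) x) in *. set (v' := mode be tau (Dv ex) x) in *.
  set (om := 2 * PI * tau / T) in *. set (w := 2 * PI * (be + x * tau)) in *.
  split.
  - replace (_ + _)%C with v'; [exact D2|].
    generalize (f_equal Re F1) (f_equal Im F1). unfold nu.
    destruct (u x) as [u1 u2], (v x) as [w1 w2], v' as [v1 v2]. unfold Re, Im; simpl. clear - Hd. intros R1 R2.
    apply Ceq; unfold Re, Im; simpl; apply Rmult_eq_reg_l with d; auto; field_simplify; lra.
  - replace (_ + _)%C with u'; [exact D1|].
    generalize (f_equal Re F2) (f_equal Im F2). unfold nu.
    destruct (u x) as [u1 u2], (v x) as [w1 w2], u' as [v1 v2]. unfold Re, Im; simpl. clear - Hd. intros R1 R2.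
    apply Ceq; unfold Re, Im; simpl; apply Rmult_eq_reg_l with d; auto; field_simplify; lra.
Qed.

(** * Bases of eigenspaces *)

Definition is_basis {A : Type} (E : (A -> spinor) -> Prop) (n : nat) (b : nat -> A -> spinor) : Prop :=
  (forall s, E s <-> exists c, forall p, s p = lincomb n c b p) /\
  (forall c, (forall p, lincomb n c b p = zero) -> forall i, (i < n)%nat -> c i = RtoC 0).

Section Biorthogonal.
Context {A I : Type} (E : (A -> spinor) -> Prop) (l : list I) (i0 : I)
  (b : I -> A -> spinor) (coefficient : I -> (A -> spinor) -> C).
Context (E0 : E (fun _ => zero))
  (Eplus : forall s s', E s -> E s' -> E (fun p => plus (s p) (s' p)))
  (Escal : forall c s, E s -> E (fun p => scal c (s p)))
  (Hl : NoDup l) (Hb : forall i, In i l -> E (b i))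
  (Lplus : forall i s s', E s -> E s' -> coefficient i (fun p => plus (s p) (s' p)) = (coefficient i s + coefficient i s')%C)
  (Lscal : forall i c s, E s -> coefficient i (fun p => scal c (s p)) = (c * coefficient i s)%C)
  (Lb : forall i, In i l -> coefficient i (b i) = RtoC 1)
  (Lb0 : forall i j, In i l -> In j l -> i <> j -> coefficient i (b j) = RtoC 0)
  (Linj : forall s, E s -> (forall i, In i l -> coefficient i s = RtoC 0) -> forall p, s p = zero).

Lemma coefficient_zero i : coefficient i (fun _ => zero) = RtoC 0.
Proof using E0 Lscal.
  pose proof (Lscal i (RtoC 0) _ E0) as H.
  rewrite Cmult_0_l in H. rewrite <- H. f_equal. extensionality p. symmetry. exact (scal_zero_r (K := C_AbsRing) _).
Qed.

Lemma lincomb_E n c : (n <= length l)%nat -> E (lincomb n c (fun m => b (nth m l i0))).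
Proof using E0 Eplus Escal Hb.
  induction n as [|n IH]; intros Hn; [exact E0|].
  apply (Eplus (lincomb n c (fun m => b (nth m l i0))) (fun p => scal (c n) (b (nth n l i0) p))).
  - apply IH; lia.
  - apply Escal, Hb, nth_In; lia.
Qed.

Lemma coefficient_lincomb n c m : (n <= length l)%nat -> (m < length l)%nat ->
  coefficient (nth m l i0) (lincomb n c (fun m => b (nth m l i0))) = if Nat.ltb m n then c m else RtoC 0.
Proof using E0 Eplus Escal Hb Hl Lplus Lscal Lb Lb0.
  intros Hn Hm; induction n as [|n IH]; [apply coefficient_zero|].
  refine (eq_trans (Lplus _ (lincomb n c (fun m => b (nth m l i0))) (fun p => scal (c n) (b (nth n l i0) p)) _ _) _).
  - apply lincomb_E; lia.
  - apply Escal, Hb, nth_In; lia.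
  - rewrite IH by lia. rewrite Lscal by (apply Hb, nth_In; lia).
    destruct (Nat.ltb_spec m n), (Nat.ltb_spec m (S n)); try lia.
    + rewrite Lb0; try (apply nth_In; lia); [rewrite Cmult_0_r; apply Cplus_0_r|].
      intros EQ. apply NoDup_nth in EQ; auto; lia.
    + replace m with n by lia. rewrite Lb by (apply nth_In; lia). rewrite Cmult_1_r. apply Cplus_0_l.
    + rewrite Lb0; try (apply nth_In; lia); [rewrite Cmult_0_r; apply Cplus_0_l|].
      intros EQ. apply NoDup_nth in EQ; auto; lia.
Qed.

(** The functionals give coordinates and independence at once; an element minus its expansion is
    killed by all of them, and they separate the space. No inner product is involved. *)
Lemma is_basis_biorthogonal : is_basis E (length l) (fun m => b (nth m l i0)).
Proof using i0 E0 Eplus Escal Hb Hl Lplus Lscal Lb Lb0 Linj.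
  split.
  - intros s; split.
    + intros Hs. set (c := fun m => coefficient (nth m l i0) s). exists c.
      set (s' := lincomb (length l) c (fun m => b (nth m l i0))).
      assert (Es' : E s') by (apply lincomb_E; lia).
      assert (Es'' : E (fun p => scal (RtoC (-1)) (s' p))) by now apply Escal.
      assert (H : forall p, plus (s p) (scal (RtoC (-1)) (s' p)) = zero).
      { apply (Linj (fun p => plus (s p) (scal (RtoC (-1)) (s' p)))); [now apply (Eplus s (fun p => scal (RtoC (-1)) (s' p)))|].
        intros i Hi. rewrite (Lplus i s (fun p => scal (RtoC (-1)) (s' p)) Hs Es''), Lscal by auto.
        destruct (In_nth l i i0 Hi) as [m [Hm <-]].
        unfold s'. rewrite coefficient_lincomb by lia.
        destruct (Nat.ltb_spec m (length l)); [|lia]. unfold c. ring. }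
      intros p. specialize (H p). fold s'.
      destruct (s p) as [[a1 a2] [b1 b2]], (s' p) as [[a1' a2'] [b1' b2']].
      injection H. simpl. intros H4 H3 H2 H1.
      apply (f_equal2 pair); apply (f_equal2 pair); lra.
    + intros [c Hc]. replace s with (lincomb (length l) c (fun m => b (nth m l i0))); [apply lincomb_E; lia|].
      extensionality p. now rewrite Hc.
  - intros c Hc m Hm.
    pose proof (coefficient_lincomb (length l) c m (Nat.le_refl _) Hm) as H.
    destruct (Nat.ltb_spec m (length l)); [|lia]. rewrite <- H.
    replace (lincomb (length l) c (fun m => b (nth m l i0))) with (fun _ : A => @zero (prod_AbelianMonoid C_AbelianMonoid C_AbelianMonoid)).
    + apply coefficient_zero.
    + extensionality p. symmetry. apply Hc.
Qed.
End Biorthogonal.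

Lemma C1_with_plus f g D G : C1_with f D -> C1_with g G ->
  C1_with (fun p => (f p + g p)%C) (fun v p => (D v p + G v p)%C).
Proof.
  intros [F1 [F2 F3]] [G1 [G2 G3]]. split; [|split].
  - intros p; now apply continuous_Cplus.
  - intros v p; now apply continuous_Cplus.
  - intros v p. exact (is_derive_plus (V := C_R_NormedModule) _ _ _ _ _ (F3 v p) (G3 v p)).
Qed.

Lemma C1_with_Cmult c f D : C1_with f D -> C1_with (fun p => (c * f p)%C) (fun v p => (c * D v p)%C).
Proof.
  intros [F1 [F2 F3]]. split; [|split].
  - intros p; apply (continuous_Cmult (fun _ => c) f); [apply continuous_const|apply F1].
  - intros v p; apply (continuous_Cmult (fun _ => c) (D v)); [apply continuous_const|apply F2].
  - intros v p. apply (is_derive_linear (V := C_R_NormedModule) (W := C_R_NormedModule) (Cmult c)); [apply is_linear_Cmult|apply F3].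
Qed.

Notation spinorM := (prod_NormedModule R_AbsRing C_R_NormedModule C_R_NormedModule).

Lemma is_Ck_fst {V : NormedModule R_AbsRing} k (s : V -> spinor) :
  is_Ck (W := spinorM) k s -> is_Ck (W := C_R_NormedModule) k (fun p => fst (s p)).
Proof. apply (is_Ck_linear_comp (W := spinorM) (W' := C_R_NormedModule) fst). apply is_linear_fst. Qed.

Lemma is_Ck_snd {V : NormedModule R_AbsRing} k (s : V -> spinor) :
  is_Ck (W := spinorM) k s -> is_Ck (W := C_R_NormedModule) k (fun p => snd (s p)).
Proof. apply (is_Ck_linear_comp (W := spinorM) (W' := C_R_NormedModule) snd). apply is_linear_snd. Qed.

Lemma is_Ck_spinor {V : NormedModule R_AbsRing} k (s : V -> spinor) :
  is_Ck (W := C_R_NormedModule) k (fun p => fst (s p)) ->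
  is_Ck (W := C_R_NormedModule) k (fun p => snd (s p)) -> is_Ck (W := spinorM) k s.
Proof.
  intros H1 H2. eapply is_Ck_ext; [|exact (is_Ck_pair (W := C_R_NormedModule) (W' := C_R_NormedModule) k _ _ H1 H2)].
  intros p; symmetry; exact (surjective_pairing (s p)).
Qed.

Lemma smooth_C1_with (s : heis -> spinor) : smooth s ->
  exists Du Dv, C1_with (fun p => fst (s p)) Du /\ C1_with (fun p => snd (s p)) Dv.
Proof.
  intros H. destruct (is_Ck_C1_with _ (is_Ck_fst 1 s (H 1%nat))) as [Du Hu].
  destruct (is_Ck_C1_with _ (is_Ck_snd 1 s (H 1%nat))) as [Dv Hv]. now exists Du, Dv.
Qed.

(** The operator is built from total derivatives that are additive only on differentiable sections,
    so the sum is computed from chosen derivatives of both summands. *)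
Lemma heis_eigenspace_plus r d1 d2 d3 d T mu s s' : d <> 0 -> T <> 0 ->
  heis_eigenspace r d1 d2 d3 d T mu s -> heis_eigenspace r d1 d2 d3 d T mu s' ->
  heis_eigenspace r d1 d2 d3 d T mu (fun p => plus (s p) (s' p)).
Proof.
  intros Hd HT [S1 [Q1 D1]] [S2 [Q2 D2]]. split; [|split].
  - intros k. exact (is_Ck_plus (W := spinorM) k s s' (S1 k) (S2 k)).
  - intros x y z p. rewrite Q1, Q2. symmetry. exact (scal_distr_l (K := C_AbsRing) _ _ _).
  - intros [[x y] z].
    destruct (smooth_C1_with s S1) as [Du [Dv [U V]]], (smooth_C1_with s' S2) as [Du' [Dv' [U' V']]].
    specialize (D1 (x, y, z)). specialize (D2 (x, y, z)).
    pose proof (heis_dirac_formula d T s Du Dv x y z Hd HT U V) as F1.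
    pose proof (heis_dirac_formula d T s' Du' Dv' x y z Hd HT U' V') as F2.
    pose proof (heis_dirac_formula d T (fun p => plus (s p) (s' p)) _ _ x y z Hd HT
      (C1_with_plus _ _ _ _ U U') (C1_with_plus _ _ _ _ V V')) as F3.
    cbv zeta in F1, F2, F3. 
    refine (eq_trans F3 _). 
    pose proof (eq_trans (eq_sym F1) D1) as G1. pose proof (eq_trans (eq_sym F2) D2) as G2.
    refine (eq_trans _ (eq_trans (f_equal2 plus G1 G2) (eq_sym (scal_distr_l (K := C_AbsRing) (RtoC mu) (s (x, y, z)) (s' (x, y, z)))))).
    clear. destruct (s (x, y, z)) as [a b], (s' (x, y, z)) as [a' b'].
    apply (f_equal2 pair).
    + change (snd (plus (a, b) (a', b'))) with (b + b')%C. change (fst (plus (a, b) (a', b'))) with (a + a')%C.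
      match goal with |- _ = plus ?X ?Y => change (plus X Y) with (X + Y)%C end. simpl fst. eqC; ring.
    + change (snd (plus (a, b) (a', b'))) with (b + b')%C.
      match goal with |- _ = plus ?X ?Y => change (plus X Y) with (X + Y)%C end. simpl snd. eqC; ring.
Qed.

Lemma heis_eigenspace_scal r d1 d2 d3 d T mu c s : d <> 0 -> T <> 0 ->
  heis_eigenspace r d1 d2 d3 d T mu s ->
  heis_eigenspace r d1 d2 d3 d T mu (fun p => scal c (s p)).
Proof.
  intros Hd HT [S1 [Q1 D1]]. split; [|split].
  - intros k. apply is_Ck_spinor.
    + exact (is_Ck_Cmult k c _ (is_Ck_fst k s (S1 k))).
    + exact (is_Ck_Cmult k c _ (is_Ck_snd k s (S1 k))).
  - intros x y z p. rewrite Q1. destruct (s p) as [u v].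
    set (e := RtoC (powerRZ d1 x * powerRZ d2 y * powerRZ d3 z)).
    change (((c * (e * u))%C, (c * (e * v))%C) = ((e * (c * u))%C, (e * (c * v))%C)).
    apply (f_equal2 pair); ring.
  - intros [[x y] z].
    destruct (smooth_C1_with s S1) as [Du [Dv [U V]]].
    specialize (D1 (x, y, z)).
    pose proof (heis_dirac_formula d T s Du Dv x y z Hd HT U V) as F1.
    pose proof (heis_dirac_formula d T (fun p => scal c (s p)) _ _ x y z Hd HT
      (C1_with_Cmult c _ _ U) (C1_with_Cmult c _ _ V)) as F3.
    cbv zeta in F1, F3. refine (eq_trans F3 _).
    pose proof (eq_trans (eq_sym F1) D1) as G1.
    destruct (s (x, y, z)) as [a b].
    pose proof (f_equal fst G1) as G2. pose proof (f_equal snd G1) as G3.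
    change (fst (scal (RtoC mu) (a, b))) with (RtoC mu * a)%C in G2.
    change (snd (scal (RtoC mu) (a, b))) with (RtoC mu * b)%C in G3.
    simpl fst in G2. simpl snd in G3.
    change (scal (RtoC mu) (scal c (a, b))) with ((RtoC mu * (c * a))%C, (RtoC mu * (c * b))%C).
    apply (f_equal2 pair).
    + change (fst (scal c (a, b))) with (c * a)%C.
      transitivity (c * (RtoC mu * a))%C; [rewrite <- G2|]; eqC; ring.
    + change (snd (scal c (a, b))) with (c * b)%C.
      transitivity (c * (RtoC mu * b))%C; [rewrite <- G3|]; eqC; ring.
Qed.

(** * Eigensections *)

Definition phase (e : R) : R := if Req_EM_T e 1 then 0 else 1 / 2.

Lemma phase_1 : phase 1 = 0.
Proof. unfold phase; destruct Req_EM_T; lra. Qed.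

Lemma phase_m1 : phase (-1) = 1 / 2.
Proof. unfold phase; destruct Req_EM_T; lra. Qed.

Lemma cis_phase e : e = 1 \/ e = -1 -> cis (2 * PI * phase e) = RtoC e.
Proof.
  intros [-> | ->].
  - rewrite phase_1, Rmult_0_r. apply cis_0.
  - rewrite phase_m1. replace (2 * PI * (1 / 2)) with PI by field. unfold cis. now rewrite cos_PI, sin_PI.
Qed.

Lemma cis_phase_Z e (m : Z) : e = 1 \/ e = -1 -> cis (2 * PI * (phase e + IZR m)) = RtoC e.
Proof.
  intros He. rewrite Rmult_plus_distr_l, cis_plus, cis_2PI_Z, Cmult_1_r. now apply cis_phase.
Qed.

Lemma phase_range e : 0 <= phase e <= 1 / 2.
Proof. unfold phase; destruct Req_EM_T; lra. Qed.

(* The absolute values of the nonzero vertical frequencies, increasing in t. *)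
Definition fibre_freq (d3 : R) (t : nat) : R := INR t + 1 - phase d3.

Lemma fibre_freq_ge d3 t : 1 / 2 <= fibre_freq d3 t.
Proof. unfold fibre_freq. pose proof (pos_INR t). pose proof (phase_range d3). lra. Qed.

(** Here the parity condition enters: for [d3 = -1] the fibre frequencies are half-integers and [r]
    is even. The integer [N] counts the independent theta series at this frequency. *)
Lemma fibre_freq_lattice r d3 t : (0 < r)%nat -> d3 = 1 \/ d3 = -1 -> (Nat.Odd r -> d3 = 1) ->
  exists N : nat, (0 < N)%nat /\ fibre_freq d3 t * INR r = INR N.
Proof.
  intros Hr [-> | ->] Ho; unfold fibre_freq.
  - exists ((t + 1) * r)%nat. split; [nia|]. rewrite phase_1, mult_INR, plus_INR. simpl; ring.
  - destruct (Nat.Even_or_Odd r) as [[m Hm]|HO]; [|specialize (Ho HO); lra].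
    exists ((2 * t + 1) * m)%nat. split; [nia|]. rewrite phase_m1, Hm, !mult_INR, plus_INR, mult_INR. simpl; field.
Qed.

Definition sgR (b : bool) : R := if b then 1 else -1.

Lemma sgR_sqr b : sgR b * sgR b = 1.
Proof. destruct b; simpl; ring. Qed.

Definition sgZ (k : Z) : R := if Z.leb 0 k then 1 else -1.

Lemma sgZ_sqr k : sgZ k * sgZ k = 1.
Proof. unfold sgZ; destruct Z.leb; ring. Qed.

(* [Torus m n b] is the point of the dual lattice numbered by [m, n] together with the sign
   of the eigenvalue.  [Osc sg t i k] has the fibre frequency [sgR sg * fibre_freq d3 t], the
   Hermite level [Z.abs_nat k] and an eigenvalue with the sign of [k] (positive at level 0);
   [i] counts the multiplicity. *)
Inductive index : Type :=
  | Torus (m n : Z) (b : bool)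
  | Osc (sg : bool) (t i : nat) (k : Z).

Definition torus_al (r : nat) (d1 : R) (m : Z) : R := (phase d1 + IZR m) / INR r.
Definition torus_be (d2 : R) (n : Z) : R := phase d2 + IZR n.

Definition index_shift (r : nat) (d1 d2 d3 d : R) (j : index) (T : R) : R :=
  match j with
  | Torus m n b => sgR b * (2 * PI * d * sqrt (torus_al r d1 m ^ 2 + torus_be d2 n ^ 2))
  | Osc _ t _ k => sgZ k * sqrt ((2 * PI * fibre_freq d3 t / T) ^ 2 + 4 * PI * d ^ 2 * fibre_freq d3 t * INR (Z.abs_nat k))
  end.

(** The frequencies in [y] matter only modulo [fibre_freq d3 t * INR r], an integer, and [i] runs
    through its residues. *)
Definition index_valid (r : nat) (d3 : R) (j : index) : Prop :=
  match j with
  | Torus _ _ _ => d3 = 1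
  | Osc _ t i _ => INR i < fibre_freq d3 t * INR r
  end.

(** The component at the higher Hermite level is the second one for positive fibre frequency and the
    first one for negative frequency. *)
Definition place (b : bool) (p q : C) : spinor := if b then (q, p) else (p, q).

Definition osc_theta (r : nat) (d1 d2 d3 : R) (sg : bool) (t i : nat) : nat -> heis -> C :=
  theta (INR r) (2 * PI * fibre_freq d3 t) (sgR sg) (phase d2 + INR i) (sgR sg * fibre_freq d3 t) d1 0.

Definition character (al be : R) (p : heis) : C :=
  let '(x, y, _) := p in cis (2 * PI * (al * x + be * y)).

(** The symbol [2 pi d (al - i be)]: on the character of frequency [(al, be)] the torus part of the
    operator is off-diagonal with entries [zeta] and its conjugate. *)
Definition zeta (d al be : R) : C := (2 * PI * d * al, - (2 * PI * d * be)).

(** For a torus index with nonzero shift the second component is normalized to the character, and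
    the functionals read it there. At shift 0 the symbol vanishes and both constant vectors are
    solutions, so [b] selects the component. At Hermite level 0 the coefficient of the meaningless
    [pred 0] term is zero. *)
Definition index_section (r : nat) (d1 d2 d3 d : R) (j : index) (T : R) (p : heis) : spinor :=
  let nu := index_shift r d1 d2 d3 d j T in
  match j with
  | Torus m n b =>
      let e := character (torus_al r d1 m) (torus_be d2 n) p in
      if Req_EM_T nu 0 then place (negb b) e (RtoC 0)
      else ((zeta d (torus_al r d1 m) (torus_be d2 n) * / RtoC nu * e)%C, e)
  | Osc sg t i k =>
      place sg (osc_theta r d1 d2 d3 sg t i (Z.abs_nat k) p)
        (Ci * RtoC ((nu - 2 * PI * fibre_freq d3 t / T) / d) *
         osc_theta r d1 d2 d3 sg t i (pred (Z.abs_nat k)) p)%C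
  end.

Lemma continuous_theta_dir L a be tau v (G : nat -> nat -> heis -> C) n k p :
  (forall n k, continuous (G n k) p) ->
  continuous (fun p => theta_dir L a be tau v (fun n k => G n k p) n k) p.
Proof.
  intros H. destruct v as [[v1 v2] v3]. unfold theta_dir.
  assert (CC : forall c n k, continuous (fun p => (c * G n k p)%C) p).
  { intros c n' k'. apply (continuous_Cmult (fun _ => c) (G n' k')); [apply continuous_const|apply H]. }
  apply continuous_Cplus; [apply CC|]. apply continuous_Cplus; [apply CC|].
  apply continuous_Cplus; apply CC.
Qed.

Lemma theta_C1_with L a sg be tau d1 n k : 0 < L -> 0 < a -> d1 = 1 \/ d1 = -1 ->
  C1_with (theta L a sg be tau d1 n k)
    (fun v p => theta_dir L a be tau v (fun n k => theta L a sg be tau d1 n k p) n k).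
Proof.
  intros HL Ha Hd1. split; [|split].
  - intros p; now apply theta_continuous.
  - intros v p. apply continuous_theta_dir. intros; now apply theta_continuous.
  - intros v p. now apply theta_derive.
Qed.

Lemma theta_dir_frameX L a be tau (G : nat -> nat -> C) d k :
  theta_dir L a be tau (frameX d) G 0 k =
  (RtoC (- d) * (RtoC (1 / 2) * G 0%nat (S k) - RtoC (a * INR k) * G 0%nat (pred k)))%C.
Proof. unfold theta_dir, frameX. apply Ceq; unfold Re, Im; simpl; field. Qed.

Lemma theta_dir_frameZ L a be tau (G : nat -> nat -> C) T k :
  theta_dir L a be tau (frameZ T) G 0 k = (Ci * RtoC (2 * PI * tau / T) * G 0%nat k)%C.
Proof. unfold theta_dir, frameZ, Rdiv. apply Ceq; unfold Re, Im; simpl; ring. Qed.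

Lemma theta_dir_frameY L a sg be tau d1 d k x y z :
  0 < L -> 0 < a -> sg * sg = 1 -> a = 2 * PI * (sg * tau) -> d1 = 1 \/ d1 = -1 ->
  theta_dir L a be tau (frameY d x) (fun n k => theta L a sg be tau d1 n k (x, y, z)) 0 k =
  (RtoC d * (Ci * RtoC sg) * (RtoC (1 / 2) * theta L a sg be tau d1 0 (S k) (x, y, z) +
     RtoC (a * INR k) * theta L a sg be tau d1 0 (pred k) (x, y, z)))%C.
Proof.
  intros HL Ha Hsg Hat Hd1.
  transitivity (RtoC (- d) * theta_dir L a be tau (0, 1, x) (fun n k => theta L a sg be tau d1 n k (x, y, z)) 0 k)%C.
  - unfold theta_dir, frameY, Rdiv. apply Ceq; unfold Re, Im; simpl; ring.
  - rewrite (theta_dirY L a sg be tau d1 HL Ha Hsg Hat Hd1). apply Ceq; unfold Re, Im; simpl; ring.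
Qed.

Lemma osc_algebra_q sg (P B : C) (d aK g om nu : R) : sg * sg = 1 -> 2 * d * aK = (nu + om) * g ->
  (Ci * (RtoC (- d) * (RtoC (1 / 2) * P - RtoC aK * B)) +
   RtoC sg * (RtoC d * (Ci * RtoC sg) * (RtoC (1 / 2) * P + RtoC aK * B)) +
   RtoC sg * (Ci * (Ci * RtoC g * (Ci * RtoC (sg * om) * B))) = RtoC nu * (Ci * RtoC g * B))%C.
Proof.
  intros Hs H. destruct P as [P1 P2], B as [B1 B2].
  pose proof (f_equal (Rmult B1) H) as E1. pose proof (f_equal (Rmult B2) H) as E2.
  assert (E : forall X, sg * (sg * X) = X) by (intros; rewrite <- Rmult_assoc, Hs; ring).
  pose proof (E (d * P1)). pose proof (E (d * P2)). pose proof (E (d * aK * B1)). pose proof (E (d * aK * B2)).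
  pose proof (E (g * om * B1)). pose proof (E (g * om * B2)).
  apply Ceq; unfold Re, Im; simpl; lra.
Qed.

(** The hypothesis comparing [P] and [A] is multiplied by [g] to cover level 0: there [S (pred K)]
    differs from [K], but [g = 0]. *)
Lemma osc_algebra_p sg (P Q A : C) (d aK g om nu : R) : sg * sg = 1 -> d * g = nu - om ->
  (RtoC g * P = RtoC g * A)%C ->
  (Ci * (Ci * RtoC g * (RtoC (- d) * (RtoC (1 / 2) * P - RtoC aK * Q))) +
   - (RtoC sg * (Ci * RtoC g * (RtoC d * (Ci * RtoC sg) * (RtoC (1 / 2) * P + RtoC aK * Q)))) +
   - (RtoC sg * (Ci * (Ci * RtoC (sg * om) * A))) = RtoC nu * A)%C.
Proof.
  intros Hs H HP. destruct P as [P1 P2], Q as [Q1 Q2], A as [A1 A2].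
  pose proof (f_equal (Rmult A1) H) as E1. pose proof (f_equal (Rmult A2) H) as E2.
  pose proof (f_equal (fun z => d * Re z) HP) as F1. pose proof (f_equal (fun z => d * Im z) HP) as F2.
  unfold Re, Im in F1, F2; simpl in F1, F2.
  assert (E : forall X, sg * (sg * X) = X) by (intros; rewrite <- Rmult_assoc, Hs; ring).
  pose proof (E (d * g * P1)). pose proof (E (d * g * P2)). pose proof (E (d * aK * g * Q1)). pose proof (E (d * aK * g * Q2)).
  pose proof (E (om * A1)). pose proof (E (om * A2)).
  apply Ceq; unfold Re, Im; simpl; lra.
Qed.

(** * The explicit sections satisfy the eigenvalue equation *)

Section Sections.
Context (r : nat) (d1 d2 d3 d T : R).
Context (Hr : (0 < r)%nat) (Hd : 0 < d) (HT : 0 < T) (H1 : d1 = 1 \/ d1 = -1)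
  (H2 : d2 = 1 \/ d2 = -1) (H3 : d3 = 1 \/ d3 = -1) (Hodd : Nat.Odd r -> d3 = 1).

Lemma INR_r_pos : 0 < INR r.
Proof using Hr. now apply lt_0_INR. Qed.

Lemma osc_a_pos t : 0 < 2 * PI * fibre_freq d3 t.
Proof using. pose proof PI_RGT_0. pose proof (fibre_freq_ge d3 t). nra. Qed.

Lemma osc_shift_sqr sg t i k :
  let nu := index_shift r d1 d2 d3 d (Osc sg t i k) T in
  nu ^ 2 = (2 * PI * fibre_freq d3 t / T) ^ 2 + 2 * (2 * PI * fibre_freq d3 t) * INR (Z.abs_nat k) * d ^ 2.
Proof using Hd HT.
  simpl. set (X := _ + _). assert (HX : 0 <= X).
  { pose proof (fibre_freq_ge d3 t). pose proof PI_RGT_0. pose proof (pos_INR (Z.abs_nat k)).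
    pose proof (pow2_ge_0 d).
    unfold X. apply Rplus_le_le_0_compat; [|apply Rmult_le_pos; [apply Rmult_le_pos; [nra|lra]|lra]].
    simpl. rewrite Rmult_1_r. apply Rle_0_sqr. }
  transitivity ((sgZ k * sgZ k) * (sqrt X * sqrt X)); [ring|].
  rewrite sgZ_sqr, sqrt_sqrt by auto. unfold X. simpl; ring.
Qed.

Lemma osc_shift_0 sg t i : index_shift r d1 d2 d3 d (Osc sg t i 0) T = 2 * PI * fibre_freq d3 t / T.
Proof using HT.
  simpl. unfold sgZ; simpl. rewrite Rmult_0_r, Rplus_0_r, Rmult_1_l.
  replace (_ * (_ * 1)) with ((2 * PI * fibre_freq d3 t / T) ^ 2) by (simpl; ring).
  apply sqrt_pow2. pose proof (fibre_freq_ge d3 t). pose proof PI_RGT_0. apply Rdiv_le_0_compat; nra.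
Qed.

Lemma osc_theta_smooth sg t i k : smooth (W := C_R_NormedModule) (osc_theta r d1 d2 d3 sg t i k).
Proof using Hr H1. apply theta_smooth; auto using INR_r_pos, osc_a_pos. Qed.

Lemma smooth_Cmult (c : C) (f : heis -> C) : smooth (W := C_R_NormedModule) f ->
  smooth (W := C_R_NormedModule) (fun p => c * f p)%C.
Proof using. intros H k; apply is_Ck_Cmult, H. Qed.

Lemma smooth_spinor (f g : heis -> C) : smooth (W := C_R_NormedModule) f ->
  smooth (W := C_R_NormedModule) g -> smooth (fun p => (f p, g p) : spinor).
Proof using. intros Hf Hg k. exact (is_Ck_pair (W := C_R_NormedModule) (W' := C_R_NormedModule) k f g (Hf k) (Hg k)). Qed.

Lemma osc_theta_equivariant sg t i k x y z p :
  osc_theta r d1 d2 d3 sg t i k (heis_mul (INR r * IZR x, IZR y, IZR z) p) =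
  (RtoC (powerRZ d1 x * powerRZ d2 y * powerRZ d3 z) * osc_theta r d1 d2 d3 sg t i k p)%C.
Proof using Hr H1 H2 H3 Hodd.
  destruct (fibre_freq_lattice r d3 t Hr H3 Hodd) as [N [HN EN]].
  apply (theta_equivariant _ _ _ _ _ _ INR_r_pos (osc_a_pos t) H1 (if sg then Z.of_nat N else - Z.of_nat N)%Z).
  - destruct sg; unfold sgR; rewrite ?opp_IZR, <- INR_IZR_INZ, <- EN; ring.
  - destruct H2; lra.
  - destruct H3; lra.
  - rewrite INR_IZR_INZ. now apply cis_phase_Z.
  - destruct sg; unfold sgR, fibre_freq.
    + replace (1 * (INR t + 1 - phase d3)) with (- phase d3 + IZR (Z.of_nat t + 1)) by (rewrite plus_IZR, <- INR_IZR_INZ; ring).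
      destruct H3 as [-> | ->].
      * rewrite phase_1. replace (-0) with (phase 1) by (rewrite phase_1; ring). apply cis_phase_Z; auto.
      * rewrite phase_m1. replace (- (1 / 2) + IZR (Z.of_nat t + 1)) with (phase (-1) + IZR (Z.of_nat t)) by (rewrite phase_m1, plus_IZR; field).
        apply cis_phase_Z; auto.
    + replace (-1 * (INR t + 1 - phase d3)) with (phase d3 + IZR (- Z.of_nat t - 1)) by (rewrite minus_IZR, opp_IZR, <- INR_IZR_INZ; ring).
      now apply cis_phase_Z.
Qed.

Lemma osc_section_eigen sg t i k :
  heis_eigenspace r d1 d2 d3 d T (dirac_shift d T + index_shift r d1 d2 d3 d (Osc sg t i k) T)
    (index_section r d1 d2 d3 d (Osc sg t i k) T).
Proof using Hr Hd HT H1 H2 H3 Hodd.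
  set (nu := index_shift r d1 d2 d3 d (Osc sg t i k) T).
  set (om := 2 * PI * fibre_freq d3 t / T). set (g := (nu - om) / d). set (K := Z.abs_nat k).
  set (a := 2 * PI * fibre_freq d3 t).
  assert (Hg : d * g = nu - om) by (unfold g; field; lra).
  assert (Hnu : 2 * d * (a * INR K) = (nu + om) * g).
  { pose proof (osc_shift_sqr sg t i k) as E. cbv zeta in E. fold nu om K a in E.
    apply Rmult_eq_reg_l with d; [|lra].
    replace (d * ((nu + om) * g)) with ((nu + om) * (d * g)) by ring. rewrite Hg.
    replace ((nu + om) * (nu - om)) with (nu ^ 2 - om ^ 2) by ring. rewrite E. ring. }
  (* At level 0 the index carries the positive sign, so [nu = om]; the opposite sign would leave a
     spurious lower component. *)
  assert (HK0 : K = 0%nat -> g = 0).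
  { intros HK. assert (k = 0%Z) by (unfold K in HK; lia). subst k.
    unfold g, nu. rewrite osc_shift_0. fold om. unfold Rdiv; ring. }
  assert (Hom : 2 * PI * (sgR sg * fibre_freq d3 t) / T = sgR sg * om) by (unfold om, Rdiv; ring).
  assert (Hat : a = 2 * PI * (sgR sg * (sgR sg * fibre_freq d3 t))).
  { transitivity (2 * PI * ((sgR sg * sgR sg) * fibre_freq d3 t)); [rewrite sgR_sqr; unfold a; ring|ring]. }
  pose proof (theta_C1_with (INR r) a (sgR sg) (phase d2 + INR i) (sgR sg * fibre_freq d3 t) d1 0 K INR_r_pos (osc_a_pos t) H1) as CA.
  pose proof (C1_with_Cmult (Ci * RtoC g) _ _
    (theta_C1_with (INR r) a (sgR sg) (phase d2 + INR i) (sgR sg * fibre_freq d3 t) d1 0 (pred K) INR_r_pos (osc_a_pos t) H1)) as CB.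
  split; [|split].
  - unfold index_section. fold nu. destruct sg; simpl place.
    + apply smooth_spinor; [apply smooth_Cmult|]; apply osc_theta_smooth.
    + apply smooth_spinor; [|apply smooth_Cmult]; apply osc_theta_smooth.
  - intros x y z p. unfold index_section. fold nu. rewrite !osc_theta_equivariant.
    destruct sg; apply (f_equal2 pair); eqC; try reflexivity;
      match goal with |- _ = scal ?X ?Y => change (scal X Y) with (X * Y)%C end; unfold fst, snd; simpl; ring.
  - intros [[x y] z].
    assert (FY : forall k, _) by exact (fun k => theta_dir_frameY (INR r) a (sgR sg) (phase d2 + INR i) (sgR sg * fibre_freq d3 t) d1 d k x y z
      INR_r_pos (osc_a_pos t) (sgR_sqr sg) Hat H1).
    set (Th := fun n k => theta (INR r) a (sgR sg) (phase d2 + INR i) (sgR sg * fibre_freq d3 t) d1 n k (x, y, z)) in *.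
    assert (HPA : (RtoC g * Th 0%nat (S (pred K)) = RtoC g * Th 0%nat K)%C).
    { destruct K as [|K']; [rewrite (HK0 eq_refl); ring|reflexivity]. }
    pose proof (osc_algebra_q (sgR sg) (Th 0%nat (S K)) (Th 0%nat (pred K)) d (a * INR K) g om nu (sgR_sqr sg) Hnu) as AQ.
    pose proof (osc_algebra_p (sgR sg) (Th 0%nat (S (pred K))) (Th 0%nat (pred (pred K))) (Th 0%nat K) d
      (a * INR (pred K)) g om nu (sgR_sqr sg) Hg HPA) as AP.
    set (c := dirac_shift d T).
    assert (SC : forall z : C, (RtoC (c + nu) * z = RtoC nu * z + RtoC c * z)%C) by (intros; rewrite RtoC_plus; ring).
    destruct sg; simpl sgR in *.
    + refine (eq_trans (heis_dirac_formula d T (index_section r d1 d2 d3 d (Osc true t i k) T) _ _ x y z ltac:(lra) ltac:(lra) CB CA) _).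
      rewrite !theta_dir_frameX, !FY, !theta_dir_frameZ, !Hom.
      refine (eq_trans _ (f_equal2 pair (eq_sym (SC (Ci * RtoC g * Th 0%nat (pred K))%C)) (eq_sym (SC (Th 0%nat K))))).
      rewrite <- AQ, <- AP. fold c.
      change (fst (index_section r d1 d2 d3 d (Osc true t i k) T (x, y, z))) with (Ci * RtoC g * Th 0%nat (pred K))%C.
      change (snd (index_section r d1 d2 d3 d (Osc true t i k) T (x, y, z))) with (Th 0%nat K).
      unfold Th. apply (f_equal2 pair); ring.
    + refine (eq_trans (heis_dirac_formula d T (index_section r d1 d2 d3 d (Osc false t i k) T) _ _ x y z ltac:(lra) ltac:(lra) CA CB) _).
      rewrite !theta_dir_frameX, !FY, !theta_dir_frameZ, !Hom.
      refine (eq_trans _ (f_equal2 pair (eq_sym (SC (Th 0%nat K))) (eq_sym (SC (Ci * RtoC g * Th 0%nat (pred K))%C)))).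
      rewrite <- AQ, <- AP. fold c.
      change (snd (index_section r d1 d2 d3 d (Osc false t i k) T (x, y, z))) with (Ci * RtoC g * Th 0%nat (pred K))%C.
      change (fst (index_section r d1 d2 d3 d (Osc false t i k) T (x, y, z))) with (Th 0%nat K).
      unfold Th. apply (f_equal2 pair); ring.
Qed.

Lemma character_derive al be v p :
  is_derive (fun t : R => character al be (plus p (scal t v))) 0
    (Ci * RtoC (2 * PI * (al * fst (fst v) + be * snd (fst v))) * character al be p)%C.
Proof using.
  destruct p as [[x y] z], v as [[v1 v2] v3].
  change (is_derive (fun t : R => cis (2 * PI * (al * (x + t * v1) + be * (y + t * v2)))) 0
    (Ci * RtoC (2 * PI * (al * v1 + be * v2)) * cis (2 * PI * (al * x + be * y)))%C).
  evar_last.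
  - apply (is_derive_cis (fun t => 2 * PI * (al * (x + t * v1) + be * (y + t * v2))) 0
     (2 * PI * (al * v1 + be * v2))). auto_derive; auto; eqR; ring.
  - cbv beta. now rewrite !Rmult_0_l, !Rplus_0_r.
Qed.

Lemma character_continuous al be p : continuous (character al be) p.
Proof using.
  apply (continuous_ext (fun p : heis => cis (2 * PI * (al * fst (fst p) + be * snd (fst p))))).
  { intros [[x y] z]; reflexivity. }
  apply continuous_cis. apply continuous_Rmult; [apply continuous_const|].
  apply continuous_Rplus; apply continuous_Rmult;
    first [apply continuous_const|apply continuous_heis_x|apply continuous_heis_y].
Qed.

Lemma character_smooth al be : smooth (W := C_R_NormedModule) (character al be).
Proof using.
  intros k; induction k as [|k IH]; (split; [apply character_continuous|auto]).
  intros v. eexists; split; [intros p; apply character_derive|]. apply is_Ck_Cmult, IH.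
Qed.

Lemma character_C1_with al be :
  C1_with (character al be) (fun v p => Ci * RtoC (2 * PI * (al * fst (fst v) + be * snd (fst v))) * character al be p)%C.
Proof using.
  split; [|split].
  - intros p; apply character_continuous.
  - intros v p. apply (continuous_Cmult (fun _ => _) (character al be)); [apply continuous_const|apply character_continuous].
  - intros v p; apply character_derive.
Qed.

Lemma character_equivariant m n x y z p : d3 = 1 ->
  character (torus_al r d1 m) (torus_be d2 n) (heis_mul (INR r * IZR x, IZR y, IZR z) p) =
  (RtoC (powerRZ d1 x * powerRZ d2 y * powerRZ d3 z) * character (torus_al r d1 m) (torus_be d2 n) p)%C.
Proof using Hr H1 H2.
  intros H3'. destruct p as [[x' y'] z']. unfold character, heis_mul.
  replace (2 * PI * (torus_al r d1 m * (INR r * IZR x + x') + torus_be d2 n * (IZR y + y'))) with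
    (2 * PI * (phase d1 + IZR m) * IZR x + (2 * PI * torus_be d2 n * IZR y + 2 * PI * (torus_al r d1 m * x' + torus_be d2 n * y'))).
  2:{ unfold torus_al. field. pose proof INR_r_pos; lra. }
  rewrite !cis_plus, (cis_powerRZ _ d1), (cis_powerRZ _ d2); try (destruct H1, H2; lra); try now apply cis_phase_Z.
  rewrite H3', powerRZ_R1, Rmult_1_r, RtoC_mult. ring.
Qed.

Lemma zeta_norm al be : (zeta d al be * (RtoC (2 * PI * d * al) + Ci * RtoC (2 * PI * d * be)))%C =
  RtoC ((2 * PI * d * sqrt (al ^ 2 + be ^ 2)) ^ 2).
Proof using.
  assert (E : sqrt (al ^ 2 + be ^ 2) ^ 2 = al ^ 2 + be ^ 2).
  { apply pow2_sqrt. pose proof (pow2_ge_0 al); pose proof (pow2_ge_0 be); lra. }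
  rewrite Rpow_mult_distr, E. apply Ceq; unfold zeta, Re, Im; simpl; ring.
Qed.

Lemma torus_section_eigen m n b : d3 = 1 ->
  heis_eigenspace r d1 d2 d3 d T (dirac_shift d T + index_shift r d1 d2 d3 d (Torus m n b) T)
    (index_section r d1 d2 d3 d (Torus m n b) T).
Proof using Hr Hd HT H1 H2.
  intros H3'.
  set (al := torus_al r d1 m). set (be := torus_be d2 n). set (nu := index_shift r d1 d2 d3 d (Torus m n b) T).
  assert (EX : exists cu cv, index_section r d1 d2 d3 d (Torus m n b) T =
     (fun p => ((cu * character al be p)%C, (cv * character al be p)%C)) /\
     (zeta d al be * cv = RtoC nu * cu)%C /\
     ((RtoC (2 * PI * d * al) + Ci * RtoC (2 * PI * d * be)) * cu = RtoC nu * cv)%C).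
  { assert (Hnu2 : nu ^ 2 = (2 * PI * d * sqrt (al ^ 2 + be ^ 2)) ^ 2).
    { unfold nu, index_shift. fold al be. destruct b; simpl sgR; ring. }
    unfold index_section. fold nu al be. destruct (Req_EM_T nu 0) as [H0|H0].
    - assert (Hz : al = 0 /\ be = 0).
      { rewrite H0 in Hnu2. 
        assert (E : sqrt (al ^ 2 + be ^ 2) ^ 2 = al ^ 2 + be ^ 2).
        { apply pow2_sqrt. pose proof (pow2_ge_0 al); pose proof (pow2_ge_0 be); lra. }
        rewrite Rpow_mult_distr, E in Hnu2. pose proof PI_RGT_0.
        assert (0 < (2 * PI * d) ^ 2) by (apply pow_lt; nra).
        pose proof (pow2_ge_0 al); pose proof (pow2_ge_0 be). split; apply Rsqr_0_uniq; unfold Rsqr; nra. }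
      destruct Hz as [Ha Hb]. unfold zeta. rewrite H0, Ha, Hb.
      destruct b; simpl.
      + exists (RtoC 1), (RtoC 0). split; [|split].
        * extensionality p. apply (f_equal2 pair); eqC; ring.
        * apply Ceq; unfold Re, Im; simpl; ring.
        * apply Ceq; unfold Re, Im; simpl; ring.
      + exists (RtoC 0), (RtoC 1). split; [|split].
        * extensionality p. apply (f_equal2 pair); eqC; ring.
        * apply Ceq; unfold Re, Im; simpl; ring.
        * apply Ceq; unfold Re, Im; simpl; ring.
    - assert (Hn0 : RtoC nu <> RtoC 0) by (intros E; apply H0; now apply RtoC_inj).
      exists (zeta d al be * / RtoC nu)%C, (RtoC 1). split; [|split].
      + extensionality p. apply (f_equal2 pair); eqC; ring.
      + field; auto.
      + rewrite Cmult_assoc, (Cmult_comm _ (zeta d al be)), zeta_norm, <- Hnu2.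
        replace (nu ^ 2) with (nu * nu) by ring. rewrite RtoC_mult. field; auto. }
  destruct EX as [cu [cv [-> [Q1 Q2]]]].
  split; [|split].
  - apply smooth_spinor; apply smooth_Cmult, character_smooth.
  - intros x y z p. pose proof (character_equivariant m n x y z p H3') as Q. fold al be in Q. rewrite Q.
    set (e := RtoC _). 
    change (((cu * (e * character al be p))%C, (cv * (e * character al be p))%C) =
      ((e * (cu * character al be p))%C, (e * (cv * character al be p))%C)).
    apply (f_equal2 pair); ring.
  - intros [[x y] z].
    refine (eq_trans (heis_dirac_formula d T (fun p => ((cu * character al be p)%C, (cv * character al be p)%C)) _ _ x y z ltac:(lra) ltac:(lra)
      (C1_with_Cmult cu _ _ (character_C1_with al be)) (C1_with_Cmult cv _ _ (character_C1_with al be))) _).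
    generalize (character al be (x, y, z)). intros e. unfold fst, snd, frameX, frameY, frameZ.
    set (c := dirac_shift d T).
    change (scal (RtoC (c + nu)) ((cu * e)%C, (cv * e)%C)) with ((RtoC (c + nu) * (cu * e))%C, (RtoC (c + nu) * (cv * e))%C).
    apply (f_equal2 pair).
    + transitivity (RtoC c * (cu * e) + (RtoC nu * cu) * e)%C; [|rewrite RtoC_plus; ring].
      rewrite <- Q1. apply Ceq; unfold zeta, Re, Im; simpl; ring.
    + transitivity (RtoC c * (cv * e) + (RtoC nu * cv) * e)%C; [|rewrite RtoC_plus; ring].
      rewrite <- Q2. apply Ceq; unfold zeta, Re, Im; simpl; ring.
Qed.

Lemma index_section_eigen j : index_valid r d3 j ->
  heis_eigenspace r d1 d2 d3 d T (dirac_shift d T + index_shift r d1 d2 d3 d j T) (index_section r d1 d2 d3 d j T).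
Proof using Hr Hd HT H1 H2 H3 Hodd.
  destruct j as [m n b|sg t i k]; intros Hv; [now apply torus_section_eigen|now apply osc_section_eigen].
Qed.
End Sections.

(** * Completeness of the eigensections *)

Section ModeODE.
Context (a b A B : R) (p q : R -> C) (Ha : 0 < a)
  (Dp : forall x, is_derive p x (RtoC (- (a * x + b)) * p x + Ci * RtoC A * q x)%C)
  (Dq : forall x, is_derive q x (RtoC (a * x + b) * q x + Ci * RtoC B * p x)%C)
  (Bp : exists M, forall x, Cmod (p x) <= M) (Bq : exists M, forall x, Cmod (q x) <= M).

Lemma is_derive_affine x : is_derive (fun x => a * x + b) x a.
Proof using. auto_derive; auto; eqR; ring. Qed.

Lemma mode_components x :
  is_derive (fun x => Re (p x)) x (- ((a * x + b) * Re (p x)) - A * Im (q x)) /\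
  is_derive (fun x => Im (p x)) x (- ((a * x + b) * Im (p x)) + A * Re (q x)) /\
  is_derive (fun x => Re (q x)) x ((a * x + b) * Re (q x) - B * Im (p x)) /\
  is_derive (fun x => Im (q x)) x ((a * x + b) * Im (q x) + B * Re (p x)).
Proof using Dp Dq.
  pose proof (is_derive_Re _ _ _ (Dp x)) as E1. pose proof (is_derive_Im _ _ _ (Dp x)) as E2.
  pose proof (is_derive_Re _ _ _ (Dq x)) as E3. pose proof (is_derive_Im _ _ _ (Dq x)) as E4.
  split; [|split; [|split]].
  - evar_last; [exact E1|]. unfold Re, Im; simpl. eqR; ring.
  - evar_last; [exact E2|]. unfold Re, Im; simpl. eqR; ring.
  - evar_last; [exact E3|]. unfold Re, Im; simpl. eqR; ring.
  - evar_last; [exact E4|]. unfold Re, Im; simpl. eqR; ring.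
Qed.

(** Eliminating [q] gives the oscillator with parameter [A * B]. Real and imaginary parts are
    separated because the oscillator is treated over the reals. *)
Lemma oscillator_Re_p : oscillator a b (A * B) (fun x => Re (p x)) (fun x => - ((a * x + b) * Re (p x)) - A * Im (q x)).
Proof using Dp Dq.
  split; intros x; destruct (mode_components x) as [E1 [E2 [E3 E4]]]; [exact E1|].
  evar_last.
  - apply is_derive_Rminus; [apply is_derive_Ropp, is_derive_Rmult; [apply is_derive_affine|exact E1]|apply is_derive_scal, E4].
  - eqR; ring.
Qed.

Lemma oscillator_Im_p : oscillator a b (A * B) (fun x => Im (p x)) (fun x => - ((a * x + b) * Im (p x)) + A * Re (q x)).
Proof using Dp Dq.
  split; intros x; destruct (mode_components x) as [E1 [E2 [E3 E4]]]; [exact E2|].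
  evar_last.
  - apply is_derive_Rplus; [apply is_derive_Ropp, is_derive_Rmult; [apply is_derive_affine|exact E2]|apply is_derive_scal, E3].
  - eqR; ring.
Qed.

(** Eliminating [p] instead gives the parameter one level lower, the usual pairing of neighbouring
    levels by a Dirac operator. *)
Lemma oscillator_Re_q : oscillator a b (A * B - 2 * a) (fun x => Re (q x)) (fun x => (a * x + b) * Re (q x) - B * Im (p x)).
Proof using Dp Dq.
  split; intros x; destruct (mode_components x) as [E1 [E2 [E3 E4]]]; [exact E3|].
  evar_last.
  - apply is_derive_Rminus; [apply is_derive_Rmult; [apply is_derive_affine|exact E3]|apply is_derive_scal, E2].
  - eqR; ring.
Qed.

Lemma oscillator_Im_q : oscillator a b (A * B - 2 * a) (fun x => Im (q x)) (fun x => (a * x + b) * Im (q x) + B * Re (p x)).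
Proof using Dp Dq.
  split; intros x; destruct (mode_components x) as [E1 [E2 [E3 E4]]]; [exact E4|].
  evar_last.
  - apply is_derive_Rplus; [apply is_derive_Rmult; [apply is_derive_affine|exact E4]|apply is_derive_scal, E1].
  - eqR; ring.
Qed.

Lemma poly_bounded_Re (f : R -> C) : (exists M, forall x, Cmod (f x) <= M) -> poly_bounded (fun x => Re (f x)).
Proof using. intros [M H]. exists M, 0%nat. intros x. simpl. rewrite Rmult_1_r. eapply Rle_trans; [apply Rabs_Re_le|apply H]. Qed.

Lemma poly_bounded_Im (f : R -> C) : (exists M, forall x, Cmod (f x) <= M) -> poly_bounded (fun x => Im (f x)).
Proof using. intros [M H]. exists M, 0%nat. intros x. simpl. rewrite Rmult_1_r. eapply Rle_trans; [apply Rabs_Im_le|apply H]. Qed.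

(** For [A] nonzero the first equation returns [q]. For [A * B = 0] the equation for [q] has
    parameter [- 2 a], below the spectrum. *)
Lemma mode_q_zero_of_p : (forall x, p x = RtoC 0) -> A * B = 0 \/ A <> 0 -> forall x, q x = RtoC 0.
Proof using Ha Dp Dq Bq.
  intros Hp [H|H] x.
  - assert (HL : A * B - 2 * a < - a) by lra. apply Ceq.
    + exact (oscillator_neg a b _ _ _ HL oscillator_Re_q (poly_bounded_Re _ Bq) x).
    + exact (oscillator_neg a b _ _ _ HL oscillator_Im_q (poly_bounded_Im _ Bq) x).
  - pose proof (is_derive_zero_fun _ _ x (proj1 oscillator_Re_p) ltac:(intros y; cbv beta; now rewrite Hp)) as E1.
    pose proof (is_derive_zero_fun _ _ x (proj1 oscillator_Im_p) ltac:(intros y; cbv beta; now rewrite Hp)) as E2.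
    cbv beta in E1, E2. rewrite Hp in E1, E2. simpl in E1, E2.
    apply Ceq; apply Rmult_eq_reg_l with A; auto; unfold Re, Im in *; simpl in *; lra.
Qed.

Lemma mode_nonquantized : (forall k, A * B <> 2 * a * INR k) ->
  forall x, p x = RtoC 0 /\ q x = RtoC 0.
Proof using Ha Dp Dq Bp Bq.
  intros Hk x. split; apply Ceq.
  - exact (oscillator_nonquantized a b _ _ _ Ha Hk oscillator_Re_p (poly_bounded_Re _ Bp) x).
  - exact (oscillator_nonquantized a b _ _ _ Ha Hk oscillator_Im_p (poly_bounded_Im _ Bp) x).
  - refine (oscillator_nonquantized a b _ _ _ Ha _ oscillator_Re_q (poly_bounded_Re _ Bq) x).
    intros k E. apply (Hk (S k)). rewrite S_INR. lra.
  - refine (oscillator_nonquantized a b _ _ _ Ha _ oscillator_Im_q (poly_bounded_Im _ Bq) x).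
    intros k E. apply (Hk (S k)). rewrite S_INR. lra.
Qed.

(** Here [p] is a multiple of one Hermite function, so its value at one point where that function is
    nonzero decides whether it vanishes. This is why point evaluation can serve as the dual
    functional. *)
Lemma mode_quantized K x0 : A * B = 2 * a * INR K -> herm a K (a * x0 + b) <> 0 -> p x0 = RtoC 0 ->
  forall x, p x = RtoC 0 /\ q x = RtoC 0.
Proof using Ha Dp Dq Bp Bq.
  intros HK Hh Hp0.
  assert (Hp : forall x, p x = RtoC 0).
  { pose proof oscillator_Re_p as O1. pose proof oscillator_Im_p as O2. rewrite HK in O1, O2.
    destruct (oscillator_quantized _ _ _ _ _ Ha O1 (poly_bounded_Re _ Bp)) as [M1 H1].
    destruct (oscillator_quantized _ _ _ _ _ Ha O2 (poly_bounded_Im _ Bp)) as [M2 H2].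
    pose proof (H1 x0) as E1. pose proof (H2 x0) as E2. rewrite Hp0 in E1, E2. simpl in E1, E2.
    symmetry in E1, E2. apply Rmult_integral in E1, E2.
    intros x. apply Ceq; [rewrite H1|rewrite H2]; simpl; [destruct E1 as [->|E]|destruct E2 as [->|E]]; solve [ring|contradiction]. }
  intros x; split; [apply Hp|]. apply mode_q_zero_of_p; auto.
  destruct (Req_EM_T A 0) as [->|]; [left; ring|now right].
Qed.

(** This is the sign missing at Hermite level 0: [q] lies below the spectrum and vanishes, and the
    second equation then forces [B * p = 0]. *)
Lemma mode_quantized_neg : A = 0 -> B <> 0 -> forall x, p x = RtoC 0 /\ q x = RtoC 0.
Proof using Ha Dp Dq Bq.
  intros HA HB.
  assert (Hq : forall x, q x = RtoC 0).
  { intros x. apply Ceq.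
    - refine (oscillator_neg a b _ _ _ _ oscillator_Re_q (poly_bounded_Re _ Bq) x). rewrite HA; lra.
    - refine (oscillator_neg a b _ _ _ _ oscillator_Im_q (poly_bounded_Im _ Bq) x). rewrite HA; lra. }
  intros x; split; [|apply Hq].
  pose proof (is_derive_zero_fun _ _ x (proj1 oscillator_Re_q) ltac:(intros y; cbv beta; now rewrite Hq)) as E1.
  pose proof (is_derive_zero_fun _ _ x (proj1 oscillator_Im_q) ltac:(intros y; cbv beta; now rewrite Hq)) as E2.
  cbv beta in E1, E2. rewrite Hq in E1, E2. simpl in E1, E2.
  apply Ceq; apply Rmult_eq_reg_l with B; auto; unfold Re, Im in *; simpl in *; lra.
Qed.
End ModeODE.

(* The vertical frequency of an oscillator index, as an offset from [phase d3]. *)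
Definition fibre_index (d3 : R) (sg : bool) (t : nat) : Z :=
  if sg then (if Req_EM_T d3 1 then Z.of_nat t + 1 else Z.of_nat t)%Z else (- Z.of_nat t - 1)%Z.

Lemma fibre_freq_index d3 sg t : d3 = 1 \/ d3 = -1 -> sgR sg * fibre_freq d3 t = phase d3 + IZR (fibre_index d3 sg t).
Proof.
  intros [-> | ->]; unfold fibre_index, fibre_freq, sgR, phase; destruct sg; destruct Req_EM_T; try lra;
    rewrite ?plus_IZR, ?minus_IZR, ?opp_IZR, <- ?INR_IZR_INZ; field.
Qed.

Lemma fibre_index_inj d3 sg t sg' t' : fibre_index d3 sg t = fibre_index d3 sg' t' -> sg = sg' /\ t = t'.
Proof.
  unfold fibre_index. destruct sg, sg', (Req_EM_T d3 1); intros H; try (exfalso; lia); (split; [reflexivity|lia]).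
Qed.

Lemma fibre_index_neq0 sg t : fibre_index 1 sg t <> 0%Z.
Proof. unfold fibre_index. destruct sg; [destruct (Req_EM_T 1 1); [lia|lra]|lia]. Qed.

Lemma fibre_index_surj d3 n : d3 = 1 \/ d3 = -1 -> (d3 = 1 /\ n = 0%Z) \/ exists sg t, n = fibre_index d3 sg t.
Proof.
  intros H3. destruct (Z_lt_le_dec n 0) as [Hn|Hn].
  - right. exists false, (Z.to_nat (- n - 1)). unfold fibre_index. lia.
  - destruct H3 as [-> | ->].
    + destruct (Z.eq_dec n 0) as [->|]; [left; auto|right].
      exists true, (Z.to_nat (n - 1)). unfold fibre_index. destruct Req_EM_T; [lia|lra].
    + right. exists true, (Z.to_nat n). unfold fibre_index. destruct Req_EM_T; [lra|lia].
Qed.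

(** * Functionals dual to the eigensections *)

Definition vertical (d3 : R) (j : index) : Z :=
  match j with Torus _ _ _ => 0%Z | Osc sg t _ _ => fibre_index d3 sg t end.

Definition herm_pt (d3 : R) (t K : nat) : R :=
  proj1_sig (constructive_indefinite_description _ (herm_neq0 (2 * PI * fibre_freq d3 t) K (osc_a_pos d3 t))).

Lemma herm_pt_spec d3 t K : herm (2 * PI * fibre_freq d3 t) K (herm_pt d3 t K) <> 0.
Proof. unfold herm_pt. destruct constructive_indefinite_description; auto. Qed.

Definition osc_pt (d2 d3 : R) (sg : bool) (t i K : nat) : R :=
  (herm_pt d3 t K - 2 * PI * (sgR sg * (phase d2 + INR i))) / (2 * PI * fibre_freq d3 t).

Definition component (sg : bool) (s : heis -> spinor) (p : heis) : C := if sg then snd (s p) else fst (s p).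

(* For oscillator indices, evaluation of a Fourier mode at a point where the Hermite function
   of the index does not vanish replaces the L2 inner product. *)
Definition coefficient (r : nat) (d1 d2 d3 d T : R) (j : index) (s : heis -> spinor) : C :=
  match j with
  | Osc sg t i k =>
      (/ RtoC (herm (2 * PI * fibre_freq d3 t) (Z.abs_nat k) (herm_pt d3 t (Z.abs_nat k))) *
       mode (phase d2 + INR i) (sgR sg * fibre_freq d3 t) (component sg s) (osc_pt d2 d3 sg t i (Z.abs_nat k)))%C
  | Torus m n b =>
      cRInt (fun t => cis (- (2 * PI * (phase d1 + IZR m) * t)) *
        mode (torus_be d2 n) 0
          (component (if Req_EM_T (index_shift r d1 d2 d3 d j T) 0 then negb b else true) s) (INR r * t))%C
  end.

Lemma osc_pt_arg d2 d3 sg t i K :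
  2 * PI * fibre_freq d3 t * osc_pt d2 d3 sg t i K + 2 * PI * (sgR sg * (phase d2 + INR i)) = herm_pt d3 t K.
Proof. unfold osc_pt. field. pose proof (fibre_freq_ge d3 t). pose proof PI_RGT_0. split; lra. Qed.

Lemma continuous_mode be tau (f : heis -> C) x : (forall p, continuous f p) -> continuous (mode be tau f) x.
Proof.
  intros Hf. apply (continuous_comp (fun x => (x, 0, 0) : heis) (avg ey be (avg ez tau f))).
  - apply (continuous_pair (V := prod_UniformSpace R_UniformSpace R_UniformSpace) (W := R_UniformSpace));
      [|apply continuous_const].
    apply (continuous_pair (V := R_UniformSpace) (W := R_UniformSpace));
      [apply continuous_id|apply continuous_const].
  - apply continuous_avg. intros; now apply continuous_avg.
Qed.

Lemma continuous_mode_line c th' be tau (f : heis -> C) t : (forall p, continuous f p) ->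
  continuous (fun t => cis (- (2 * PI * th' * t)) * mode be tau f (c * t))%C t.
Proof.
  intros Hf. apply (continuous_Cmult (fun t => cis (- (2 * PI * th' * t))) (fun t => mode be tau f (c * t))).
  - apply continuous_cis_lin.
  - apply (continuous_comp (fun t => c * t) (mode be tau f)); [|now apply continuous_mode].
    apply @ex_derive_continuous; auto_derive; auto.
Qed.

Definition continuous_spinor (s : heis -> spinor) : Prop := forall sg p, continuous (component sg s) p.

Lemma eigenspace_continuous r d1 d2 d3 d T mu s : heis_eigenspace r d1 d2 d3 d T mu s -> continuous_spinor s.
Proof.
  intros [Hs _] sg p. destruct (smooth_C1_with s Hs) as [Du [Dv [U V]]].
  destruct sg; [apply V|apply U].
Qed.

Section Functional.
Context (r : nat) (d1 d2 d3 d T : R).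

Lemma coefficient_plus j s s' : continuous_spinor s -> continuous_spinor s' ->
  coefficient r d1 d2 d3 d T j (fun p => plus (s p) (s' p)) = (coefficient r d1 d2 d3 d T j s + coefficient r d1 d2 d3 d T j s')%C.
Proof.
  intros Hs Hs'.
  assert (E : forall sg, component sg (fun p => plus (s p) (s' p)) = (fun p => (component sg s p + component sg s' p)%C)).
  { intros sg; extensionality p. now destruct sg. }
  destruct j as [m n b|sg t i k]; unfold coefficient; rewrite E.
  - rewrite <- cRInt_plus by (intros; now apply continuous_mode_line).
    apply cRInt_ext; intros t. rewrite mode_plus by auto. ring.
  - rewrite mode_plus by auto. ring.
Qed.

Lemma coefficient_scal j c s : continuous_spinor s ->
  coefficient r d1 d2 d3 d T j (fun p => scal c (s p)) = (c * coefficient r d1 d2 d3 d T j s)%C.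
Proof.
  intros Hs.
  assert (E : forall sg, component sg (fun p => scal c (s p)) = (fun p => (c * component sg s p)%C)).
  { intros sg; extensionality p. now destruct sg. }
  destruct j as [m n b|sg t i k]; unfold coefficient; rewrite E.
  - rewrite <- cRInt_Cmult by (intros; now apply continuous_mode_line).
    apply cRInt_ext; intros t. rewrite mode_Cmult by auto. ring.
  - rewrite mode_Cmult by auto. ring.
Qed.
End Functional.

Lemma cRInt_cis_delta m : cRInt (fun t => cis (2 * PI * IZR m * t)) = if Z.eq_dec m 0 then RtoC 1 else RtoC 0.
Proof.
  destruct Z.eq_dec as [->|H]; [|now apply cRInt_cis_Z].
  rewrite (cRInt_ext _ (fun _ => RtoC 1)); [apply cRInt_const|].
  intros t. replace (2 * PI * 0 * t) with 0 by ring. apply cis_0.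
Qed.

Lemma continuous_cis_Z c t : continuous (fun t => cis (2 * PI * c * t)) t.
Proof. apply continuous_cis. apply @ex_derive_continuous. auto_derive; auto. Qed.

Lemma mode_vertical be tau tau' m (f : heis -> C) x : 
  (forall x y z t, f (x, y, z + t) = (cis (2 * PI * tau' * t) * f (x, y, z))%C) ->
  tau' - tau = IZR m ->
  mode be tau f x = if Z.eq_dec m 0 then cRInt (fun y => cis (- (2 * PI * be * y)) * f (x, y, 0))%C else RtoC 0.
Proof.
  intros Hf Hm. rewrite mode_eq.
  assert (E : forall y, cRInt (fun z => cis (- (2 * PI * tau * z)) * f (x, y, z))%C =
    (f (x, y, 0%R) * if Z.eq_dec m 0 then RtoC 1 else RtoC 0)%C).
  { intros y. rewrite <- cRInt_cis_delta, <- cRInt_Cmult by (intros; apply continuous_cis_Z).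
    apply cRInt_ext; intros z. rewrite <- (Rplus_0_l z) at 2. rewrite Hf, <- Hm.
    replace (2 * PI * (tau' - tau) * z) with (- (2 * PI * tau * z) + 2 * PI * tau' * z) by ring.
    rewrite cis_plus. ring. }
  destruct Z.eq_dec as [H|H].
  - apply cRInt_ext; intros y. rewrite E. ring.
  - rewrite (cRInt_ext _ (fun _ => RtoC 0)); [apply cRInt_const|]. intros y. rewrite E. ring.
Qed.

(** * Biorthogonality of sections and functionals *)

Section Spectrum.
Context (r : nat) (d1 d2 d3 d T : R).
Context (Hr : (0 < r)%nat) (Hd : 0 < d) (HT : 0 < T) (H1 : d1 = 1 \/ d1 = -1)
  (H2 : d2 = 1 \/ d2 = -1) (H3 : d3 = 1 \/ d3 = -1) (Hodd : Nat.Odd r -> d3 = 1).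

Local Notation shift j := (index_shift r d1 d2 d3 d j T).
Local Notation section j := (index_section r d1 d2 d3 d j T).
Local Notation ellr := (coefficient r d1 d2 d3 d T).

Lemma section_vertical j b : index_valid r d3 j -> forall x y z t,
  component b (section j) (x, y, z + t) =
  (cis (2 * PI * (phase d3 + IZR (vertical d3 j)) * t) * component b (section j) (x, y, z))%C.
Proof using Hr Hd HT H1 H2 H3 Hodd.
  destruct j as [m n b'|sg t i k]; intros Hv x y z t'.
  - simpl in Hv. subst d3. rewrite phase_1. simpl vertical.
    replace (2 * PI * (0 + 0) * t') with 0 by ring. rewrite cis_0, Cmult_1_l.
    unfold component, index_section. destruct Req_EM_T; reflexivity.
  - simpl vertical. rewrite <- fibre_freq_index by auto.
    unfold component, index_section, osc_theta.
    pose proof (fun k => theta_character _ _ (sgR sg) (phase d2 + INR i) (sgR sg * fibre_freq d3 t) d1 (INR_r_pos r Hr) (osc_a_pos d3 t) H1 k t' x y z) as E.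
    destruct sg, b; cbv beta iota delta [place fst snd]; rewrite !E; ring.
Qed.

Lemma coefficient_other_vertical i j : index_valid r d3 i -> index_valid r d3 j ->
  vertical d3 i <> vertical d3 j -> ellr i (section j) = RtoC 0.
Proof using Hr Hd HT H1 H2 H3 Hodd.
  intros Hi Hj Hv.
  assert (E : forall be tau b x, tau = phase d3 + IZR (vertical d3 i) -> mode be tau (component b (section j)) x = RtoC 0).
  { intros be tau b x ->.
    rewrite (mode_vertical _ _ _ (vertical d3 j - vertical d3 i) _ _ (section_vertical j b Hj)) by (rewrite minus_IZR; ring).
    destruct Z.eq_dec; [lia|reflexivity]. }
  destruct i as [m n b|sg t i k]; unfold coefficient.
  - rewrite (cRInt_ext _ (fun _ => RtoC 0)); [apply cRInt_const|]. intros t. rewrite E; [ring|].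
    simpl in Hi. rewrite Hi, phase_1. simpl; ring.
  - rewrite E; [ring|]. simpl. now apply fibre_freq_index.
Qed.

Lemma osc_shift_inj sg t i sg' i' k k' : shift (Osc sg t i k) = shift (Osc sg' t i' k') -> k = k'.
Proof using Hr Hd HT H1 H2 H3 Hodd.
  intros E.
  pose proof (osc_shift_sqr r d1 d2 d3 d T Hd HT sg t i k) as E1.
  pose proof (osc_shift_sqr r d1 d2 d3 d T Hd HT sg' t i' k') as E2. cbv zeta in E1, E2.
  assert (EK : Z.abs_nat k = Z.abs_nat k').
  { apply INR_eq. rewrite E, E2 in E1. pose proof (osc_a_pos d3 t) as Ha.
    assert (0 < d ^ 2) by (apply pow_lt; auto).
    apply Rmult_eq_reg_l with (2 * (2 * PI * fibre_freq d3 t) * d ^ 2); [lra|].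
    apply Rgt_not_eq. apply Rmult_lt_0_compat; lra. }
  simpl in E. rewrite <- EK in E.
  apply Rmult_eq_reg_r in E.
  - unfold sgZ in E. destruct (Z.leb_spec 0 k), (Z.leb_spec 0 k'); try lra; lia.
  - apply Rgt_not_eq, sqrt_lt_R0. pose proof (fibre_freq_ge d3 t). pose proof PI_RGT_0.
    assert (0 < 2 * PI * fibre_freq d3 t / T) by (apply Rdiv_lt_0_compat; [|lra]; nra).
    pose proof (pos_INR (Z.abs_nat k)). assert (0 < d ^ 2) by (apply pow_lt; auto).
    apply Rplus_lt_le_0_compat; [nra|].
    apply Rmult_le_pos; [apply Rmult_le_pos; [simpl in *; nra|lra]|lra].
Qed.

(** The theta series of index [i'] has frequencies in [y] congruent to [i'] modulo [N]; two distinct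
    residues below [N] share no frequency. *)
Lemma coefficient_osc_same sg t i i' k : index_valid r d3 (Osc sg t i k) -> index_valid r d3 (Osc sg t i' k) ->
  ellr (Osc sg t i k) (section (Osc sg t i' k)) = if Nat.eq_dec i i' then RtoC 1 else RtoC 0.
Proof using Hr Hd HT H1 H2 H3 Hodd.
  intros Hi Hi'. unfold coefficient.
  set (K := Z.abs_nat k). set (x0 := osc_pt d2 d3 sg t i K).
  destruct (fibre_freq_lattice r d3 t Hr H3 Hodd) as [N [HN EN]].
  simpl in Hi, Hi'. rewrite EN in Hi, Hi'. apply INR_lt in Hi, Hi'.
  set (q := (if sg then Z.of_nat N else - Z.of_nat N)%Z).
  assert (Eq : sgR sg * fibre_freq d3 t * INR r = IZR q).
  { unfold q. destruct sg; unfold sgR; rewrite ?opp_IZR, <- INR_IZR_INZ, <- EN; ring. }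
  assert (Hq0 : q <> 0%Z) by (unfold q; destruct sg; lia).
  rewrite (mode_vertical _ _ (phase d3 + IZR (vertical d3 (Osc sg t i' k))) 0 _ _ (section_vertical (Osc sg t i' k) sg ltac:(simpl; rewrite EN; now apply lt_INR))).
  2:{ simpl. rewrite <- fibre_freq_index by auto. ring. }
  destruct (Z.eq_dec 0 0) as [_|]; [|lia].
  rewrite (cRInt_ext _ (fun y => cis (- (2 * PI * ((phase d2 + INR i') + IZR (Z.of_nat i - Z.of_nat i')) * y)) *
     osc_theta r d1 d2 d3 sg t i' K (x0, y, 0%R))%C).
  2:{ intros y. f_equal.
      - f_equal. rewrite minus_IZR, <- !INR_IZR_INZ. ring.
      - unfold index_section. now destruct sg. }
  destruct Nat.eq_dec as [<-|Hne].
  - rewrite (cRInt_ext _ (fun y => cis (- (2 * PI * (phase d2 + INR i) * y)) *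
     osc_theta r d1 d2 d3 sg t i K (x0, y, 0%R))%C).
    2:{ intros y. replace (phase d2 + INR i + IZR (Z.of_nat i - Z.of_nat i)) with (phase d2 + INR i); [reflexivity|].
        rewrite Z.sub_diag. ring. }
    unfold osc_theta. rewrite (theta_coefficient_self _ _ _ _ _ _ (INR_r_pos r Hr) (osc_a_pos d3 t) H1 q K x0 Eq Hq0).
    replace (theta_arg (INR r) (2 * PI * fibre_freq d3 t) (sgR sg) (phase d2 + INR i) 0 x0) with (herm_pt d3 t K).
    + rewrite <- RtoC_inv by apply herm_pt_spec. rewrite <- RtoC_mult. f_equal. apply Rinv_l, herm_pt_spec.
    + unfold theta_arg. rewrite <- (osc_pt_arg d2 d3 sg t i K). fold x0. ring.
  - unfold osc_theta. rewrite (theta_coefficient_other _ _ _ _ _ _ (INR_r_pos r Hr) (osc_a_pos d3 t) H1 q (Z.of_nat i - Z.of_nat i') K x0 Eq); [ring|].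
    intros j Hj. unfold q in Hj. clear - Hi Hi' Hne Hj.
    assert (HJ : (j = 0 \/ j >= 1 \/ j <= -1)%Z) by lia. destruct sg, HJ as [->|[HJ|HJ]]; nia.
Qed.

Lemma torus_functional m n m' n' (c : C) :
  cRInt (fun t => cis (- (2 * PI * (phase d1 + IZR m) * t)) *
    mode (torus_be d2 n) 0 (fun p => c * character (torus_al r d1 m') (torus_be d2 n') p)%C (INR r * t))%C =
  if Z.eq_dec m' m then (if Z.eq_dec n' n then c else RtoC 0) else RtoC 0.
Proof using Hr Hd HT H1 H2 H3 Hodd.
  set (dn := if Z.eq_dec (n' - n) 0 then RtoC 1 else RtoC 0).
  assert (E : forall x, mode (torus_be d2 n) 0 (fun p => c * character (torus_al r d1 m') (torus_be d2 n') p)%C x =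
    (c * (cis (2 * PI * (torus_al r d1 m' * x)) * dn))%C).
  { intros x. rewrite mode_Cmult by (intros; apply character_continuous). f_equal.
    rewrite (mode_vertical _ _ 0 0) by (intros; first [ring|replace (2 * PI * 0 * t) with 0 by ring; rewrite cis_0, Cmult_1_l; reflexivity]).
    destruct (Z.eq_dec 0 0) as [_|]; [|lia].
    unfold dn. rewrite <- cRInt_cis_delta, <- cRInt_Cmult by (intros; apply continuous_cis_Z).
    apply cRInt_ext; intros y. unfold character. rewrite <- !cis_plus. f_equal.
    rewrite minus_IZR. unfold torus_be. ring. }
  rewrite (cRInt_ext _ (fun t => c * dn * cis (2 * PI * IZR (m' - m) * t))%C).
  - rewrite cRInt_Cmult by (intros; apply continuous_cis_Z). rewrite cRInt_cis_delta. unfold dn.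
    destruct (Z.eq_dec (m' - m) 0), (Z.eq_dec m' m), (Z.eq_dec (n' - n) 0), (Z.eq_dec n' n); try lia; ring.
  - intros t. rewrite E.
    replace (2 * PI * IZR (m' - m) * t) with (- (2 * PI * (phase d1 + IZR m) * t) + 2 * PI * (torus_al r d1 m' * (INR r * t))).
    + rewrite cis_plus. ring.
    + unfold torus_al. rewrite minus_IZR. field. pose proof (INR_r_pos r Hr); lra.
Qed.

Lemma coefficient_torus_torus m n b m' n' b' : shift (Torus m n b) = shift (Torus m' n' b') ->
  ellr (Torus m n b) (section (Torus m' n' b')) =
  if Z.eq_dec m' m then (if Z.eq_dec n' n then (if Bool.bool_dec b' b then RtoC 1 else RtoC 0) else RtoC 0) else RtoC 0.
Proof using Hr Hd HT H1 H2 H3 Hodd.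
  intros E. unfold coefficient. rewrite E.
  set (al := torus_al r d1 m'). set (be := torus_be d2 n').
  destruct (Req_EM_T (shift (Torus m' n' b')) 0) as [H0|H0].
  - assert (EP : component (negb b) (section (Torus m' n' b')) =
      (fun p => (if Bool.bool_dec b' b then RtoC 1 else RtoC 0) * character al be p)%C).
    { extensionality p. unfold component, index_section.
      destruct (Req_EM_T (shift (Torus m' n' b')) 0) as [_|H0']; [|contradiction].
      destruct b, b'; simpl; unfold al, be; ring. }
    rewrite EP. unfold al, be. apply torus_functional.
  - assert (EP : component true (section (Torus m' n' b')) = (fun p => RtoC 1 * character al be p)%C).
    { extensionality p. unfold component, index_section.
      destruct (Req_EM_T (shift (Torus m' n' b')) 0) as [H0'|_]; [contradiction|].
      simpl; unfold al, be; ring. }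
    rewrite EP. unfold al, be. rewrite torus_functional.
    destruct (Z.eq_dec m' m) as [->|]; auto. destruct (Z.eq_dec n' n) as [->|]; auto.
    (* Both signs have the same second component, so the functional cannot separate them; equality
       of the shifts does, since opposite signs would make the shift zero. *)
    destruct (Bool.bool_dec b' b) as [->|Hb]; auto. exfalso. apply H0.
    simpl in E |- *. destruct b, b'; simpl in *; try congruence; lra.
Qed.

(** Fibre frequencies separate most pairs of indices. The functionals alone do not distinguish signs
    or Hermite levels at the same frequency; equality of the shifts, that is membership in one
    eigenspace, settles these. *)
Lemma coefficient_biorthogonal i j : index_valid r d3 i -> index_valid r d3 j -> shift i = shift j ->
  (i = j -> ellr i (section j) = RtoC 1) /\ (i <> j -> ellr i (section j) = RtoC 0).
Proof using Hr Hd HT H1 H2 H3 Hodd.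
  intros Hi Hj E.
  destruct (Z.eq_dec (vertical d3 i) (vertical d3 j)) as [EV|NV].
  2:{ split; intros Hij; [subst; contradiction|]. now apply coefficient_other_vertical. }
  destruct i as [m n b|sg t i k], j as [m' n' b'|sg' t' i' k'].
  - rewrite (coefficient_torus_torus _ _ _ _ _ _ E).
    destruct (Z.eq_dec m' m) as [->|]; [|split; congruence].
    destruct (Z.eq_dec n' n) as [->|]; [|split; congruence].
    destruct (Bool.bool_dec b' b) as [->|]; split; congruence.
  - exfalso. simpl in EV, Hi. subst d3. symmetry in EV. now apply fibre_index_neq0 in EV.
  - exfalso. simpl in EV, Hj. subst d3. now apply fibre_index_neq0 in EV.
  - simpl in EV. apply fibre_index_inj in EV. destruct EV as [<- <-].
    assert (k = k') as <- by (eapply osc_shift_inj; exact E).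
    rewrite coefficient_osc_same by auto. destruct Nat.eq_dec as [->|]; split; congruence.
Qed.
End Spectrum.

Lemma cRInt_derive (G G' : R -> C) : (forall t, is_derive G t (G' t)) -> (forall t, continuous G' t) ->
  cRInt G' = (G 1 - G 0)%C.
Proof.
  intros HD HC. unfold cRInt. apply Ceq; simpl.
  - apply is_RInt_unique. apply (is_RInt_derive (V := R_CompleteNormedModule) (fun t => Re (G t))).
    + intros t _. apply is_derive_Re, HD.
    + intros t _. now apply (continuous_Re G').
  - apply is_RInt_unique. apply (is_RInt_derive (V := R_CompleteNormedModule) (fun t => Im (G t))).
    + intros t _. apply is_derive_Im, HD.
    + intros t _. now apply (continuous_Im G').
Qed.

Lemma is_derive_Cmult_fun (f g : R -> C) x l m : is_derive f x l -> is_derive g x m ->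
  is_derive (fun t => (f t * g t)%C) x (l * g x + f x * m)%C.
Proof.
  intros Hf Hg.
  pose proof (is_derive_Re _ _ _ Hf) as F1. pose proof (is_derive_Im _ _ _ Hf) as F2.
  pose proof (is_derive_Re _ _ _ Hg) as G1. pose proof (is_derive_Im _ _ _ Hg) as G2.
  apply is_derive_RC.
  - evar_last; [exact (is_derive_Rminus _ _ _ _ _ (is_derive_Rmult _ _ _ _ _ F1 G1) (is_derive_Rmult _ _ _ _ _ F2 G2))|].
    unfold Re, Im; simpl; eqR; ring.
  - evar_last; [exact (is_derive_Rplus _ _ _ _ _ (is_derive_Rmult _ _ _ _ _ F1 G2) (is_derive_Rmult _ _ _ _ _ F2 G1))|].
    unfold Re, Im; simpl; eqR; ring.
Qed.

(** Integration by parts; the boundary terms cancel because the multiplier of [h] is inverse to that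
    of the character. *)
Lemma fourier_derive q (h h' : R -> C) : (forall t, is_derive h t (h' t)) -> (forall t, continuous h' t) ->
  (forall t, continuous h t) -> (forall t, h (t + 1) = (cis (2 * PI * q) * h t)%C) ->
  cRInt (fun t => cis (- (2 * PI * q * t)) * h' t)%C =
  (Ci * RtoC (2 * PI * q) * cRInt (fun t => cis (- (2 * PI * q * t)) * h t))%C.
Proof.
  intros HD HC Hc Hp.
  set (e := fun t => cis (- (2 * PI * q * t))).
  assert (De : forall t, is_derive e t (- (Ci * RtoC (2 * PI * q)) * e t)%C).
  { intros t. evar_last; [apply (is_derive_cis (fun t => - (2 * PI * q * t)) t (- (2 * PI * q))); auto_derive; auto; eqR; ring|].
    unfold e. rewrite RtoC_opp. eqC. ring. }
  assert (C1 : forall t, continuous (fun t => e t * h' t)%C t).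
  { intros t. apply (continuous_Cmult e h'); [apply continuous_cis_lin|apply HC]. }
  assert (C2 : forall t, continuous (fun t => e t * h t)%C t).
  { intros t. apply (continuous_Cmult e h); [apply continuous_cis_lin|apply Hc]. }
  assert (C3 : forall t, continuous (fun t => - (Ci * RtoC (2 * PI * q)) * (e t * h t))%C t).
  { intros t. apply (continuous_Cmult (fun _ => _) (fun t => e t * h t)%C); [apply continuous_const|apply C2]. }
  pose proof (cRInt_derive (fun t => e t * h t)%C (fun t => - (Ci * RtoC (2 * PI * q)) * (e t * h t) + e t * h' t)%C) as E.
  rewrite cRInt_plus, cRInt_Cmult in E by auto.
  assert (E1 : ((e 1 * h 1) - (e 0 * h 0))%C = RtoC 0).
  { rewrite <- (Rplus_0_l 1) at 2. rewrite Hp. unfold e.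
    rewrite Cmult_assoc, <- cis_plus. replace (- (2 * PI * q * 1) + 2 * PI * q) with 0 by ring.
    replace (- (2 * PI * q * 0)) with 0 by ring. ring. }
  rewrite E1 in E. 
  rewrite <- (Cplus_0_l (Ci * _ * _)%C). rewrite <- E.
  - unfold e. ring.
  - intros t. pose proof (is_derive_Cmult_fun _ _ _ _ _ (De t) (HD t)) as E2.
    evar_last; [exact E2|]. eqC; ring.
  - intros t. apply continuous_Cplus; [apply C3|apply C1].
Qed.

Lemma dirac_mode_minus d W al be nu (t f : C) : d <> 0 -> W = 2 * PI * be ->
  (RtoC (- W) * t + Ci * RtoC (nu / d) * f = Ci * RtoC (2 * PI * al) * t)%C ->
  (RtoC nu * f = zeta d al be * t)%C.
Proof.
  intros Hd -> E. set (n := nu / d) in E. replace nu with (d * n) by (unfold n; field; auto).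
  destruct t as [t1 t2], f as [f1 f2].
  pose proof (f_equal Re E) as R1. pose proof (f_equal Im E) as R2. unfold Re, Im in R1, R2; simpl in R1, R2.
  assert (S1 : n * f2 = 2 * PI * al * t2 - 2 * PI * be * t1) by lra.
  assert (S2 : n * f1 = 2 * PI * al * t1 + 2 * PI * be * t2) by lra.
  apply Ceq; unfold zeta, Re, Im; simpl.
  - transitivity (d * (n * f1)); [ring|]. rewrite S2; ring.
  - transitivity (d * (n * f2)); [ring|]. rewrite S1; ring.
Qed.

Lemma dirac_mode_plus d W al be nu (t f : C) : d <> 0 -> W = 2 * PI * be ->
  (RtoC W * f + Ci * RtoC (nu / d) * t = Ci * RtoC (2 * PI * al) * f)%C ->
  (RtoC nu * t = (RtoC (2 * PI * d * al) + Ci * RtoC (2 * PI * d * be)) * f)%C.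
Proof.
  intros Hd -> E. set (n := nu / d) in E. replace nu with (d * n) by (unfold n; field; auto).
  destruct t as [t1 t2], f as [f1 f2].
  pose proof (f_equal Re E) as R1. pose proof (f_equal Im E) as R2. unfold Re, Im in R1, R2; simpl in R1, R2.
  assert (S1 : n * t2 = 2 * PI * al * f2 + 2 * PI * be * f1) by lra.
  assert (S2 : n * t1 = 2 * PI * al * f1 - 2 * PI * be * f2) by lra.
  apply Ceq; unfold Re, Im; simpl.
  - transitivity (d * (n * t1)); [ring|]. rewrite S2; ring.
  - transitivity (d * (n * t2)); [ring|]. rewrite S1; ring.
Qed.

Ltac coefficient_eq :=
  apply (f_equal2 Cplus); (apply (f_equal2 Cmult); [|reflexivity]);
  [apply (f_equal RtoC)|apply (f_equal (Cmult Ci)), (f_equal RtoC)]; unfold Rdiv; ring.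

(** * Eigensections killed by all functionals vanish *)

Section Completeness.
Context (r : nat) (d1 d2 d3 d T mu : R) (s : heis -> spinor).
Context (Hr : (0 < r)%nat) (Hd : 0 < d) (HT : 0 < T) (H1 : d1 = 1 \/ d1 = -1)
  (H2 : d2 = 1 \/ d2 = -1) (H3 : d3 = 1 \/ d3 = -1) (Hodd : Nat.Odd r -> d3 = 1)
  (Hs : heis_eigenspace r d1 d2 d3 d T mu s)
  (H0 : forall j, index_valid r d3 j -> dirac_shift d T + index_shift r d1 d2 d3 d j T = mu ->
     coefficient r d1 d2 d3 d T j s = RtoC 0).

Local Notation nu := (mu - dirac_shift d T).

Lemma component_continuous b p : continuous (component b s) p.
Proof using Hs. exact (eigenspace_continuous _ _ _ _ _ _ _ _ Hs b p). Qed.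

Lemma component_equivariant b : scalar_equivariant (INR r) d1 d2 d3 (component b s).
Proof using Hs.
  destruct Hs as [_ [He _]]. destruct (heis_equivariant_components _ _ _ _ _ He) as [E1 E2].
  destruct b; [exact E2|exact E1].
Qed.

Lemma cis_vert sg t : cis (2 * PI * (sgR sg * fibre_freq d3 t)) = RtoC d3.
Proof using H3. rewrite fibre_freq_index by exact H3. now apply cis_phase_Z. Qed.

(** The two modes solve the first order system with [A * B * d^2 = nu^2 - om^2]. If [A * B] is not
    quantized, boundedness kills them; if it is, [nu] belongs to an index, whose functional kills
    them, except for the missing sign at level 0. *)
Lemma osc_modes_zero_base sg t i b x : INR i < fibre_freq d3 t * INR r ->
  mode (phase d2 + INR i) (sgR sg * fibre_freq d3 t) (component b s) x = RtoC 0.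
Proof using Hr Hd HT H1 H2 H3 Hs H0.
  intros Hi.
  set (be := phase d2 + INR i). set (tau := sgR sg * fibre_freq d3 t).
  assert (Hbe : cis (2 * PI * be) = RtoC d2) by (unfold be; rewrite INR_IZR_INZ; now apply cis_phase_Z).
  assert (Htau : cis (2 * PI * tau) = RtoC d3) by apply cis_vert.
  set (a := 2 * PI * fibre_freq d3 t). set (b0 := 2 * PI * (sgR sg * be)). set (om := 2 * PI * fibre_freq d3 t / T).
  assert (Ha : 0 < a) by apply osc_a_pos.
  assert (Hom : 0 < om) by (apply Rdiv_lt_0_compat; auto).
  set (A := (nu + om) / d). set (B := (nu - om) / d).
  set (p := mode be tau (component sg s)). set (q := mode be tau (component (negb sg) s)).
  pose proof (mode_ode r d1 d2 d3 d T mu s be tau ltac:(lra) ltac:(lra) Hs Hbe Htau) as ODE. cbv zeta in ODE.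
  assert (Dp : forall x, is_derive p x (RtoC (- (a * x + b0)) * p x + Ci * RtoC A * q x)%C).
  { intros y. destruct (ODE y) as [E1 E2]. unfold p, q, A, a, b0, om, tau in *. destruct sg; simpl negb; simpl sgR in *.
    - evar_last; [exact E1|]. eqC. coefficient_eq.
    - evar_last; [exact E2|]. eqC. coefficient_eq. }
  assert (Dq : forall x, is_derive q x (RtoC (a * x + b0) * q x + Ci * RtoC B * p x)%C).
  { intros y. destruct (ODE y) as [E1 E2]. unfold p, q, B, a, b0, om, tau in *. destruct sg; simpl negb; simpl sgR in *.
    - evar_last; [exact E2|]. eqC. coefficient_eq.
    - evar_last; [exact E1|]. eqC. coefficient_eq. }
  assert (Bd : forall b, exists M, forall x, Cmod (mode be tau (component b s) x) <= M).
  { intros b'. apply (mode_bounded (INR r) d1 d2 d3); auto using INR_r_pos, component_equivariant.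
    intros; apply component_continuous. }
  assert (Hab : A * B * d ^ 2 = nu ^ 2 - om ^ 2) by (unfold A, B; field; lra).
  assert (Hd2 : 0 < d ^ 2) by (apply pow_lt; auto).
  enough (Z : forall x, p x = RtoC 0 /\ q x = RtoC 0).
  { destruct (Z x) as [Z1 Z2]. unfold p, q in Z1, Z2. destruct b, sg; simpl negb in *; auto. }
  destruct (classic (exists K, A * B = 2 * a * INR K)) as [[K HK]|HN].
  2:{ apply (mode_nonquantized a b0 A B p q Ha Dp Dq (Bd _) (Bd _)). intros k E; apply HN; now exists k. }
  (* Whenever [nu] is the shift of an index [k] of level [K], the hypothesis on its functional says
     that [p] vanishes at [osc_pt]. *)
  assert (Match : forall k : Z, Z.abs_nat k = K -> nu = sgZ k * sqrt (om ^ 2 + 2 * a * INR K * d ^ 2) ->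
    forall x, p x = RtoC 0 /\ q x = RtoC 0).
  { intros k Hk Hnu.
    apply (mode_quantized a b0 A B p q Ha Dp Dq (Bd _) (Bd _) K (osc_pt d2 d3 sg t i K) HK).
    - rewrite (osc_pt_arg d2 d3 sg t i K : a * _ + b0 = _). apply herm_pt_spec.
    - pose proof (H0 (Osc sg t i k) Hi) as E. unfold coefficient in E. rewrite Hk in E.
      assert (E' : dirac_shift d T + index_shift r d1 d2 d3 d (Osc sg t i k) T = mu).
      { unfold index_shift. rewrite Hk.
        replace ((2 * PI * fibre_freq d3 t / T) ^ 2 + 4 * PI * d ^ 2 * fibre_freq d3 t * INR K) with (om ^ 2 + 2 * a * INR K * d ^ 2)
          by (unfold om, a; ring).
        rewrite <- Hnu. ring. }
      specialize (E E'). fold be tau in E. fold p in E.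
      set (h := herm _ _ _) in E.
      assert (Hh : RtoC h <> RtoC 0) by (intros EE; apply RtoC_inj in EE; now apply (herm_pt_spec d3 t K)).
      transitivity (RtoC h * (/ RtoC h * p (osc_pt d2 d3 sg t i K)))%C; [field; auto|].
      rewrite E. ring. }
  assert (Hnu2 : nu ^ 2 = om ^ 2 + 2 * a * INR K * d ^ 2) by (rewrite HK in Hab; lra).
  destruct K as [|K'].
  (* At level 0 only [nu = om] has an index; [nu = - om] is excluded by the differential equations
     themselves. *)
  - simpl INR in *. rewrite Rmult_0_r, Rmult_0_l, Rplus_0_r in Hnu2.
    destruct (Req_EM_T nu om) as [E|E].
    + apply (Match 0%Z eq_refl). simpl INR. rewrite Rmult_0_r, Rmult_0_l, Rplus_0_r, sqrt_pow2 by lra.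
      unfold sgZ; simpl. lra.
    + assert (E2 : nu = - om).
      { assert (X : (nu - om) * (nu + om) = 0) by (replace ((nu - om) * (nu + om)) with (nu ^ 2 - om ^ 2) by ring; lra).
        apply Rmult_integral in X. lra. }
      apply (mode_quantized_neg a b0 A B p q Ha Dp Dq (Bd _)).
      * unfold A. rewrite E2. unfold Rdiv; ring.
      * unfold B. rewrite E2. apply Rlt_not_eq. unfold Rdiv. apply Ropp_lt_cancel.
        replace (- ((- om - om) * / d)) with (2 * om / d) by (unfold Rdiv; ring). rewrite Ropp_0.
        apply Rdiv_lt_0_compat; lra.
  - assert (HX : sqrt (nu ^ 2) = sqrt (om ^ 2 + 2 * a * INR (S K') * d ^ 2)) by (now rewrite Hnu2).
    destruct (Rle_lt_dec 0 nu) as [Hn|Hn].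
    + apply (Match (Z.of_nat (S K'))); [apply Zabs2Nat.id|].
      rewrite <- HX, sqrt_pow2 by lra. unfold sgZ. destruct (Z.leb_spec 0 (Z.of_nat (S K'))); [ring|lia].
    + apply (Match (- Z.of_nat (S K'))%Z); [lia|].
      rewrite <- HX. replace (nu ^ 2) with ((- nu) ^ 2) by ring. rewrite sqrt_pow2 by lra.
      unfold sgZ. destruct (Z.leb_spec 0 (- Z.of_nat (S K'))); [lia|ring].
Qed.

(** Division of [m] by [N] writes the frequency as a base residue plus a multiple of [tau * r];
    translation in [x] by whole periods reduces to the base residue. For negative [tau] the quotient
    changes sign. *)
Lemma osc_modes_zero sg t m b x : mode (phase d2 + IZR m) (sgR sg * fibre_freq d3 t) (component b s) x = RtoC 0.
Proof using Hr Hd HT H1 H2 H3 Hodd Hs H0.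
  destruct (fibre_freq_lattice r d3 t Hr H3 Hodd) as [N [HN EN]].
  set (i := Z.to_nat (m mod Z.of_nat N)).
  assert (Hi : (0 <= m mod Z.of_nat N < Z.of_nat N)%Z) by (apply Z.mod_pos_bound; lia).
  assert (Hv : INR i < fibre_freq d3 t * INR r) by (rewrite EN; apply lt_INR; unfold i; lia).
  set (j := (if sg then m / Z.of_nat N else - (m / Z.of_nat N))%Z).
  assert (E : phase d2 + IZR m = phase d2 + INR i + IZR j * (sgR sg * fibre_freq d3 t * INR r)).
  { rewrite Rmult_assoc, EN. unfold i. rewrite !INR_IZR_INZ, Z2Nat.id by lia.
    rewrite (Z.div_mod m (Z.of_nat N)) at 1 by lia. rewrite plus_IZR, mult_IZR.
    unfold j; destruct sg; simpl sgR; rewrite ?opp_IZR; ring. }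
  apply Cmod_eq_0. rewrite E.
  rewrite <- (mode_shift_Z (INR r) d1 d2 d3 (component b s) (sgR sg * fibre_freq d3 t) H1).
  - rewrite osc_modes_zero_base by auto. apply Cmod_0.
  - intros; apply component_continuous.
  - apply component_equivariant.
  - apply cis_vert.
Qed.

(** At fibre frequency 0 the modes are periodic in [x] up to [d1]. A third Fourier expansion, in
    [x], turns the differential system into a two by two linear system for the coefficients [F]. *)
Lemma torus_modes_zero n b x : d3 = 1 -> mode (phase d2 + IZR n) 0 (component b s) x = RtoC 0.
Proof using Hr Hd HT H1 H2 Hs H0.
  intros H3'.
  pose proof (INR_r_pos r Hr) as HL.
  set (be := phase d2 + IZR n).
  assert (Hbe : cis (2 * PI * be) = RtoC d2) by now apply cis_phase_Z.
  assert (Htau : cis (2 * PI * 0) = RtoC d3) by (rewrite Rmult_0_r, cis_0, H3'; reflexivity).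
  pose proof (mode_ode r d1 d2 d3 d T mu s be 0 ltac:(lra) ltac:(lra) Hs Hbe Htau) as ODE. cbv zeta in ODE.
  set (phi := fun b => mode be 0 (component b s)).
  assert (Cphi : forall b y, continuous (phi b) y) by (intros b' y; exact (continuous_mode be 0 (component b' s) y (component_continuous b'))).
  assert (ODE' : forall b y, is_derive (phi b) y
    (RtoC (if b then - (2 * PI * be) else 2 * PI * be) * phi b y + Ci * RtoC (nu / d) * phi (negb b) y)%C).
  { intros b' y. destruct (ODE y) as [E1 E2]. destruct b'; simpl negb.
    - evar_last; [exact E1|]. eqC. coefficient_eq.
    - evar_last; [exact E2|]. eqC. coefficient_eq. }
  assert (phi_shift : forall b y, phi b (y + INR r) = (RtoC d1 * phi b y)%C).
  { intros b' y. unfold phi.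
    rewrite (mode_shift (INR r) d1 d2 d3 _ ltac:(intros; apply component_continuous) (component_equivariant b') be 0 Htau).
    now rewrite Rmult_0_l, Rplus_0_r. }
  assert (coefficient_phi : forall m b1, coefficient r d1 d2 d3 d T (Torus m n b1) s =
    cRInt (fun t => cis (- (2 * PI * (phase d1 + IZR m) * t)) *
      phi (if Req_EM_T (index_shift r d1 d2 d3 d (Torus m n b1) T) 0 then negb b1 else true) (INR r * t)%R)%C)
    by reflexivity.
  enough (Zphi : forall b y, phi b y = RtoC 0) by apply (Zphi b x).
  clearbody phi. clear ODE x b.
  set (h := fun b t => phi b (INR r * t)).
  assert (Ch : forall b t, continuous (h b) t).
  { intros b' t. refine (continuous_comp (fun t => INR r * t) (phi b') t _ (Cphi b' _)).
    apply @ex_derive_continuous; auto_derive; auto. }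
  assert (Hh : forall b t, h b (t + 1) = (cis (2 * PI * phase d1) * h b t)%C).
  { intros b' t. unfold h. rewrite cis_phase by auto.
    replace (INR r * (t + 1)) with (INR r * t + INR r) by ring. apply phi_shift. }
  set (W := 2 * PI * be).
  set (h' := fun (b : bool) t => (RtoC (INR r) * (RtoC (if b then - W else W) * h b t + Ci * RtoC (nu / d) * h (negb b) t))%C).
  assert (Dh : forall b t, is_derive (h b) t (h' b t)).
  { intros b' t. unfold h'. rewrite <- scal_R_Cmult.
    apply (is_derive_comp (V := C_R_NormedModule) (phi b') (fun t => INR r * t)).
    - exact (ODE' b' (INR r * t)).
    - auto_derive; auto; eqR; ring. }
  assert (hphi : forall b t, h b t = phi b (INR r * t)) by reflexivity.
  clearbody h.
  assert (Ch2 : forall (c c' : C) b t, continuous (fun t => (c * h b t + c' * h (negb b) t)%C) t).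
  { intros c c' b' t. apply (continuous_Cplus (fun t => (c * h b' t)%C)).
    - apply (continuous_Cmult (fun _ => c) (h b')); [apply continuous_const|apply Ch].
    - apply (continuous_Cmult (fun _ => c') (h (negb b'))); [apply continuous_const|apply Ch]. }
  assert (Ch' : forall b t, continuous (h' b) t).
  { intros b' t. unfold h'. apply (continuous_Cmult (fun _ => RtoC (INR r)) (fun t => (RtoC (if b' then - W else W) * h b' t + Ci * RtoC (nu / d) * h (negb b') t)%C));
      [apply continuous_const|apply Ch2]. }
  assert (Z : forall b t, h b t = RtoC 0).
  { assert (ZF : forall m b, cRInt (fun t => cis (- (2 * PI * (phase d1 + IZR m) * t)) * h b t)%C = RtoC 0).
    { intros m.
      set (F := fun b => cRInt (fun t => cis (- (2 * PI * (phase d1 + IZR m) * t)) * h b t)%C).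
      assert (FE : forall b, F b = cRInt (fun t => cis (- (2 * PI * (phase d1 + IZR m) * t)) * h b t)%C) by reflexivity.
      enough (ZF : forall b, F b = RtoC 0) by (intros b; rewrite <- FE; apply ZF).
      clearbody F.
      assert (Ce : forall b t, continuous (fun t => cis (- (2 * PI * (phase d1 + IZR m) * t)) * h b t)%C t).
      { intros b' t. apply (continuous_Cmult (fun t => cis (- (2 * PI * (phase d1 + IZR m) * t))) (h b')); [apply continuous_cis_lin|apply Ch]. }
      assert (Cc : forall (c : C) b t, continuous (fun t => (c * (cis (- (2 * PI * (phase d1 + IZR m) * t)) * h b t))%C) t).
      { intros c b' t. apply (continuous_Cmult (fun _ => c) (fun t => (cis (- (2 * PI * (phase d1 + IZR m) * t)) * h b' t)%C)); [apply continuous_const|apply Ce]. }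
      assert (EF : forall b : bool, (RtoC (INR r) * (RtoC (if b then - W else W) * F b + Ci * RtoC (nu / d) * F (negb b)) =
        Ci * RtoC (2 * PI * (phase d1 + IZR m)) * F b)%C).
      { intros b'. rewrite !FE, <- (fourier_derive (phase d1 + IZR m) (h b') (h' b')); auto.
        - rewrite <- !cRInt_Cmult, <- cRInt_plus, <- cRInt_Cmult; auto.
          + apply cRInt_ext; intros t. unfold h'. ring.
          + intros t. apply (continuous_Cplus
              (fun t => RtoC (if b' then - W else W) * (cis (- (2 * PI * (phase d1 + IZR m) * t)) * h b' t))%C
              (fun t => Ci * RtoC (nu / d) * (cis (- (2 * PI * (phase d1 + IZR m) * t)) * h (negb b') t))%C); apply Cc.
        - intros t. rewrite Hh. f_equal. symmetry. rewrite Rmult_plus_distr_l, cis_plus, cis_2PI_Z. ring. }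
      set (al := torus_al r d1 m).
      assert (Hal : 2 * PI * (phase d1 + IZR m) = INR r * (2 * PI * al)) by (unfold al, torus_al; field; lra).
      rewrite Hal in EF.
      assert (HrC : RtoC (INR r) <> RtoC 0) by (intros E; apply RtoC_inj in E; lra).
      assert (Q1 : (RtoC nu * F false = zeta d al be * F true)%C).
      { pose proof (EF true) as E. simpl negb in E. 
        assert (E' : (RtoC (- W) * F true + Ci * RtoC (nu / d) * F false = Ci * RtoC (2 * PI * al) * F true)%C).
        { transitivity (/ RtoC (INR r) * (RtoC (INR r) * (RtoC (- W) * F true + Ci * RtoC (nu / d) * F false)))%C; [field; auto|].
          rewrite E, RtoC_mult. field; auto. }
        apply (dirac_mode_minus d W); [lra|reflexivity|exact E']. }
      assert (Q2 : (RtoC nu * F true = (RtoC (2 * PI * d * al) + Ci * RtoC (2 * PI * d * be)) * F false)%C).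
      { pose proof (EF false) as E. simpl negb in E.
        assert (E' : (RtoC W * F false + Ci * RtoC (nu / d) * F true = Ci * RtoC (2 * PI * al) * F false)%C).
        { transitivity (/ RtoC (INR r) * (RtoC (INR r) * (RtoC W * F false + Ci * RtoC (nu / d) * F true)))%C; [field; auto|].
          rewrite E, RtoC_mult. field; auto. }
        apply (dirac_mode_plus d W); [lra|reflexivity|exact E']. }
      set (X := 2 * PI * d * sqrt (al ^ 2 + be ^ 2)).
      pose proof (zeta_norm d al be) as ZN. fold X in ZN.
      (* [nu^2 - X^2] is minus the determinant of the system given by [Q1] and [Q2], up to sign, so
         it annihilates both coefficients. *)
      assert (Q3 : forall b, (RtoC (nu ^ 2 - X ^ 2) * F b = RtoC 0)%C).
      { intros b'. rewrite RtoC_minus. replace (nu ^ 2) with (nu * nu) by ring. rewrite RtoC_mult, <- ZN.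
        destruct b'.
        - transitivity (RtoC nu * (RtoC nu * F true) - (RtoC (2 * PI * d * al) + Ci * RtoC (2 * PI * d * be)) * (zeta d al be * F true))%C; [ring|].
          rewrite <- Q1, Q2. ring.
        - transitivity (RtoC nu * (RtoC nu * F false) - zeta d al be * ((RtoC (2 * PI * d * al) + Ci * RtoC (2 * PI * d * be)) * F false))%C; [ring|].
          rewrite <- Q2, Q1. ring. }
      assert (CM0 : forall (c : R) z, c <> 0 -> (RtoC c * z = RtoC 0)%C -> z = RtoC 0).
      { intros c z Hc E. assert (RtoC c <> RtoC 0) by (intros E'; apply RtoC_inj in E'; auto).
        transitivity (/ RtoC c * (RtoC c * z))%C; [field; auto|]. rewrite E; ring. }
      destruct (Req_EM_T (nu ^ 2) (X ^ 2)) as [EX|NX].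
      2:{ intros b'. apply (CM0 (nu ^ 2 - X ^ 2)); [lra|exact (Q3 b')]. }
      assert (EB : exists b0, nu = sgR b0 * X).
      { assert (P : (nu - X) * (nu + X) = 0) by (replace ((nu - X) * (nu + X)) with (nu ^ 2 - X ^ 2) by ring; lra).
        apply Rmult_integral in P. destruct P as [P|P]; [exists true|exists false]; simpl; lra. }
      destruct EB as [b0 EB].
      assert (HE : forall b1, nu = sgR b1 * X -> coefficient r d1 d2 d3 d T (Torus m n b1) s = F (if Req_EM_T nu 0 then negb b1 else true)).
      { intros b1 Hb1. rewrite coefficient_phi, FE.
        assert (EQ : index_shift r d1 d2 d3 d (Torus m n b1) T = nu) by (rewrite Hb1; reflexivity).
        rewrite EQ. apply cRInt_ext; intros t. now rewrite hphi. }
      assert (HZ : forall b1, nu = sgR b1 * X -> F (if Req_EM_T nu 0 then negb b1 else true) = RtoC 0).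
      { intros b1 Hb1. rewrite <- HE by auto. apply H0; [exact H3'|].
        change (dirac_shift d T + sgR b1 * X = mu). rewrite <- Hb1. ring. }
      (* At [nu = 0] both signs give valid indices and their functionals read the two components.
         Otherwise the functional reads the second component and [Q1] yields the first. *)
      destruct (Req_EM_T nu 0) as [N0|N0].
      - assert (HX0 : X = 0) by (destruct b0; simpl in EB; lra).
        intros b'. rewrite <- (Bool.negb_involutive b'). apply HZ. rewrite HX0, N0. ring.
      - pose proof (HZ b0 EB) as ZT. intros b'. destruct b'; [exact ZT|].
        refine (CM0 nu (F false) N0 _). rewrite Q1. rewrite ZT. ring. }
    intros b' t. apply (fourier_uniqueness (phase d1) (h b')); auto. }
  intros b y. specialize (Z b (y / INR r)). rewrite hphi in Z.
  replace (INR r * (y / INR r)) with y in Z by (field; lra). exact Z.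
Qed.

Lemma eigen_functionals_injective p : s p = zero.
Proof using Hr Hd HT H1 H2 H3 Hodd Hs H0.
  assert (Z : forall b p, component b s p = RtoC 0).
  { intros b. apply (mode_unique (INR r) d1 d2 d3 (component b s) (phase d2) (phase d3)).
    - intros; apply component_continuous.
    - apply component_equivariant.
    - now apply cis_phase.
    - now apply cis_phase.
    - intros m n x. destruct (fibre_index_surj d3 n H3) as [[E3 ->]|[sg [t ->]]].
      + rewrite E3 at 1. rewrite phase_1, Rplus_0_r. now apply torus_modes_zero.
      + rewrite <- fibre_freq_index by exact H3. apply osc_modes_zero. }
  pose proof (Z true p) as Z1. pose proof (Z false p) as Z2. unfold component in Z1, Z2.
  destruct (s p) as [u v]. simpl in Z1, Z2. subst. reflexivity.
Qed.
End Completeness.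

Lemma heis_basis r d1 d2 d3 d T mu (l : list index) :
  (0 < r)%nat -> 0 < d -> 0 < T -> d1 = 1 \/ d1 = -1 -> d2 = 1 \/ d2 = -1 -> d3 = 1 \/ d3 = -1 ->
  (Nat.Odd r -> d3 = 1) -> NoDup l ->
  (forall j, In j l <-> index_valid r d3 j /\ dirac_shift d T + index_shift r d1 d2 d3 d j T = mu) ->
  is_basis (heis_eigenspace r d1 d2 d3 d T mu) (length l)
    (fun m => index_section r d1 d2 d3 d (nth m l (Torus 0 0 true)) T).
Proof.
  intros Hr Hd HT H1 H2 H3 Hodd Hl Hin.
  assert (HE : forall j, In j l -> heis_eigenspace r d1 d2 d3 d T mu (index_section r d1 d2 d3 d j T)).
  { intros j Hj. apply Hin in Hj. destruct Hj as [Hv <-]. now apply index_section_eigen. }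
  apply (is_basis_biorthogonal (heis_eigenspace r d1 d2 d3 d T mu) l (Torus 0 0 true)
    (fun j => index_section r d1 d2 d3 d j T) (coefficient r d1 d2 d3 d T)); auto.
  - split; [|split].
    + intros k. apply is_Ck_spinor.
      * induction k as [|k IH]; (split; [intros; apply continuous_const|auto]).
        intros v. exists (fun _ => RtoC 0). split; [|exact IH]. intros p.
        exact (is_derive_const (V := C_R_NormedModule) (RtoC 0) 0).
      * induction k as [|k IH]; (split; [intros; apply continuous_const|auto]).
        intros v. exists (fun _ => RtoC 0). split; [|exact IH]. intros p.
        exact (is_derive_const (V := C_R_NormedModule) (RtoC 0) 0).
    + intros x y z p. symmetry. exact (scal_zero_r (K := C_AbsRing) _).
    + assert (Z : C1_with (fun _ => RtoC 0) (fun _ _ => RtoC 0)).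
      { split; [|split]; intros; try apply continuous_const. exact (is_derive_const (V := C_R_NormedModule) (RtoC 0) 0). }
      intros [[x y] z].
      refine (eq_trans (heis_dirac_formula d T (fun _ => zero) _ _ x y z ltac:(lra) ltac:(lra) Z Z) _).
      refine (eq_trans _ (eq_sym (scal_zero_r (K := C_AbsRing) _))).
      apply (f_equal2 pair); apply Ceq; unfold Re, Im; simpl; ring.
  - intros; apply heis_eigenspace_plus; auto; lra.
  - intros; apply heis_eigenspace_scal; auto; lra.
  - intros i s s' Hs Hs'. apply coefficient_plus; eapply eigenspace_continuous; eauto.
  - intros i c s Hs. apply coefficient_scal; eapply eigenspace_continuous; eauto.
  - intros i Hi. apply Hin in Hi. now apply (proj1 (coefficient_biorthogonal r d1 d2 d3 d T Hr Hd HT H1 H2 H3 Hodd i i (proj1 Hi) (proj1 Hi) eq_refl)).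
  - intros i j Hi Hj. apply Hin in Hi, Hj.
    apply (coefficient_biorthogonal r d1 d2 d3 d T Hr Hd HT H1 H2 H3 Hodd i j (proj1 Hi) (proj1 Hj)).
    destruct Hi, Hj. lra.
  - intros s Hs Hell. apply (eigen_functionals_injective r d1 d2 d3 d T mu s); auto.
    intros j Hv Hj. apply Hell, Hin. auto.
Qed.

(** * Numbering of the eigenvalues *)

Section Enumeration.
Context (Q : nat -> Prop) (Qinf : forall N, exists n, (N <= n)%nat /\ Q n).

Fixpoint rank_below (n : nat) : nat :=
  match n with
  | 0%nat => 0%nat
  | S n' => (rank_below n' + if excluded_middle_informative (Q n') then 1 else 0)%nat
  end.

Lemma rank_below_le m n : (m <= n)%nat -> (rank_below m <= rank_below n)%nat.
Proof using. induction 1; simpl; lia. Qed.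

Lemma rank_below_lt m n : Q m -> (m < n)%nat -> (rank_below m < rank_below n)%nat.
Proof using.
  intros Hm H. apply Nat.lt_le_trans with (rank_below (S m)); [|now apply rank_below_le].
  simpl. destruct excluded_middle_informative; [lia|contradiction].
Qed.

Lemma rank_below_unbounded k : exists n, (k <= rank_below n)%nat.
Proof using Qinf.
  induction k as [|k [n IH]]; [exists 0%nat; lia|].
  destruct (Qinf n) as [m [Hm HQ]]. exists (S m). simpl.
  pose proof (rank_below_le n m Hm). destruct excluded_middle_informative; [lia|contradiction].
Qed.

Lemma rank_below_surj k : exists n, Q n /\ rank_below n = k.
Proof using Qinf.
  destruct (rank_below_unbounded (S k)) as [n Hn].
  induction n as [|n IH]; simpl in Hn; [lia|].
  destruct (Nat.le_gt_cases (S k) (rank_below n)) as [H|H]; [now apply IH|].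
  destruct excluded_middle_informative as [HQ|]; [|lia]. exists n; split; [exact HQ|lia].
Qed.
End Enumeration.

(** A numbering uses every natural number, so the valid indices have to be listed bijectively.
    Injective codes make them countable, [g] shows that they are infinite, and the rank of the code
    removes the gaps. *)
Lemma enumerate {X : Type} (code : X -> nat) (P : X -> Prop) (g : nat -> X) :
  (forall x y, code x = code y -> x = y) -> (forall m n, g m = g n -> m = n) -> (forall n, P (g n)) ->
  exists e : nat -> X, (forall m n, e m = e n -> m = n) /\ forall x, P x <-> exists n, e n = x.
Proof.
  intros Hcode Hg HP.
  set (Q := fun n => exists x, P x /\ code x = n).
  assert (Qinf : forall N, exists n, (N <= n)%nat /\ Q n).
  { intros N. apply NNPP; intros HN.
    assert (B : forall m, (code (g m) < N)%nat).
    { intros m. apply Nat.nle_gt; intros H. apply HN. exists (code (g m)). split; auto. exists (g m); auto. }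
    assert (L : (length (map (fun m => code (g m)) (seq 0 (S N))) <= length (seq 0 N))%nat).
    { apply NoDup_incl_length.
      - apply FinFun.Injective_map_NoDup; [|apply seq_NoDup]. intros a b E. now apply Hg, Hcode.
      - intros y Hy. apply in_map_iff in Hy. destruct Hy as [m [<- _]]. apply in_seq. specialize (B m). lia. }
    rewrite length_map, !length_seq in L. lia. }
  destruct (choice (fun k x => P x /\ rank_below Q (code x) = k)) as [e He].
  { intros k. destruct (rank_below_surj Q Qinf k) as [n [[x [Hx <-]] Hr]]. now exists x. }
  exists e; split.
  - intros m n E. destruct (He m) as [_ <-], (He n) as [_ <-]. now rewrite E.
  - intros x; split; [|intros [n <-]; apply He].
    intros Hx. exists (rank_below Q (code x)). destruct (He (rank_below Q (code x))) as [H1 H2].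
    apply Hcode. set (y := e (rank_below Q (code x))) in *.
    destruct (Nat.lt_trichotomy (code y) (code x)) as [H|[H|H]]; auto.
    + apply (rank_below_lt Q) in H; [lia|now exists y].
    + apply (rank_below_lt Q) in H; [lia|now exists x].
Qed.

Definition zcode (z : Z) : nat := (2 * Z.abs_nat z + if Z.leb 0 z then 0 else 1)%nat.

Lemma zcode_inj x y : zcode x = zcode y -> x = y.
Proof. unfold zcode. destruct (Z.leb_spec 0 x), (Z.leb_spec 0 y); lia. Qed.

Definition index_code (j : index) : nat :=
  match j with
  | Torus m n b => to_nat (0, to_nat (zcode m, to_nat (zcode n, Nat.b2n b)))
  | Osc sg t i k => to_nat (1, to_nat (Nat.b2n sg, to_nat (t, to_nat (i, zcode k))))
  end%nat.

Lemma to_nat_pair_inj a b c e : to_nat (a, b) = to_nat (c, e) -> a = c /\ b = e.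
Proof. intros H. apply (f_equal of_nat) in H. rewrite !cancel_of_to in H. now injection H. Qed.

Lemma index_code_inj x y : index_code x = index_code y -> x = y.
Proof.
  destruct x as [m n b|sg t i k], y as [m' n' b'|sg' t' i' k']; unfold index_code; intros H;
    apply to_nat_pair_inj in H; destruct H as [H1 H]; try discriminate;
    apply to_nat_pair_inj in H; destruct H as [H2 H];
    apply to_nat_pair_inj in H; destruct H as [H3 H].
  - apply zcode_inj in H2, H3. destruct b, b'; simpl in H; congruence.
  - apply to_nat_pair_inj in H; destruct H as [H4 H]. apply zcode_inj in H.
    destruct sg, sg'; simpl in H2; congruence.
Qed.

Lemma finite_set_list {X : Type} (Q : X -> Prop) (L : list X) : (forall x, Q x -> In x L) ->
  exists l, NoDup l /\ forall x, In x l <-> Q x.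
Proof.
  intros H.
  set (dec := fun x y : X => excluded_middle_informative (x = y)).
  exists (nodup dec (filter (fun x => if excluded_middle_informative (Q x) then true else false) L)).
  split; [apply NoDup_nodup|]. intros x. rewrite nodup_In, filter_In.
  destruct excluded_middle_informative; split; intros; try tauto; try (destruct H0; discriminate). auto.
Qed.

Definition zrange (M : nat) : list Z := map (fun k => (Z.of_nat k - Z.of_nat M)%Z) (seq 0 (2 * M + 1)).

Lemma in_zrange M z : Rabs (IZR z) <= INR M -> In z (zrange M).
Proof.
  intros H. rewrite INR_IZR_INZ, <- abs_IZR in H. apply le_IZR in H.
  unfold zrange. apply in_map_iff. exists (Z.to_nat (z + Z.of_nat M)). split; [lia|]. apply in_seq. lia.
Qed.

Definition index_box (M : nat) : list index :=
  (flat_map (fun m => flat_map (fun n => map (Torus m n) (true :: false :: nil)) (zrange M)) (zrange M)) ++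
  flat_map (fun sg => flat_map (fun t => flat_map (fun i => map (Osc sg t i) (zrange M)) (seq 0 (S M))) (seq 0 (S M)))
    (true :: false :: nil).

Lemma in_index_box_torus M m n b : Rabs (IZR m) <= INR M -> Rabs (IZR n) <= INR M -> In (Torus m n b) (index_box M).
Proof.
  intros Hm Hn. apply in_or_app; left. apply in_flat_map. exists m; split; [now apply in_zrange|].
  apply in_flat_map. exists n; split; [now apply in_zrange|]. apply in_map. destruct b; simpl; auto.
Qed.

Lemma in_index_box_osc M sg t i k : INR t <= INR M -> INR i <= INR M -> INR (Z.abs_nat k) <= INR M ->
  In (Osc sg t i k) (index_box M).
Proof.
  intros Ht Hi Hk. apply INR_le in Ht, Hi. apply in_or_app; right.
  apply in_flat_map. exists sg; split; [destruct sg; simpl; auto|].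
  apply in_flat_map. exists t; split; [apply in_seq; lia|].
  apply in_flat_map. exists i; split; [apply in_seq; lia|]. apply in_map. apply in_zrange.
  rewrite <- abs_IZR. rewrite INR_IZR_INZ, Zabs2Nat.id_abs in Hk. exact Hk.
Qed.

Section Numbering.
Context (r : nat) (d1 d2 d3 d : R).
Context (Hr : (0 < r)%nat) (Hd : 0 < d) (H1 : d1 = 1 \/ d1 = -1)
  (H2 : d2 = 1 \/ d2 = -1) (H3 : d3 = 1 \/ d3 = -1) (Hodd : Nat.Odd r -> d3 = 1).

Lemma torus_shift_sqr m n b T : index_shift r d1 d2 d3 d (Torus m n b) T ^ 2 =
  (2 * PI * d) ^ 2 * (torus_al r d1 m ^ 2 + torus_be d2 n ^ 2).
Proof using.
  unfold index_shift. set (S := torus_al r d1 m ^ 2 + torus_be d2 n ^ 2).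
  assert (HS : 0 <= S) by (unfold S; pose proof (pow2_ge_0 (torus_al r d1 m)); pose proof (pow2_ge_0 (torus_be d2 n)); lra).
  transitivity ((sgR b * sgR b) * ((2 * PI * d) ^ 2 * (sqrt S * sqrt S))); [ring|].
  rewrite sgR_sqr, sqrt_sqrt by auto. ring.
Qed.

Lemma osc_shift_ge sg t i k T : 0 < T -> 2 * PI * fibre_freq d3 t / T <= Rabs (index_shift r d1 d2 d3 d (Osc sg t i k) T).
Proof using Hd.
  intros HT. pose proof (osc_shift_sqr r d1 d2 d3 d T Hd HT sg t i k) as E. cbv zeta in E.
  pose proof (osc_a_pos d3 t) as Ha. assert (Hom : 0 < 2 * PI * fibre_freq d3 t / T) by (apply Rdiv_lt_0_compat; auto).
  rewrite <- (Rabs_pos_eq (2 * PI * fibre_freq d3 t / T)) by lra. apply Rsqr_le_abs_0. unfold Rsqr.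
  pose proof (pos_INR (Z.abs_nat k)). assert (0 < d ^ 2) by (apply pow_lt; auto).
  assert (0 <= 2 * (2 * PI * fibre_freq d3 t) * INR (Z.abs_nat k) * d ^ 2) by (apply Rmult_le_pos; [apply Rmult_le_pos|]; lra).
  revert E. generalize (index_shift r d1 d2 d3 d (Osc sg t i k) T). intros nu E.
  apply Rle_trans with (nu ^ 2); [rewrite E|apply Req_le; ring].
  replace (2 * PI * fibre_freq d3 t / T * (2 * PI * fibre_freq d3 t / T)) with ((2 * PI * fibre_freq d3 t / T) ^ 2) by ring. lra.
Qed.

Lemma index_level_finite T mu : 0 < T -> exists l, NoDup l /\
  forall j, In j l <-> index_valid r d3 j /\ dirac_shift d T + index_shift r d1 d2 d3 d j T = mu.
Proof using Hr Hd.
  intros HT.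
  pose proof PI_RGT_0 as HPI. pose proof (INR_r_pos r Hr) as HL.
  (* [B1] bounds the torus frequencies, [B2] the fibre frequency and [B3] the Hermite level; the
     last uses that fibre frequencies are at least [1 / 2]. [B] adds these bounds together with the
     terms needed for [m] and [i], which are scaled by [r]. *)
  set (X := Rabs (mu - dirac_shift d T)). assert (HX : 0 <= X) by apply Rabs_pos.
  set (B1 := X / (2 * PI * d)). set (B2 := X * T / (2 * PI)). set (B3 := X ^ 2 / (2 * PI * d ^ 2)).
  assert (Hd2 : 0 < d ^ 2) by (apply pow_lt; auto).
  assert (P1 : 0 <= B1) by (apply Rdiv_le_0_compat; nra).
  assert (P2 : 0 <= B2) by (apply Rdiv_le_0_compat; nra).
  assert (P3 : 0 <= B3) by (apply Rdiv_le_0_compat; nra).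
  set (B := B1 * INR r + B1 + 1 + B2 + B2 * INR r + B3).
  assert (Q1 : 0 <= B1 * INR r) by nra. assert (Q2 : 0 <= B2 * INR r) by nra.
  assert (HB : 0 <= B) by (unfold B; lra).
  destruct (nfloor_ex B HB) as [M0 [_ HM]].
  apply (finite_set_list _ (index_box (S M0))). intros j [Hv Hj].
  assert (HM' : B <= INR (S M0)) by (rewrite S_INR; lra).
  destruct j as [m n b|sg t i k].
  - assert (E : X ^ 2 = (2 * PI * d) ^ 2 * (torus_al r d1 m ^ 2 + torus_be d2 n ^ 2)).
    { unfold X. rewrite pow2_abs. rewrite <- torus_shift_sqr with (b := b) (T := T). rewrite <- Hj. f_equal. ring. }
    assert (HC : 0 < 2 * PI * d) by nra.
    assert (E2 : B1 ^ 2 = torus_al r d1 m ^ 2 + torus_be d2 n ^ 2).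
    { unfold B1, Rdiv. rewrite Rpow_mult_distr, E, pow_inv. field. lra. }
    pose proof (pow2_ge_0 (torus_al r d1 m)). pose proof (pow2_ge_0 (torus_be d2 n)).
    assert (A1 : Rabs (torus_al r d1 m) <= B1).
    { rewrite <- (Rabs_pos_eq B1) by auto. apply Rsqr_le_abs_0. unfold Rsqr. simpl in *; lra. }
    assert (A2 : Rabs (torus_be d2 n) <= B1).
    { rewrite <- (Rabs_pos_eq B1) by auto. apply Rsqr_le_abs_0. unfold Rsqr. simpl in *; lra. }
    pose proof (phase_range d1). pose proof (phase_range d2).
    apply Rabs_le_between in A1, A2.
    apply in_index_box_torus; apply Rabs_le_between.
    + assert (EM : IZR m = torus_al r d1 m * INR r - phase d1) by (unfold torus_al; field; lra).
      rewrite EM. unfold B in HM'. nra.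
    + unfold torus_be in A2. unfold B in HM'. lra.
  - pose proof (osc_shift_ge sg t i k T HT) as A.
    pose proof (osc_shift_sqr r d1 d2 d3 d T Hd HT sg t i k) as E. cbv zeta in E.
    replace (index_shift r d1 d2 d3 d (Osc sg t i k) T) with (mu - dirac_shift d T) in A, E by lra.
    fold X in A. rewrite <- pow2_abs in E. fold X in E.
    pose proof (fibre_freq_ge d3 t) as Htv.
    assert (A2 : fibre_freq d3 t <= B2).
    { unfold B2. apply Rmult_le_reg_r with (2 * PI / T); [apply Rdiv_lt_0_compat; lra|].
      replace (X * T / (2 * PI) * (2 * PI / T)) with X by (field; lra).
      replace (fibre_freq d3 t * (2 * PI / T)) with (2 * PI * fibre_freq d3 t / T) by (field; lra). exact A. }
    pose proof (phase_range d3). simpl in Hv.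
    apply in_index_box_osc.
    + unfold fibre_freq in A2. unfold B in HM'. lra.
    + unfold B in HM'. assert (fibre_freq d3 t * INR r <= B2 * INR r) by (apply Rmult_le_compat_r; lra). lra.
    + set (K := INR (Z.abs_nat k)) in *. assert (HK : 0 <= K) by apply pos_INR.
      assert (A3 : K <= B3).
      { unfold B3. apply Rmult_le_reg_r with (2 * PI * d ^ 2); [nra|].
        replace (X ^ 2 / (2 * PI * d ^ 2) * (2 * PI * d ^ 2)) with (X ^ 2) by (field; lra).
        rewrite E. pose proof (pow2_ge_0 (2 * PI * fibre_freq d3 t / T)).
        assert (0 <= PI * K * d ^ 2) by (apply Rmult_le_pos; [apply Rmult_le_pos|]; lra).
        assert (PI * K * d ^ 2 * 1 <= PI * K * d ^ 2 * (2 * fibre_freq d3 t)) by (apply Rmult_le_compat_l; lra).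
        lra. }
      unfold B in HM'. lra.
Qed.

Lemma index_shift_continuous j T : 0 < T -> continuous (fun T => dirac_shift d T + index_shift r d1 d2 d3 d j T) T.
Proof using Hd.
  intros HT. apply continuous_Rplus.
  { apply @ex_derive_continuous. unfold dirac_shift. auto_derive; auto. }
  destruct j as [m n b|sg t i k]; unfold index_shift; [apply continuous_const|].
  apply continuous_Rmult; [apply continuous_const|].
  apply @ex_derive_continuous. auto_derive.
  pose proof (osc_a_pos d3 t) as Ha. split; [lra|split; auto].
  pose proof (fibre_freq_ge d3 t). pose proof (pos_INR (Z.abs_nat k)). assert (0 < d * (d * 1)) by nra.
  pose proof PI_RGT_0.
  assert (0 < 2 * PI * fibre_freq d3 t * / T) by (apply Rmult_lt_0_compat; [auto|now apply Rinv_0_lt_compat]).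
  apply Rplus_lt_le_0_compat; [nra|]. apply Rmult_le_pos; [apply Rmult_le_pos|]; nra.
Qed.

Lemma dirac_numbering_exists : exists ev, dirac_numbering r d1 d2 d3 d ev.
Proof using Hr Hd H1 H2 H3 Hodd.
  (* The indices [Osc true 0 0 n] are valid for every spin structure and show that there are
     infinitely many. *)
  destruct (enumerate index_code (index_valid r d3) (fun n => Osc true 0 0 (Z.of_nat n))) as [e [Einj Esurj]].
  - apply index_code_inj.
  - intros m n E. injection E. lia.
  - intros n. simpl. apply Rmult_lt_0_compat; [pose proof (fibre_freq_ge d3 0); lra|now apply INR_r_pos].
  - exists (fun j T => dirac_shift d T + index_shift r d1 d2 d3 d (e j) T). split.
    + intros j T HT. now apply index_shift_continuous.
    + intros T HT mu. destruct (index_level_finite T mu HT) as [l [Hl Hin]].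
      exists (length l). split.
      * eexists. now apply (heis_basis r d1 d2 d3 d T mu l).
      * destruct (choice (fun x n => index_valid r d3 x -> e n = x)) as [f Hf].
        { intros x. destruct (classic (index_valid r d3 x)) as [Hx|Hx].
          - apply Esurj in Hx. destruct Hx as [n Hn]. now exists n.
          - exists 0%nat. contradiction. }
        exists (map f l). split; [|split].
        -- apply NoDup_map_NoDup_ForallPairs; auto. intros x y Hx Hy E.
           apply Hin in Hx, Hy. rewrite <- (Hf x), <- (Hf y), E by tauto. reflexivity.
        -- apply length_map.
        -- intros j. rewrite in_map_iff. split.
           ++ intros [x [<- Hx]]. apply Hin in Hx. rewrite Hf by tauto. tauto.
           ++ intros E. assert (Hv : index_valid r d3 (e j)) by (apply Esurj; now exists j).
              exists (e j). split; [apply Einj, Hf, Hv|apply Hin; auto].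
Qed.

(** Without such an index the empty family would be a basis, contradicting positive dimension. *)
Lemma eigenvalue_index T mu n : 0 < T -> has_dim (heis_eigenspace r d1 d2 d3 d T mu) n -> (0 < n)%nat ->
  exists j, index_valid r d3 j /\ dirac_shift d T + index_shift r d1 d2 d3 d j T = mu.
Proof using Hr Hd H1 H2 H3 Hodd.
  intros HT [b [Hb1 Hb2]] Hn. apply NNPP; intros HN.
  destruct (heis_basis r d1 d2 d3 d T mu nil Hr Hd HT H1 H2 H3 Hodd (NoDup_nil _)) as [B1 _].
  { intros j; split; [intros []|]. intros Hj. apply HN. now exists j. }
  set (c := fun i : nat => RtoC 1).
  assert (E : heis_eigenspace r d1 d2 d3 d T mu (lincomb n c b)) by (apply Hb1; now exists c).
  apply B1 in E. destruct E as [c' E].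
  assert (c 0%nat = RtoC 0) as A by (apply (Hb2 c); auto).
  apply RtoC_inj in A. lra.
Qed.
End Numbering.

(** * Fibrewise constant spinors *)

(* The Dirac operator of the torus acts on fibrewise constant spinors only after conjugation by
   the Clifford action of the fibre direction. *)
Definition lift (sg : R * R -> spinor) (p : heis) : spinor := clifford 2 (sg (fst p)).

Definition clifford2_inv (s : spinor) : spinor := let '(u, v) := s in ((- Ci * u)%C, (Ci * v)%C).

Lemma clifford2_invK s : clifford2_inv (clifford 2 s) = s.
Proof. destruct s as [u v]. apply (f_equal2 pair); apply Ceq; unfold Re, Im; simpl; ring. Qed.

Lemma clifford2K s : clifford 2 (clifford2_inv s) = s.
Proof. destruct s as [u v]. apply (f_equal2 pair); apply Ceq; unfold Re, Im; simpl; ring. Qed.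

Lemma fst_clifford2 s : fst (clifford 2 s) = (Ci * fst s)%C.
Proof. now destruct s. Qed.

Lemma snd_clifford2 s : snd (clifford 2 s) = (- Ci * snd s)%C.
Proof. destruct s as [u v]. apply Ceq; unfold Re, Im; simpl; ring. Qed.

Lemma clifford2_scal c s : clifford 2 (scal c s) = scal c (clifford 2 s).
Proof.
  destruct s as [u v].
  change (((Ci * (c * u))%C, (- (Ci * (c * v)))%C) = ((c * (Ci * u))%C, (c * - (Ci * v))%C)).
  apply (f_equal2 pair); ring.
Qed.

Lemma clifford2_inj s s' : clifford 2 s = clifford 2 s' -> s = s'.
Proof. intros H. now rewrite <- (clifford2_invK s), H, clifford2_invK. Qed.

Notation torusM := (prod_NormedModule R_AbsRing R_NormedModule R_NormedModule).

Definition derivatives_with (f : R * R -> C) (D : R * R -> R * R -> C) : Prop :=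
  forall v p, is_derive (fun t : R => f (plus p (scal t v))) 0 (D v p).

Lemma lift_smooth (sg : R * R -> spinor) : smooth sg <-> smooth (lift sg).
Proof.
  split; intros H k; specialize (H k).
  - apply is_Ck_spinor.
    + apply (is_Ck_ext k (fun p : heis => (Ci * fst (sg (fst p)))%C)); [intros p; symmetry; apply fst_clifford2|].
      apply is_Ck_Cmult.
      apply (is_Ck_comp_linear (V := torusM) (W := C_R_NormedModule) fst k (fun q => fst (sg q))); [apply is_linear_fst|].
      now apply is_Ck_fst.
    + apply (is_Ck_ext k (fun p : heis => (- Ci * snd (sg (fst p)))%C)); [intros p; symmetry; apply snd_clifford2|].
      apply is_Ck_Cmult.
      apply (is_Ck_comp_linear (V := torusM) (W := C_R_NormedModule) fst k (fun q => snd (sg q))); [apply is_linear_fst|].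
      now apply is_Ck_snd.
  - assert (HL : is_linear (U := torusM) (V := prod_NormedModule R_AbsRing torusM R_NormedModule) (fun q => (q, 0))).
    { apply (is_linear_prod (T := torusM) (U := torusM) (V := R_NormedModule) (fun q => q) (fun q => zero)); [apply (is_linear_id (V := torusM))|apply (is_linear_zero (U := torusM) (V := R_NormedModule))]. }
    apply is_Ck_spinor.
    + apply (is_Ck_ext k (fun q : R * R => (- Ci * fst (lift sg (q, 0)))%C)); [intros q; unfold lift; rewrite ?fst_clifford2, ?snd_clifford2; cbn [fst]; apply Ceq; unfold Re, Im; simpl; ring|].
      apply is_Ck_Cmult.
      exact (is_Ck_comp_linear (V := prod_NormedModule R_AbsRing torusM R_NormedModule) (W := C_R_NormedModule)
        (fun q : R * R => (q, 0)) k (fun p => fst (lift sg p)) HL (is_Ck_fst k _ H)).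
    + apply (is_Ck_ext k (fun q : R * R => (Ci * snd (lift sg (q, 0)))%C)); [intros q; unfold lift; rewrite ?fst_clifford2, ?snd_clifford2; cbn [fst]; apply Ceq; unfold Re, Im; simpl; ring|].
      apply is_Ck_Cmult.
      exact (is_Ck_comp_linear (V := prod_NormedModule R_AbsRing torusM R_NormedModule) (W := C_R_NormedModule)
        (fun q : R * R => (q, 0)) k (fun p => snd (lift sg p)) HL (is_Ck_snd k _ H)).
Qed.

Lemma derivatives_with_opp f D v p : derivatives_with f D -> D (opp v) p = (- D v p)%C.
Proof.
  intros H. refine (is_derive_C_unique _ _ _ _ (H (opp v) p) _).
  apply (is_derive_ext (fun t : R => f (plus p (scal (- t) v)))).
  { intros t. do 2 f_equal. destruct v as [v1 v2].
    change ((- t * v1, - t * v2) = (t * - v1, t * - v2)). apply (f_equal2 pair); ring. }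
  pose proof (H v p) as Hv. replace 0 with (- 0) in Hv by ring.
  pose proof (is_derive_comp (V := C_R_NormedModule) (fun t => f (plus p (scal t v))) (fun t => - t) 0 (D v p) (-1) Hv) as H0.
  replace (- D v p)%C with (scal (-1) (D v p) : C_R_NormedModule).
  - apply H0. replace (-1) with (- (1)) by ring. apply is_derive_Ropp, is_derive_Rid.
  - destruct (D v p) as [a b]. change ((-1 * a, -1 * b) = (- a, - b)). apply (f_equal2 pair); ring.
Qed.

Lemma derivatives_with_zero f D p : derivatives_with f D -> D (0, 0) p = RtoC 0.
Proof.
  intros H. pose proof (derivatives_with_opp f D (0, 0) p H) as E.
  replace (opp (0, 0)) with (0, 0) in E by (change ((0, 0) = (- 0, - 0)); now rewrite Ropp_0).
  destruct (D (0, 0) p) as [a b]. injection E as E1 E2. apply (f_equal2 pair); lra.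
Qed.

(** The frame on the group projects to the negative of the frame on the torus. Clifford
    multiplication by [e_3] anticommutes with [e_1] and [e_2], so conjugating by it restores the
    sign. *)
Lemma lift_dirac d T sg p : d <> 0 -> T <> 0 -> smooth sg ->
  heis_dirac d T (lift sg) p =
  plus (clifford 2 (torus_dirac d sg (fst p))) (scal (RtoC (dirac_shift d T)) (lift sg p)).
Proof.
  intros Hd HT Hs.
  pose proof (proj1 (lift_smooth sg) Hs) as Hl.
  destruct (is_Ck_fst 1 sg (Hs 1%nat)) as [_ A1]. destruct (is_Ck_snd 1 sg (Hs 1%nat)) as [_ B1].
  destruct (choice _ A1) as [Da HA]. destruct (choice _ B1) as [Db HB]. clear A1 B1.
  assert (A : derivatives_with (fun q => fst (sg q)) Da) by (intros v q; apply (HA v)).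
  assert (B : derivatives_with (fun q => snd (sg q)) Db) by (intros v q; apply (HB v)).
  assert (Ac : forall v q, continuous (Da v) q) by (intros v q; apply (HA v)).
  assert (Bc : forall v q, continuous (Db v) q) by (intros v q; apply (HB v)).
  assert (TD : forall v q, torus_derivative v sg q = (Da v q, Db v q)).
  { intros v q. apply derive_spinor_eq.
    apply (is_derive_ext (fun t => (fst (sg (plus q (scal t v))), snd (sg (plus q (scal t v)))))).
    - intros t. symmetry. apply surjective_pairing.
    - exact (is_derive_pair (V := C_R_NormedModule) (W := C_R_NormedModule) _ _ _ _ _ (A v q) (B v q)). }
  assert (U : C1_with (fun p => fst (lift sg p)) (fun v p => (Ci * Da (fst v) (fst p))%C)).
  { split; [|split].
    - intros q. destruct (is_Ck_fst 0 _ (Hl 0%nat)) as [H _]. apply H.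
    - intros v q. apply (continuous_Cmult (fun _ => Ci) (fun p : heis => Da (fst v) (fst p))); [apply continuous_const|].
      apply (continuous_comp (V := prod_UniformSpace R_UniformSpace R_UniformSpace) (fun p : heis => fst p) (Da (fst v))); [|apply Ac].
      apply (continuous_fst (U := prod_UniformSpace R_UniformSpace R_UniformSpace) (V := R_UniformSpace)).
    - intros v q.
      apply (is_derive_ext (fun t : R => (Ci * fst (sg (plus (fst q) (scal t (fst v)))))%C)).
      + intros t. unfold lift. change (fst (plus q (scal t v))) with (plus (fst q) (scal t (fst v))).
        symmetry; apply fst_clifford2.
      + apply (is_derive_linear (V := C_R_NormedModule) (W := C_R_NormedModule) (Cmult Ci)); [apply is_linear_Cmult|apply A]. }
  assert (V : C1_with (fun p => snd (lift sg p)) (fun v p => (- Ci * Db (fst v) (fst p))%C)).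
  { split; [|split].
    - intros q. destruct (is_Ck_snd 0 _ (Hl 0%nat)) as [H _]. apply H.
    - intros v q. apply (continuous_Cmult (fun _ => (- Ci)%C) (fun p : heis => Db (fst v) (fst p))); [apply continuous_const|].
      apply (continuous_comp (V := prod_UniformSpace R_UniformSpace R_UniformSpace) (fun p : heis => fst p) (Db (fst v))); [|apply Bc].
      apply (continuous_fst (U := prod_UniformSpace R_UniformSpace R_UniformSpace) (V := R_UniformSpace)).
    - intros v q.
      apply (is_derive_ext (fun t : R => (- Ci * snd (sg (plus (fst q) (scal t (fst v)))))%C)).
      + intros t. unfold lift. change (fst (plus q (scal t v))) with (plus (fst q) (scal t (fst v))).
        symmetry; apply snd_clifford2.
      + apply (is_derive_linear (V := C_R_NormedModule) (W := C_R_NormedModule) (Cmult (- Ci)%C)); [apply is_linear_Cmult|apply B]. }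
  destruct p as [[x y] z].
  pose proof (heis_dirac_formula d T (lift sg) _ _ x y z Hd HT U V) as F. cbv zeta in F.
  refine (eq_trans F _). clear F.
  unfold torus_dirac. rewrite !TD. cbn [fst].
  unfold frameX, frameY, frameZ. cbn [fst].
  assert (X1 : Da (- d, 0) (x, y) = (- Da (d, 0) (x, y))%C).
  { rewrite <- (derivatives_with_opp _ Da (d, 0) (x, y) A). f_equal. apply (f_equal2 pair); [reflexivity|symmetry; apply Ropp_0]. }
  assert (X2 : Db (- d, 0) (x, y) = (- Db (d, 0) (x, y))%C).
  { rewrite <- (derivatives_with_opp _ Db (d, 0) (x, y) B). f_equal. apply (f_equal2 pair); [reflexivity|symmetry; apply Ropp_0]. }
  assert (Y1 : Da (0, - d) (x, y) = (- Da (0, d) (x, y))%C).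
  { rewrite <- (derivatives_with_opp _ Da (0, d) (x, y) A). f_equal. apply (f_equal2 pair); [symmetry; apply Ropp_0|reflexivity]. }
  assert (Y2 : Db (0, - d) (x, y) = (- Db (0, d) (x, y))%C).
  { rewrite <- (derivatives_with_opp _ Db (0, d) (x, y) B). f_equal. apply (f_equal2 pair); [symmetry; apply Ropp_0|reflexivity]. }
  rewrite X1, X2, Y1, Y2, (derivatives_with_zero _ _ _ A), (derivatives_with_zero _ _ _ B).
  unfold lift. cbn [fst]. generalize (Da (d, 0) (x, y)) (Da (0, d) (x, y)) (Db (d, 0) (x, y)) (Db (0, d) (x, y)).
  intros a1 a2 b1 b2. destruct (sg (x, y)) as [u v]. clear.
  set (c := RtoC (dirac_shift d T)).
  apply (f_equal2 pair).
  - change (fst (clifford 2 (u, v))) with (Ci * u)%C.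
    match goal with |- ?l = _ => change (l = (Ci * (Ci * b1 + b2) + c * (Ci * u))%C) end.
    unfold c. eqC; ring.
  - change (snd (clifford 2 (u, v))) with (- (Ci * v))%C.
    match goal with |- ?l = _ => change (l = (- (Ci * (Ci * a1 + - a2)) + c * - (Ci * v))%C) end.
    unfold c. eqC; ring.
Qed.

Lemma lift_eigenspace r d1 d2 d T mu sg : d <> 0 -> T <> 0 ->
  torus_eigenspace r d1 d2 d mu sg <-> heis_eigenspace r d1 d2 1 d T (mu + dirac_shift d T) (lift sg).
Proof.
  intros Hd HT.
  assert (K : forall p, plus (clifford 2 (scal (RtoC mu) (sg (fst p)))) (scal (RtoC (dirac_shift d T)) (lift sg p)) =
    scal (RtoC (mu + dirac_shift d T)) (lift sg p)).
  { intros p. rewrite clifford2_scal. fold (lift sg p). rewrite RtoC_plus. symmetry.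
    exact (scal_distr_r (K := C_AbsRing) _ _ _). }
  assert (P1 : forall z, powerRZ 1 z = 1).
  { intros z. destruct z; simpl; rewrite ?pow1; auto. apply Rinv_1. }
  split.
  - intros [S [Q D]]. split; [now apply lift_smooth|split].
    + intros x y z [[px py] pz]. unfold lift. rewrite P1, Rmult_1_r, <- clifford2_scal. f_equal.
      exact (Q x y (px, py)).
    + intros p. refine (eq_trans (lift_dirac d T sg p Hd HT S) _). rewrite D. apply K.
  - intros [S [Q D]]. apply lift_smooth in S. split; [exact S|split].
    + intros x y [px py]. specialize (Q x y 0%Z (px, py, 0)). unfold lift in Q.
      rewrite P1, Rmult_1_r, <- clifford2_scal in Q. now apply clifford2_inj in Q.
    + intros [px py]. specialize (D (px, py, 0)). pose proof (eq_trans (eq_sym (lift_dirac d T sg (px, py, 0) Hd HT S)) D) as E.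
      rewrite <- K in E. 
      pose proof (plus_reg_r (G := prod_AbelianGroup C_AbelianGroup C_AbelianGroup) _ _ _ E) as E'.
      now apply clifford2_inj in E'.
Qed.

Lemma lincomb_clifford2_inv {A : Type} n c (b : nat -> A -> spinor) {B : Type} (g : B -> A) q :
  lincomb n c (fun m q => clifford2_inv (b m (g q))) q = clifford2_inv (lincomb n c b (g q)).
Proof.
  induction n as [|n IH]; simpl.
  - apply (f_equal2 pair); apply Ceq; unfold Re, Im; simpl; ring.
  - rewrite IH. destruct (lincomb n c b (g q)) as [u v], (b n (g q)) as [u' v'].
    set (k := c n).
    change (((- Ci * u + k * (- Ci * u'))%C, (Ci * v + k * (Ci * v'))%C) =
      ((- Ci * (u + k * u'))%C, (Ci * (v + k * v'))%C)). apply (f_equal2 pair); ring.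
Qed.

Lemma lincomb_fibre n c (b : nat -> heis -> spinor) : (forall m, (m < n)%nat -> forall q z, b m (q, z) = b m (q, 0)) ->
  forall q z, lincomb n c b (q, z) = lincomb n c b (q, 0).
Proof.
  intros H q z; induction n as [|n IH]; simpl; auto.
  rewrite IH, H; auto.
Qed.

Lemma has_dim_nonzero {A : Type} (E : (A -> spinor) -> Prop) n : has_dim E n -> (0 < n)%nat ->
  exists s, E s /\ exists p, s p <> zero.
Proof.
  intros [b [Hb1 Hb2]] Hn. set (c := fun i : nat => RtoC 1). exists (lincomb n c b).
  split; [apply Hb1; now exists c|].
  apply not_all_ex_not; intros H. assert (A0 : c 0%nat = RtoC 0) by now apply (Hb2 c).
  apply RtoC_inj in A0. lra.
Qed.

Section Fibre.
Context (r : nat) (d1 d2 d T mu : R) (Hr : (0 < r)%nat) (Hd : 0 < d) (HT : 0 < T)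
  (H1 : d1 = 1 \/ d1 = -1) (H2 : d2 = 1 \/ d2 = -1) (Hmu : Rabs mu < PI / T).

(** Oscillator indices have shifts of absolute value at least [pi / T], so the bound on [mu] leaves
    only torus indices in the basis, and their sections do not depend on [z]. *)
Lemma small_eigensection_fibre s : heis_eigenspace r d1 d2 1 d T (mu + dirac_shift d T) s ->
  forall q z, s (q, z) = s (q, 0).
Proof using Hr Hd HT H1 H2 Hmu.
  intros Hs. destruct (index_level_finite r d1 d2 1 d Hr Hd T (mu + dirac_shift d T) HT) as [l [Hl Hin]].
  destruct (heis_basis r d1 d2 1 d T (mu + dirac_shift d T) l) as [B _]; auto.
  apply B in Hs. destruct Hs as [c Hc]. intros q z. rewrite !Hc. apply lincomb_fibre.
  intros m Hm q' z'. assert (Hj : In (nth m l (Torus 0 0 true)) l) by now apply nth_In.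
  apply Hin in Hj. destruct Hj as [_ Hj]. destruct (nth m l (Torus 0 0 true)) as [m' n' b'|sg t i k].
  - now destruct q'.
  - exfalso. pose proof (osc_shift_ge r d1 d2 1 d Hd sg t i k T HT) as G.
    replace (index_shift r d1 d2 1 d (Osc sg t i k) T) with mu in G by lra.
    pose proof (fibre_freq_ge 1 t). pose proof PI_RGT_0.
    assert (PI / T <= 2 * PI * fibre_freq 1 t / T); [|lra].
    apply Rmult_le_compat_r; [left; now apply Rinv_0_lt_compat|nra].
Qed.

(** The torus spectrum is not computed separately: lifting identifies the torus eigenspace with the
    space of fibrewise constant eigensections, which for small [mu] is the whole eigenspace on the
    Heisenberg manifold. *)
Lemma torus_has_dim n : has_dim (heis_eigenspace r d1 d2 1 d T (mu + dirac_shift d T)) n ->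
  has_dim (torus_eigenspace r d1 d2 d mu) n.
Proof using Hr Hd HT H1 H2 Hmu.
  intros [b [Hb1 Hb2]].
  assert (Z : forall c q z, lincomb n c b (q, z) = lincomb n c b (q, 0)).
  { intros c. apply small_eigensection_fibre. apply Hb1. now exists c. }
  exists (fun m (q : R * R) => clifford2_inv (b m (q, 0))). 
  assert (L : forall c q, lincomb n c (fun m (q : R * R) => clifford2_inv (b m (q, 0))) q = clifford2_inv (lincomb n c b (q, 0))).
  { intros c q. exact (lincomb_clifford2_inv n c b (fun q : R * R => (q, 0)) q). }
  split.
  - intros sg. rewrite (lift_eigenspace r d1 d2 d T) by lra. rewrite Hb1.
    split; intros [c Hc]; exists c.
    + intros q. rewrite L, <- Hc. symmetry. apply clifford2_invK.
    + intros [q z]. rewrite Z. unfold lift. cbn [fst]. rewrite Hc, L. apply clifford2K.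
  - intros c Hc. apply Hb2. intros [q z]. rewrite Z. specialize (Hc q). rewrite L in Hc.
    rewrite <- (clifford2K (lincomb n c b (q, 0))), Hc. apply (f_equal2 pair); apply Ceq; unfold Re, Im; simpl; ring.
Qed.
End Fibre.

(** * Collapse *)

Lemma IVT_pos (f : R -> R) a b y T0 : (forall t, 0 < t -> continuous f t) -> 0 < a <= T0 -> 0 < b <= T0 ->
  f a <= y <= f b -> exists t, 0 < t <= T0 /\ f t = y.
Proof.
  intros Hf Ha Hb Hy.
  assert (Hc : forall t, 0 < t -> continuity_pt f t) by (intros; now apply continuity_pt_filterlim, Hf).
  destruct (Rtotal_order a b) as [H|[H|H]].
  - destruct (f_interv_is_interv f a b y H Hy) as [t [Ht E]]; [intros; apply Hc; lra|]. exists t; split; [lra|exact E].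
  - subst b. exists a; split; lra.
  - destruct (f_interv_is_interv (fun t => - f t) b a (- y) H) as [t [Ht E]].
    + lra.
    + intros; apply (continuity_pt_opp f), Hc; lra.
    + exists t; split; lra.
Qed.

Lemma IVT_between (f : R -> R) a b y T0 : (forall t, 0 < t -> continuous f t) -> 0 < a <= T0 -> 0 < b <= T0 ->
  f a <= y <= f b \/ f b <= y <= f a -> exists t, 0 < t <= T0 /\ f t = y.
Proof. intros Hf Ha Hb [H|H]; [now apply (IVT_pos f a b)|now apply (IVT_pos f b a)]. Qed.

(** Integrality is known only below the barrier [B]. If the value changed, the intermediate value
    theorem would produce a value near [g T1] that is below the barrier and strictly between
    integers. *)
Lemma between_integers_constant (g : R -> R) T0 B : 0 < T0 -> (forall t, 0 < t -> continuous g t) ->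
  (forall T, 0 < T <= T0 -> g T < B -> exists N : Z, g T = IZR N) ->
  forall T1 T2, 0 < T1 <= T0 -> 0 < T2 <= T0 -> g T1 < B -> g T2 = g T1.
Proof.
  intros H0 Hg HI T1 T2 H1 H2 HB. destruct (HI T1 H1 HB) as [N HN].
  assert (Key : forall v, (g T1 <= v <= g T2 \/ g T2 <= v <= g T1) -> v < B -> (IZR N < v < IZR N + 1 \/ IZR N - 1 < v < IZR N) -> False).
  { intros v Hv HvB Hv2. destruct (IVT_between g T1 T2 v T0 Hg H1 H2 Hv) as [T [HT E]].
    destruct (HI T HT) as [M HM]; [lra|]. rewrite <- E, HM in Hv2. rewrite <- plus_IZR, <- minus_IZR in Hv2.
    destruct Hv2 as [[A1 A2]|[A1 A2]]; apply lt_IZR in A1, A2; lia. }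
  destruct (Rtotal_order (g T2) (g T1)) as [H|[H|H]]; auto; exfalso.
  - apply (Key (g T1 - Rmin (1 / 2) (g T1 - g T2))).
    + right. pose proof (Rmin_r (1 / 2) (g T1 - g T2)). pose proof (Rmin_glb (1/2) (g T1 - g T2) 0); lra.
    + pose proof (Rmin_glb (1/2) (g T1 - g T2) 0); lra.
    + right. pose proof (Rmin_l (1 / 2) (g T1 - g T2)). pose proof (Rmin_glb_lt (1/2) (g T1 - g T2) 0); lra.
  (* The step stays below the next integer, does not pass the value [g T2], and keeps clear of the
     barrier. *)
  - set (e := Rmin (1 / 2) (Rmin (g T2 - g T1) ((B - g T1) / 2))).
    assert (E0 : 0 < e) by (repeat apply Rmin_glb_lt; lra).
    assert (E1 : e <= 1 / 2) by apply Rmin_l.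
    assert (E2 : e <= g T2 - g T1) by (eapply Rle_trans; [apply Rmin_r|apply Rmin_l]).
    assert (E3 : e <= (B - g T1) / 2) by (eapply Rle_trans; [apply Rmin_r|apply Rmin_r]).
    apply (Key (g T1 + e)); lra.
Qed.

Lemma at_right_0_intro (P : R -> Prop) e : 0 < e -> (forall T, 0 < T < e -> P T) -> at_right 0 P.
Proof.
  intros He H. exists (mkposreal e He). intros T HT HT0. apply H. split; auto.
  change (Rabs (T - 0) < e) in HT. rewrite Rabs_pos_eq in HT; lra.
Qed.

Lemma continuous_at_right_0 (g : R -> R) : continuous g 0 -> filterlim g (at_right 0) (locally (g 0)).
Proof. intros H P HP. destruct (H P HP) as [e He]. exists e. intros y Hy _. exact (He y Hy). Qed.

Lemma inv_large M T : 0 < M -> 0 < T < PI / M -> M < PI / T.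
Proof.
  intros HM [HT H]. apply (Rmult_lt_reg_r T); auto. unfold Rdiv. rewrite Rmult_assoc, Rinv_l, Rmult_1_r by lra.
  apply (Rmult_lt_compat_l M) in H; auto. replace (M * (PI / M)) with PI in H by (field; lra). lra.
Qed.

Section Collapse.
Context (r : nat) (d1 d2 d3 d : R) (Hr : (0 < r)%nat) (Hd : 0 < d) (H1 : d1 = 1 \/ d1 = -1)
  (H2 : d2 = 1 \/ d2 = -1) (H3 : d3 = 1 \/ d3 = -1) (Hodd : Nat.Odd r -> d3 = 1)
  (ev : nat -> R -> R) (Hev : dirac_numbering r d1 d2 d3 d ev) (j : nat).

Local Notation f T := (ev j T - dirac_shift d T).
Local Notation norm T := ((f T * INR r / (PI * d)) ^ 2).

Lemma twice_phase e : exists b : Z, 2 * phase e = IZR b.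
Proof using. unfold phase. destruct Req_EM_T; [exists 0%Z|exists 1%Z]; lra. Qed.

(** The scaling by [r / (pi d)] clears all denominators: at a torus value it gives
    [(2 r al)^2 + r^2 (2 be)^2], where [2 r al] and [2 be] are integers for every spin structure. *)
Lemma branch_value T : 0 < T -> (d3 = 1 /\ exists N : Z, norm T = IZR N) \/ PI / T <= Rabs (f T).
Proof using Hr Hd H1 H2 H3 Hodd Hev.
  intros HT. destruct Hev as [_ He]. destruct (He T HT (ev j T)) as [n [Hn [l [_ [Hl Hin]]]]].
  assert (Hp : (0 < n)%nat).
  { assert (Hj : In j l) by now apply Hin. destruct l; [destruct Hj|simpl in Hl; lia]. }
  destruct (eigenvalue_index r d1 d2 d3 d Hr Hd H1 H2 H3 Hodd T (ev j T) n HT Hn Hp) as [i [Hi E]].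
  pose proof PI_RGT_0 as HPI.
  destruct i as [m k b|sg t i k].
  - left. split; [exact Hi|].
    pose proof (INR_r_pos r Hr) as HL.
    destruct (twice_phase d1) as [b1 Hb1], (twice_phase d2) as [b2 Hb2].
    exists ((b1 + 2 * m) * (b1 + 2 * m) + Z.of_nat r * Z.of_nat r * ((b2 + 2 * k) * (b2 + 2 * k)))%Z.
    pose proof (torus_shift_sqr r d1 d2 d3 d m k b T) as S.
    replace (index_shift r d1 d2 d3 d (Torus m k b) T) with (f T) in S by lra.
    replace ((f T * INR r / (PI * d)) ^ 2) with ((f T) ^ 2 * (INR r / (PI * d)) ^ 2) by (field; lra).
    rewrite S. rewrite !plus_IZR, !mult_IZR, !plus_IZR, !mult_IZR, <- Hb1, <- Hb2, <- INR_IZR_INZ.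
    unfold torus_al, torus_be. field. lra.
  - right. pose proof (osc_shift_ge r d1 d2 d3 d Hd sg t i k T HT) as G.
    replace (index_shift r d1 d2 d3 d (Osc sg t i k) T) with (f T) in G by lra.
    pose proof (fibre_freq_ge d3 t).
    assert (PI / T <= 2 * PI * fibre_freq d3 t / T); [|lra].
    apply Rmult_le_compat_r; [left; now apply Rinv_0_lt_compat|nra].
Qed.

Lemma branch_continuous T : 0 < T -> continuous (fun T => f T) T.
Proof using Hev.
  intros HT. apply (continuous_Rminus (ev j) (dirac_shift d)); [now apply Hev|].
  apply @ex_derive_continuous. unfold dirac_shift. auto_derive; auto.
Qed.

Lemma branch_norm_continuous T : 0 < T -> continuous (fun T => norm T) T.
Proof using Hev.
  intros HT. apply (continuous_ext (fun T => (INR r / (PI * d)) ^ 2 * (f T * f T))).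
  { intros t. unfold Rdiv. eqR; ring. }
  apply continuous_Rmult; [apply continuous_const|].
  apply (continuous_Rmult (fun T => f T) (fun T => f T)); now apply branch_continuous.
Qed.

Lemma branch_norm_ge T B : 0 <= B -> B <= Rabs (f T) -> (B * INR r / (PI * d)) ^ 2 <= norm T.
Proof using Hr Hd.
  intros HB H. pose proof PI_RGT_0. pose proof (INR_r_pos r Hr).
  assert (HC : 0 < INR r / (PI * d)) by (apply Rdiv_lt_0_compat; nra).
  rewrite <- (pow2_abs (f T * INR r / (PI * d))). apply pow_incr. split.
  - unfold Rdiv in *. rewrite Rmult_assoc. apply Rmult_le_pos; lra.
  - unfold Rdiv in *. rewrite !Rmult_assoc, (Rabs_mult (f T)), (Rabs_pos_eq (INR r * _)) by lra.
    apply Rmult_le_compat_r; lra.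
Qed.

(** On [(0, T0]] oscillator values stay above [pi / T0], so below that barrier the scaled square is
    an integer and cannot move. The branch is then constant up to sign. *)
Lemma branch_constant T0 T1 T2 : 0 < T1 <= T0 -> 0 < T2 <= T0 -> Rabs (f T1) < PI / T0 -> f T2 = f T1.
Proof using Hr Hd H1 H2 H3 Hodd Hev.
  intros HT1 HT2 HB. assert (HT0 : 0 < T0) by lra.
  pose proof PI_RGT_0 as HPI. pose proof (INR_r_pos r Hr) as HL.
  assert (HC : 0 < INR r / (PI * d)) by (apply Rdiv_lt_0_compat; nra).
  assert (HP : 0 <= PI / T0) by (apply Rdiv_le_0_compat; lra).
  assert (Hn : forall T, 0 < T <= T0 -> norm T = norm T1).
  { intros T HT.
    refine (between_integers_constant (fun T => norm T) T0 ((PI / T0 * INR r / (PI * d)) ^ 2) HT0 branch_norm_continuous _ T1 T HT1 HT _).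
    - intros T' HT' HN. destruct (branch_value T') as [[_ E]|E]; [lra|exact E|exfalso].
      assert (PI / T0 <= PI / T') by (apply Rmult_le_compat_l; [lra|apply Rinv_le_contravar; lra]).
      pose proof (branch_norm_ge T' (PI / T0) HP). lra.
    - cbv beta. rewrite <- (pow2_abs (f T1 * INR r / (PI * d))).
      unfold Rdiv in *. rewrite !Rmult_assoc, (Rabs_mult (f T1)), (Rabs_pos_eq (INR r * _)) by lra.
      assert (Rabs (f T1) * (INR r * / (PI * d)) < PI * / T0 * (INR r * / (PI * d))) by (apply Rmult_lt_compat_r; lra).
      assert (0 <= Rabs (f T1) * (INR r * / (PI * d))) by (apply Rmult_le_pos; [apply Rabs_pos|lra]).
      rewrite <- Rmult_assoc. simpl. rewrite !Rmult_1_r. nra. }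
  assert (Hs : forall T, 0 < T <= T0 -> (f T) ^ 2 = (f T1) ^ 2).
  { intros T HT. specialize (Hn T HT). cbv beta in Hn.
    assert (HC2 : 0 < (INR r / (PI * d)) ^ 2) by now apply pow_lt.
    apply Rmult_eq_reg_r with ((INR r / (PI * d)) ^ 2); [|lra].
    rewrite <- !Rpow_mult_distr. unfold Rdiv in *. rewrite <- !Rmult_assoc. exact Hn. }
  destruct (Req_dec (f T2) (f T1)) as [E|E]; auto.
  assert (E2 : f T2 = - f T1).
  { pose proof (Hs T2 HT2) as Q. assert ((f T2 - f T1) * (f T2 + f T1) = 0) by (ring_simplify; lra).
    apply Rmult_integral in H. lra. }
  (* A change of sign would force a zero in between; as the square is constant, the branch would be
     zero throughout. *)
  destruct (IVT_between (fun T => f T) T1 T2 0 T0 branch_continuous HT1 HT2) as [T [HT Z]]; [cbv beta; lra|].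
  cbv beta in Z. pose proof (Hs T HT) as Q. rewrite Z in Q. assert (f T1 = 0); [|lra].
  simpl in Q. apply Rsqr_0_uniq. unfold Rsqr. lra.
Qed.

Lemma branch_limit T0 T1 : 0 < T1 <= T0 -> Rabs (f T1) < PI / T0 -> collapse_limit (ev j) (f T1).
Proof using Hr Hd H1 H2 H3 Hodd Hev.
  intros HT1 HB. set (c := f T1) in *. unfold collapse_limit.
  assert (L : filterlim (fun T => c + dirac_shift d T) (at_right 0) (Rbar_locally c)).
  { assert (C : continuous (fun T => c + dirac_shift d T) 0).
    { apply @ex_derive_continuous. unfold dirac_shift. auto_derive; auto. }
    apply continuous_at_right_0 in C. cbv beta in C.
    replace (c + dirac_shift d 0) with c in C by (unfold dirac_shift; field). exact C. }
  refine (filterlim_ext_loc _ _ _ L).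
  apply at_right_0_intro with T0; [lra|]. intros T HT.
  assert (E : f T = c) by (apply (branch_constant T0 T1 T); auto; lra). lra.
Qed.

(** The choice of [T0] puts the barrier [pi / T0] one unit above [|mu|]. A branch tending to [mu] is
    eventually within 1 of it after the shift, hence below the barrier, hence constant all the way
    up to [T0]. Counting limits becomes counting eigenvalues at [T0]. *)
Lemma branch_limit_iff mu T0 : T0 = PI / (Rabs mu + 1) ->
  collapse_limit (ev j) mu <-> ev j T0 = mu + dirac_shift d T0.
Proof using Hr Hd H1 H2 H3 Hodd Hev.
  intros ET. pose proof PI_RGT_0 as HPI. pose proof (Rabs_pos mu) as Hm.
  assert (HT0 : 0 < T0) by (subst; apply Rdiv_lt_0_compat; lra).
  assert (EP : PI / T0 = Rabs mu + 1) by (subst; field; lra).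
  split.
  - intros HL.
    assert (HF : filterlim (fun T => f T) (at_right 0) (locally mu)).
    { replace mu with (mu + - dirac_shift d 0) by (unfold dirac_shift; field).
      apply (filterlim_comp_2 (G := locally mu) (H := locally (- dirac_shift d 0)) (ev j) (fun T => - dirac_shift d T) Rplus).
      - exact HL.
      - apply (continuous_at_right_0 (fun T => - dirac_shift d T)).
        apply @ex_derive_continuous. unfold dirac_shift. auto_derive; auto.
      - exact (filterlim_plus (K := R_AbsRing) (V := R_NormedModule) mu (- dirac_shift d 0)). }
    destruct (HF (fun x => Rabs (x - mu) < 1)) as [e He].
    { exists (mkposreal 1 Rlt_0_1). intros y Hy. exact Hy. }
    set (T1 := Rmin (e / 2) T0). pose proof (cond_pos e) as Hep.
    assert (HT1 : 0 < T1 <= T0) by (split; [apply Rmin_glb_lt; lra|apply Rmin_r]).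
    assert (HT1e : T1 <= e / 2) by apply Rmin_l.
    assert (A : Rabs (f T1 - mu) < 1).
    { apply (He T1); [|lra]. change (Rabs (T1 - 0) < e). rewrite Rabs_pos_eq; lra. }
    assert (HB : Rabs (f T1) < PI / T0).
    { rewrite EP. replace (f T1) with ((f T1 - mu) + mu) by ring. pose proof (Rabs_triang (f T1 - mu) mu). lra. }
    pose proof (branch_limit T0 T1 HT1 HB) as HL1.
    assert (E : f T1 = mu) by exact (filterlim_locally_unique (K := R_AbsRing) (V := R_NormedModule) (F := at_right 0) (ev j) (f T1) mu HL1 HL).
    pose proof (branch_constant T0 T1 T0 HT1 ltac:(lra) HB). lra.
  - intros E. assert (E' : f T0 = mu) by lra.
    pose proof (branch_limit T0 T0) as L. rewrite E' in L. apply L; [lra|rewrite EP; lra].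
Qed.

(** A shifted branch that stays above [pi / T] in absolute value has no zero, so it keeps its sign
    by continuity. *)
Lemma branch_infinite : (forall T, 0 < T -> PI / T <= Rabs (f T)) -> collapse_infinite (ev j).
Proof using Hd Hev.
  intros HB. pose proof PI_RGT_0 as HPI.
  assert (HS : forall T T', 0 < T -> 0 < T' -> f T <= 0 <= f T' -> False).
  { intros T T' HT HT' H.
    destruct (IVT_between (fun T => f T) T T' 0 (Rmax T T') branch_continuous) as [T2 [HT2 Z]].
    - split; [auto|apply Rmax_l].
    - split; [auto|apply Rmax_r].
    - now left.
    - cbv beta in Z. specialize (HB T2 (proj1 HT2)). rewrite Z, Rabs_R0 in HB.
      assert (0 < PI / T2) by (apply Rdiv_lt_0_compat; lra). lra. }
  assert (Hd2 : 0 < d ^ 2) by now apply pow_lt.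
  destruct (Rle_dec 0 (f 1)) as [H|H]; [left|right]; intros P [M HM]; pose proof (Rabs_pos M) as HA; pose proof (Rle_abs M) as HA2;
    pose proof (Rle_abs (- M)) as HA3; rewrite Rabs_Ropp in HA3.
  - apply at_right_0_intro with (PI / (Rabs M + 1)); [apply Rdiv_lt_0_compat; lra|].
    intros T HT. apply HM. pose proof (inv_large (Rabs M + 1) T ltac:(lra) HT) as L.
    specialize (HB T (proj1 HT)).
    assert (0 < f T) by (apply Rnot_le_lt; intros N; apply (HS T 1); lra).
    rewrite Rabs_pos_eq in HB by lra.
    assert (0 <= dirac_shift d T) by (unfold dirac_shift; nra). lra.
  (* Towards minus infinity the positive shift works against the estimate; for [T <= 1] it is at
     most [d^2 / 4]. *)
  - set (K := Rabs M + 1 + d ^ 2 / 4). assert (HK : 0 < K) by (unfold K; lra).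
    apply at_right_0_intro with (Rmin 1 (PI / K)); [apply Rmin_glb_lt; [lra|apply Rdiv_lt_0_compat; lra]|].
    intros T HT. apply HM. pose proof (Rmin_l 1 (PI / K)). pose proof (Rmin_r 1 (PI / K)).
    pose proof (inv_large K T HK ltac:(lra)) as L.
    specialize (HB T (proj1 HT)).
    assert (f T < 0) by (apply Rnot_le_lt; intros N; apply (HS 1 T); lra).
    rewrite Rabs_left in HB by lra.
    assert (dirac_shift d T <= d ^ 2 / 4) by (unfold dirac_shift; nra).
    unfold K in L. lra.
Qed.

Lemma branch_dichotomy : (exists T, 0 < T /\ Rabs (f T) < PI / T) \/ collapse_infinite (ev j).
Proof using Hd Hev.
  destruct (classic (exists T, 0 < T /\ Rabs (f T) < PI / T)) as [H|H]; [now left|right].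
  apply branch_infinite. intros T HT. apply Rnot_lt_le. intros N. apply H. now exists T.
Qed.
End Collapse.

Theorem corollary3p3 (r : nat) (d d1 d2 d3 : R)
    (hr : (0 < r)%nat) (hd : 0 < d)
    (h1 : d1 = 1 \/ d1 = -1) (h2 : d2 = 1 \/ d2 = -1) (h3 : d3 = 1 \/ d3 = -1)
    (hodd : Nat.Odd r -> d3 = 1) :
  (exists ev, dirac_numbering r d1 d2 d3 d ev) /\
  forall ev : nat -> R -> R, dirac_numbering r d1 d2 d3 d ev ->
    (d3 = 1 ->
       (forall mu : R, exists n : nat,
          has_dim (torus_eigenspace r d1 d2 d mu) n /\
          has_card (fun j => collapse_limit (ev j) mu) n) /\
       (forall j : nat,
          (exists mu : R, torus_eigenvalue r d1 d2 d mu /\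
                          collapse_limit (ev j) mu) \/
          collapse_infinite (ev j))) /\
    (d3 = -1 -> forall j : nat, collapse_infinite (ev j)).
Proof.
  split; [now apply dirac_numbering_exists|].
  intros ev Hev. split.
  - intros ->.
    (* Dimension and number of branches are matched for every real [mu]; the case [n = 0] says that
       a number outside the torus spectrum is not a limit. *)
    assert (Count : forall mu : R, exists n : nat, has_dim (torus_eigenspace r d1 d2 d mu) n /\
      has_card (fun j => collapse_limit (ev j) mu) n).
    { intros mu. set (T0 := PI / (Rabs mu + 1)). pose proof (Rabs_pos mu). pose proof PI_RGT_0.
      assert (HT0 : 0 < T0) by (apply Rdiv_lt_0_compat; lra).
      destruct (proj2 Hev T0 HT0 (mu + dirac_shift d T0)) as [n [Hn [l [Hl [Hlen Hin]]]]].
      exists n; split.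
      - apply (torus_has_dim r d1 d2 d T0 mu); auto.
        replace (PI / T0) with (Rabs mu + 1) by (unfold T0; field; lra). lra.
      - exists l; split; [exact Hl|split; [exact Hlen|]]. intros j. rewrite Hin. symmetry.
        now apply (branch_limit_iff r d1 d2 1 d). }
    split; [exact Count|].
    intros j. destruct (branch_dichotomy r d1 d2 1 d hd ev Hev j) as [[T [HT HB]]|HI]; [left|now right].
    set (mu := ev j T - dirac_shift d T) in *.
    assert (L : collapse_limit (ev j) mu) by (apply (branch_limit r d1 d2 1 d) with (T0 := T); auto; lra).
    exists mu; split; [|exact L].
    (* Since branch [j] tends to [mu], the count is positive, and so is the dimension of the torus
       eigenspace. *)
    destruct (Count mu) as [n [Hn [l [_ [Hlen Hin]]]]]. apply (has_dim_nonzero _ n Hn).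
    apply Hin in L. destruct l; [destruct L|simpl in Hlen; lia].
  - intros E j. destruct (branch_dichotomy r d1 d2 d3 d hd ev Hev j) as [[T [HT HB]]|HI]; [exfalso|exact HI].
    (* With a nontrivial spin structure along the fibre there are no torus values, so no branch gets
       below [pi / T]. *)
    destruct (branch_value r d1 d2 d3 d hr hd h1 h2 h3 hodd ev Hev j T HT) as [[E1 _]|G]; lra.
Qed.
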